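(* Let $\mathcal{K}$ be a sum-maintainable semi-integral domain. For every q-hierarchical conjunctive query $Q$ over a vocabulary $\sigma$, the dynamic problem $\mathrm{DynEval}_{\mathcal{K}}(Q,\sigma)$ can be solved with constant-time updates and constant delay. In particular, for every $\mathsf{qh}\text{-}\mathsf{MATLANG}$ query $\mathbf{Q}$ over a matrix schema $\mathcal{S}$, $\mathrm{DynEval}_{\mathcal{K}}(\mathbf{Q},\mathcal{S})$ can also be solved with constant-time updates and constant delay.
   Context: $\mathcal{K}=(K,\oplus,\odot,\mathbb{0},\mathbb{1})$ is a commutative semiring with $\mathbb{0}\neq\mathbb{1}$. Semi-integral domain: $a\odot b=\mathbb{0}$ implies $a=\mathbb{0}$ or $b=\mathbb{0}$. Sum-maintainable: there is a data structure representing finite multisets of elements of $K$ such that the empty multiset can be built in $O(1)$, and from a structure representing $m$ one can in $O(1)$ time compute $\bigoplus_{k\in m}k$, and obtain a structure representing $m$ with one copy of $k$ inserted, or with one copy of $k$ deleted. Relational side: databases map relation symbols to $K$-relations (functions $(\mathbb{N}_{>0})^a\to K$ with finite support) and constants to positive integers ($1^{db}=1$). A CQ is $H(\bar x)\leftarrow\exists\bar y.a_1\wedge\dots\wedge a_n$ with relational atoms and comparison atoms $x\le c$ under semiring semantics; output $H(\bar d)$ = value on $\bar x\mapsto\bar d$ if $\bar d$ respects repetitions, else $\mathbb{0}$. With $\mathrm{atoms}(x)$ the set of relational atoms mentioning $x$, $Q$ is q-hierarchical if for all variables $x,y$: $\mathrm{atoms}(x)$ and $\mathrm{atoms}(y)$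 are comparable by inclusion or disjoint, and if $x$ is in $\bar x$ and $\mathrm{atoms}(x)\subsetneq\mathrm{atoms}(y)$ then $y$ is in $\bar x$. $\mathrm{Eval}_{\mathcal{K}}(Q,\sigma)$: given a database, enumerate without repetition the pairs $(\bar d,[\![Q]\!](db)(H)(\bar d))$ with non-$\mathbb{0}$ value. Updates: insertion $\mathrm{insert}(R,\bar d,k)$ sets $R(\bar d)$ to $R(\bar d)\oplus k$; deletion $\mathrm{delete}(R,\bar d)$ sets $R(\bar d)$ to $\mathbb{0}$. $\mathrm{DynEval}_{\mathcal{K}}(Q,\sigma)$ is solved with constant-time updates and constant delay if $\mathrm{Eval}_{\mathcal{K}}(Q,\sigma)$ is solved with $O(|db|)$ preprocessing ($|db|$ = number of non-$\mathbb{0}$ tuples) and $O(1)$ delay, and after every single-tuple update the maintained state can be updated in $O(1)$ time so that the outputs of the updated database can again be enumerated with $O(1)$ delay. Data complexity, RAM with uniform cost, semiring values $O(1)$ space and operations $O(1)$ time. Matrix side: schemas of size symbols and typed matrix symbols; operations $e^T$, $\cdot$ (matrix product), $\times$ (scalar multiplication by a $1\times1$ expression), $\odot$ (entrywise), $\mathbf{1}^\alpha$ (all-ones vector of type $(\alpha,1)$), $\mathbf{I}^\alpha$ (identity). $\mathsf{simple}\text{-}\mathsf{MATLANG}$: $e::=\mathbf{A}\mid\mathbf{1}^\alpha\mid\mathbf{I}^\alpha\mid e^T\mid e_1\times e_2\mid e_1\odot e_2\mid e\cdot\mathbf{1}^\alpha$; $\mathsf{qh}\text{-}\mathsf{MATLANG}$: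 $e::=e_1\mid e_1\odot(e_2\cdot(\mathbf{1}^\alpha)^T)\mid(\mathbf{1}^\alpha\cdot e_1)\odot e_2\mid(\mathbf{1}^\alpha\cdot e_1)\odot(e_2\cdot(\mathbf{1}^\alpha)^T)$ with $e_1,e_2$ in $\mathsf{simple}\text{-}\mathsf{MATLANG}$; queries $\mathbf{H}:=e$. $\mathrm{DynEval}_{\mathcal{K}}(\mathbf{Q},\mathcal{S})$ is defined analogously: instances represented sparsely by their non-$\mathbb{0}$ entries, outputs are the non-$\mathbb{0}$ entries of $\mathbf{H}$, and updates insert into or delete single matrix entries (dimensions never change), with the same guarantees.
   Formalization: The RAM is also given a unit-cost operation forming the n-fold sum of 1 in K from an integer n; without it the claim fails, e.g. for H() <- exists y. y <= c over Z[X], whose answer c·1 cannot be produced in O(1) when |db| = 0. *)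

(* Defs.v *)
From HB Require Import structures.
From mathcomp Require Import all_boot all_order all_algebra.
From mathcomp Require Import finmap multiset.
From mathcomp Require Import mathcomp_extra boolp classical_sets functions.
From mathcomp Require Import cardinality fsbigop.

Set Implicit Arguments.
Unset Strict Implicit.
Unset Printing Implicit Defensive.

Import GRing.Theory.
Local Open Scope classical_set_scope.
Local Open Scope ring_scope.

(** * Random access machines over a semiring, uniform cost

    Integers and semiring values live in separate registers and memories; a
    semiring value fills one cell, and every instruction and every test costs
    one unit.  The integer instructions are the classical ones (the registers
    hold natural numbers, so subtraction is truncated).  Control flow is
    structured instead of using jumps, which only affects constant factors. *)

(** Which operations on semiring values are elementary besides the semiring
    structure depends on how K is represented (subtraction of natural numbers,
    inspection of the representation, ...), so a machine has an arbitrary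
    family of further unit-cost operations as parameter.  A program refers to
    finitely many of them, each applied to a fixed number of registers. *)
Record prims (K : Type) := Prims {
  prim_val : nat -> seq K -> seq nat -> K;
  prim_int : nat -> seq K -> seq nat -> nat }.

Section Machine.
Variables (K : comNzSemiRingType) (P : prims K).

(** Registers are named by natural numbers; [r], [a], [b] range over integer
    registers, [u], [v], [w] over semiring registers.  Destinations come
    first.  [VNat u a] loads the multiple n%:R of 1 where n is the integer in
    [a]: integer literals of K are values that can be formed at unit cost. *)
Inductive instr :=
| IConst of nat & nat
| IMove of nat & nat
| IAdd of nat & nat & nat
| ISub of nat & nat & nat
| IMul of nat & nat & nat
| IDiv of nat & nat & nat
| ILoad (r a : nat)
| IStore (a r : nat)
| IRead (r : nat)
| IEqV (r u v : nat)
| IPrim (r i : nat) (us rs : seq nat)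
| VConst of nat & K
| VMove of nat & nat
| VAdd of nat & nat & nat
| VMul of nat & nat & nat
| VNat (u a : nat)
| VLoad (u a : nat)
| VStore (a u : nat)
| VRead (u : nat)
| VPrim (u i : nat) (us rs : seq nat)
| Output (rs : seq nat) (u : nat).

Inductive cmd :=
| Skip
| Do of instr
| Seq of cmd & cmd
| If of nat & cmd & cmd
| While of nat & cmd.

Record memory := Memory { imem : nat -> nat; vmem : nat -> K }.

Record state := State {
  ireg : nat -> nat;
  vreg : nat -> K;
  heap : memory;
  itape : seq nat;
  vtape : seq K }.

Definition upd (T : Type) (f : nat -> T) (a : nat) (x : T) : nat -> T :=
  fun b => if b == a then x else f b.

Definition set_ireg s r n :=
  State (upd (ireg s) r n) (vreg s) (heap s) (itape s) (vtape s).
Definition set_vreg s u k :=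
  State (ireg s) (upd (vreg s) u k) (heap s) (itape s) (vtape s).
Definition set_mem s m :=
  State (ireg s) (vreg s) m (itape s) (vtape s).
Definition set_tapes s ns ks :=
  State (ireg s) (vreg s) (heap s) ns ks.

Definition blank_memory := Memory (fun=> 0%N) (fun=> 0).

Definition blank_state := State (fun=> 0%N) (fun=> 0) blank_memory [::] [::].

(** Reading from an exhausted tape yields 0. *)
Definition step (i : instr) (s : state) : state :=
  let R := ireg s in let V := vreg s in
  let M := imem (heap s) in let W := vmem (heap s) in
  match i with
  | IConst r n => set_ireg s r n
  | IMove r a => set_ireg s r (R a)
  | IAdd r a b => set_ireg s r (R a + R b)%N
  | ISub r a b => set_ireg s r (R a - R b)%N
  | IMul r a b => set_ireg s r (R a * R b)%N
  | IDiv r a b => set_ireg s r (R a %/ R b)%N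
  | ILoad r a => set_ireg s r (M (R a))
  | IStore a r => set_mem s (Memory (upd M (R a) (R r)) W)
  | IRead r =>
      set_tapes (set_ireg s r (head 0%N (itape s))) (behead (itape s)) (vtape s)
  | IEqV r u v => set_ireg s r (V u == V v)
  | IPrim r i us rs => set_ireg s r (prim_int P i (map V us) (map R rs))
  | VConst u k => set_vreg s u k
  | VMove u v => set_vreg s u (V v)
  | VAdd u v w => set_vreg s u (V v + V w)
  | VMul u v w => set_vreg s u (V v * V w)
  | VNat u a => set_vreg s u (R a)%:R
  | VLoad u a => set_vreg s u (W (R a))
  | VStore a u => set_mem s (Memory M (upd W (R a) (V u)))
  | VRead u =>
      set_tapes (set_vreg s u (head 0 (vtape s))) (itape s) (behead (vtape s))
  | VPrim u i us rs => set_vreg s u (prim_val P i (map V us) (map R rs))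
  | Output _ _ => s
  end.

(** Each unit of time contributes one event to the trace of a run: [Some o]
    if [o] is output at that moment, [None] otherwise. *)
Definition event := option (seq nat * K).
Definition trace := seq event.

Definition emit (i : instr) (s : state) : event :=
  if i is Output rs u then Some (map (ireg s) rs, vreg s u) else None.

(** [exec c s s' t]: started in [s], [c] halts in [s'] with trace [t]; the
    running time is [size t]. *)
Inductive exec : cmd -> state -> state -> trace -> Prop :=
| exec_Skip s : exec Skip s s [::]
| exec_Do i s : exec (Do i) s (step i s) [:: emit i s]
| exec_Seq c1 c2 s1 s2 s3 t1 t2 :
    exec c1 s1 s2 t1 -> exec c2 s2 s3 t2 -> exec (Seq c1 c2) s1 s3 (t1 ++ t2)
| exec_If_true r c1 c2 s s' t :
    ireg s r != 0%N -> exec c1 s s' t -> exec (If r c1 c2) s s' (None :: t)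
| exec_If_false r c1 c2 s s' t :
    ireg s r = 0%N -> exec c2 s s' t -> exec (If r c1 c2) s s' (None :: t)
| exec_While_true r c s1 s2 s3 t1 t2 :
    ireg s1 r != 0%N -> exec c s1 s2 t1 -> exec (While r c) s2 s3 t2 ->
    exec (While r c) s1 s3 (None :: t1 ++ t2)
| exec_While_false r c s :
    ireg s r = 0%N -> exec (While r c) s s [:: None].

Definition outputs (t : trace) : seq (seq nat * K) := pmap id t.

Definition delay_at_most (d : nat) (t : trace) : Prop :=
  forall t1 n t2, t = t1 ++ nseq n None ++ t2 -> (n <= d)%N.

(** [c] halts silently from [s] in state [s'] after at most [n] steps. *)
Definition runs_within (n : nat) (c : cmd) (s s' : state) : Prop :=
  exists t, [/\ exec c s s' t, (size t <= n)%N & outputs t = [::]].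

(** * Sum-maintainability

    A multiset is represented by the content of a memory, [rep M m] meaning
    that [M] represents [m].  The procedures update the structure in place;
    arguments and results are passed in semiring register 0, and all other
    registers are scratch. *)
Definition sum_maintainable : Prop :=
  exists (rep : memory -> {mset K}%mset -> Prop)
         (cnew csum cins cdel : cmd) (d : nat),
  [/\ (forall s, heap s = blank_memory ->
         exists2 s', runs_within d cnew s s' & rep (heap s') mset0),
      (forall s m, rep (heap s) m ->
         exists2 s', runs_within d csum s s' &
           rep (heap s') m /\ vreg s' 0%N = \sum_(k <- enum_mset m) k),
      (forall s m, rep (heap s) m ->
         exists2 s', runs_within d cins s s' &
           rep (heap s') (vreg s 0%N +` m)%mset) &
      (forall s m, rep (heap s) m -> vreg s 0%N \in m ->
         exists2 s', runs_within d cdel s s' &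
           rep (heap s') (m `\ vreg s 0%N)%mset)].

(** * Dynamic enumeration problems

    [enc_inst I w] says that the pair of tapes [w] is an encoding of [I]
    (an instance has several encodings, as its non-zero entries may be listed
    in any order), and [answer I d k] that [(d, k)] has to be enumerated. *)
Record dyn_problem := DynProblem {
  inst : Type;
  update : inst -> Type;
  apply_update : forall I : inst, update I -> inst;
  inst_size : inst -> nat;
  enc_inst : inst -> seq nat * seq K -> Prop;
  enc_update : forall I : inst, update I -> seq nat * seq K;
  answer : inst -> seq nat -> K -> Prop }.

Definition enumerates (A : seq nat -> K -> Prop) (d : nat) (c : cmd)
    (s s' : state) : Prop :=
  exists t, [/\ exec c s s' t, delay_at_most d t,
    uniq (unzip1 (outputs t)) &
    forall x k, (x, k) \in outputs t <-> A x k].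

(** Linear-time preprocessing, constant-time updates, constant delay.  [inv]
    is the invariant tying the maintained state to the current instance; it
    survives an enumeration, so updates and enumerations may be interleaved. *)
Definition dyn_solvable (D : dyn_problem) : Prop :=
  exists (inv : inst D -> state -> Prop) (cpre cupd cenum : cmd) (d : nat),
  [/\ (forall (I : inst D) w, enc_inst I w ->
         exists2 s, runs_within (d * (inst_size I).+1) cpre
                      (set_tapes blank_state w.1 w.2) s & inv I s),
      (forall (I : inst D) (x : update I) s, inv I s ->
         exists2 s', runs_within d cupd
                       (set_tapes s (enc_update x).1 (enc_update x).2) s' &
           inv (apply_update x) s') &
      (forall (I : inst D) s, inv I s ->
         exists2 s', enumerates (answer I) d cenum (set_tapes s [::] [::]) s' &
           inv I s')].

End Machine.

Definition semi_integral (K : comNzSemiRingType) : Prop :=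
  forall a b : K, a * b = 0 -> a = 0 \/ b = 0.

(** * Conjunctive queries over K-relations *)

Definition posnat := {n : nat | (0 < n)%N}.

Record vocabulary := Vocabulary {
  rsym : finType;
  arity : rsym -> nat;
  csym : finType }.

(** [None] is the constant symbol 1. *)
Definition const (sg : vocabulary) := option (csym sg).

Definition fact (sg : vocabulary) := {R : rsym sg & (arity R).-tuple posnat}.

(** The relations of a database, one finitely supported function for each
    symbol, are uncurried into one such function on all facts. *)
Record database (K : comNzSemiRingType) (sg : vocabulary) := Database {
  facts : {fsfun fact sg -> K with 0};
  cval : csym sg -> posnat }.

Definition const_val K sg (db : database K sg) (c : const sg) : nat :=
  if c is Some c' then val (cval db c') else 1%N.

Definition ratom (sg : vocabulary) (n : nat) :=
  {R : rsym sg & (arity R).-tuple 'I_n}.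

Definition args sg n (a : ratom sg n) : seq 'I_n := tval (tagged a).

(** The variables are ['I_nvar]; those outside [qhead] are the existentially
    quantified ones.  [comps] lists the atoms [x <= c]. *)
Record cq (sg : vocabulary) := CQ {
  nvar : nat;
  qhead : seq 'I_nvar;
  rels : seq (ratom sg nvar);
  comps : seq ('I_nvar * const sg);
  _ : forall x : 'I_nvar,
        has (fun a => x \in args a) rels || (x \in unzip1 comps) }.

Definition atoms_of sg (Q : cq sg) (x : 'I_(nvar Q)) :
    {set ratom sg (nvar Q)} :=
  [set a in rels Q | x \in args a]%SET.

Definition q_hierarchical sg (Q : cq sg) : Prop :=
  (forall x y : 'I_(nvar Q),
     [|| atoms_of x \subset atoms_of y, atoms_of y \subset atoms_of x
       | [disjoint atoms_of x & atoms_of y]]) /\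
  (forall x y : 'I_(nvar Q), x \in qhead Q ->
     atoms_of x \proper atoms_of y -> y \in qhead Q).

Section CQSemantics.
Variables (K : comNzSemiRingType) (sg : vocabulary) (Q : cq sg).
Implicit Types (db : database K sg) (nu : {ffun 'I_(nvar Q) -> posnat}).

Definition ratom_val db nu (a : ratom sg (nvar Q)) : K :=
  facts db (Tagged (fun R => (arity R).-tuple posnat)
                   (map_tuple nu (tagged a))).

Definition comp_val db nu (a : 'I_(nvar Q) * const sg) : K :=
  if (val (nu a.1) <= const_val db a.2)%N then 1 else 0.

Definition body_val db nu : K :=
  (\prod_(a <- rels Q) ratom_val db nu a) *
  (\prod_(a <- comps Q) comp_val db nu a).

(** The index set is empty, hence the value 0, when [d] does not respect the
    repetitions in the head.  Every variable occurs in the body, so only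
    finitely many summands are non-zero. *)
Definition cq_val db (d : seq posnat) : K :=
  \sum_(nu \in [set nu : {ffun 'I_(nvar Q) -> posnat} |
                  [seq nu x | x <- qhead Q] = d]) body_val db nu.

End CQSemantics.

Variant db_update (K : Type) (sg : vocabulary) :=
| Insert of fact sg & K
| Delete of fact sg.

Definition db_apply K sg (db : database K sg) (x : db_update K sg) :=
  match x with
  | Insert f k => Database [fsfun facts db with f |-> facts db f + k] (cval db)
  | Delete f => Database [fsfun facts db with f |-> 0] (cval db)
  end.

Definition enc_fact sg (f : fact sg) : seq nat :=
  nat_of_ord (enum_rank (tag f)) :: [seq val n | n <- tagged f].

Definition enc_db_update K sg (x : db_update K sg) : seq nat * seq K :=
  match x with
  | Insert f k => (0%N :: enc_fact f, [:: k])
  | Delete f => (1%N :: enc_fact f, [::])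
  end.

(** Values of the constants, number of non-zero facts, then these facts. *)
Definition enc_db K sg (db : database K sg) (w : seq nat * seq K) : Prop :=
  exists2 l : seq (fact sg), perm_eq l (finsupp (facts db)) &
    w = ([seq val (cval db c) | c <- enum (csym sg)]
           ++ size l :: flatten [seq enc_fact f | f <- l],
         [seq facts db f | f <- l]).

Definition DynEvalCQ (K : comNzSemiRingType) sg (Q : cq sg) : dyn_problem K :=
  {| inst := database K sg;
     update := fun=> db_update K sg;
     apply_update := @db_apply K sg;
     inst_size := fun db => size (finsupp (facts db));
     enc_inst := @enc_db K sg;
     enc_update := fun _ x => enc_db_update x;
     answer := fun db d k =>
       exists d' : seq posnat,
         [/\ d = [seq val n | n <- d'], k = cq_val Q db d' & k != 0] |}.

(** * MATLANG *)

(** Size symbols are [option sz], with [None] the size symbol 1. *)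
Record schema := Schema {
  sz : finType;
  msym : finType;
  mrow : msym -> option sz;
  mcol : msym -> option sz }.

Section Expr.
Variable S : schema.

Inductive expr : option (sz S) -> option (sz S) -> Type :=
| EMat (A : msym S) : expr (mrow A) (mcol A)
| EOnes a : expr a None
| EId a : expr a a
| ETr a b : expr a b -> expr b a
| EMul a b c : expr a b -> expr b c -> expr a c
| EScale a b : expr None None -> expr a b -> expr a b
| EHad a b : expr a b -> expr a b -> expr a b.

Inductive simple_matlang : forall a b, expr a b -> Prop :=
| simple_Mat A : simple_matlang (EMat A)
| simple_Ones a : simple_matlang (EOnes a)
| simple_Id a : simple_matlang (EId a)
| simple_Tr a b (e : expr a b) :
    simple_matlang e -> simple_matlang (ETr e)
| simple_Scale a b (e1 : expr None None) (e2 : expr a b) :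
    simple_matlang e1 -> simple_matlang e2 -> simple_matlang (EScale e1 e2)
| simple_Had a b (e1 e2 : expr a b) :
    simple_matlang e1 -> simple_matlang e2 -> simple_matlang (EHad e1 e2)
| simple_Sum a b (e : expr a b) :
    simple_matlang e -> simple_matlang (EMul e (EOnes b)).

Inductive qh_matlang : forall a b, expr a b -> Prop :=
| qh_simple a b (e1 : expr a b) :
    simple_matlang e1 -> qh_matlang e1
| qh_row a b (e1 : expr a b) (e2 : expr a None) :
    simple_matlang e1 -> simple_matlang e2 ->
    qh_matlang (EHad e1 (EMul e2 (ETr (EOnes b))))
| qh_col a b (e1 : expr None b) (e2 : expr a b) :
    simple_matlang e1 -> simple_matlang e2 ->
    qh_matlang (EHad (EMul (EOnes a) e1) e2)
| qh_row_col a b (e1 : expr None b) (e2 : expr a None) :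
    simple_matlang e1 -> simple_matlang e2 ->
    qh_matlang (EHad (EMul (EOnes a) e1) (EMul e2 (ETr (EOnes b)))).

End Expr.

Definition dim_of (S : schema) (D : sz S -> posnat) (a : option (sz S)) : nat :=
  if a is Some a' then val (D a') else 1%N.

Record minst (K : Type) (S : schema) := MInst {
  mdim : sz S -> posnat;
  mat : forall A : msym S, 'M[K]_(dim_of mdim (mrow A), dim_of mdim (mcol A)) }.

Fixpoint eval (K : comNzSemiRingType) (S : schema) (I : minst K S) a b
    (e : expr a b) : 'M[K]_(dim_of (mdim I) a, dim_of (mdim I) b) :=
  match e with
  | EMat A => mat I A
  | EOnes _ => const_mx 1
  | EId _ => 1%:M
  | ETr _ _ e1 => (eval I e1)^T
  | EMul _ _ _ e1 e2 => eval I e1 *m eval I e2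
  | EScale _ _ e1 e2 => (eval I e1 : 'M_1) ord0 ord0 *: eval I e2
  | EHad _ _ e1 e2 => map2_mx *%R (eval I e1) (eval I e2)
  end.

Section MatrixInstances.
Variables (K : comNzSemiRingType) (S : schema).
Implicit Type I : minst K S.

(** Positions (A, i, j) of the entries of an instance. *)
Definition pos_of I (A : msym S) : finType :=
  ('I_(dim_of (mdim I) (mrow A)) * 'I_(dim_of (mdim I) (mcol A)))%type.

Definition pos I : finType := {A : msym S & pos_of I A}.

Definition entry I (p : pos I) : K := mat I (tag p) (tagged p).1 (tagged p).2.

Variant minst_update I :=
| MInsert of pos I & K
| MDelete of pos I.

Definition map_entries I (F : pos I -> K) : minst K S :=
  MInst (fun A => \matrix_(i, j) F (Tagged (pos_of I) ((i, j) : pos_of I A))).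

Definition minst_apply I (x : minst_update I) : minst K S :=
  match x with
  | MInsert p k => map_entries (fun q => if q == p then entry q + k else entry q)
  | MDelete p => map_entries (fun q => if q == p then 0 else entry q)
  end.

(** Rows and columns are numbered from 1 on the tapes. *)
Definition enc_pos I (p : pos I) : seq nat :=
  [:: nat_of_ord (enum_rank (tag p)); (tagged p).1.+1; (tagged p).2.+1].

Definition enc_minst_update I (x : minst_update I) : seq nat * seq K :=
  match x with
  | MInsert p k => (0%N :: enc_pos p, [:: k])
  | MDelete p => (1%N :: enc_pos p, [::])
  end.

(** Dimensions, number of non-zero entries, then these entries. *)
Definition enc_minst I (w : seq nat * seq K) : Prop :=
  exists2 l : seq (pos I), perm_eq l (enum [pred p : pos I | entry p != 0]) &
    w = ([seq val (mdim I a) | a <- enum (sz S)]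
           ++ size l :: flatten [seq enc_pos p | p <- l],
         [seq entry p | p <- l]).

Definition DynEvalMatlang a b (e : expr a b) : dyn_problem K :=
  {| inst := minst K S;
     update := minst_update;
     apply_update := minst_apply;
     inst_size := fun I => #|[pred p : pos I | entry p != 0]|;
     enc_inst := enc_minst;
     enc_update := enc_minst_update;
     answer := fun I d k =>
       exists i j, [/\ d = [:: (nat_of_ord i).+1; (nat_of_ord j).+1],
                       k = eval I e i j & k != 0] |}.

End MatrixInstances.

(* Main.v *)
(** A query plan is a tree whose leaves are atoms and whose inner nodes multiply,
    sum over a variable or enumerate a variable; every atom below a binder
    contains the bound variable.  For each valuation of the variables bound
    above it, a binder stores the values of its child: in a sum-maintained
    multiset if the variable is summed over, in an array closed under
    swap-deletion if it is enumerated.  An update of a tuple then changes one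
    entry at each binder above an atom.  Enumeration is a nest of loops over the
    arrays; without zero divisors, no loop meets a value that does not extend
    to an output, so that the delay is constant.

    For a q-hierarchical query, eliminating first the quantified and then the
    free variables, those with the fewest atoms first, yields a plan.  A
    simple-MATLANG expression denotes a product of a scalar, factors depending on
    the row or on the column only, matrix entries and possibly a diagonal test;
    qh-MATLANG only adds row factors or column factors, and the plan is
    read off. *)

Require Import Defs.
From HB Require Import structures.
From mathcomp Require Import all_boot all_algebra.
From mathcomp Require Import zify.
From mathcomp Require Import finmap multiset.
From mathcomp Require Import boolp classical_sets fsbigop.

Set Implicit Arguments.
Unset Strict Implicit.
Unset Printing Implicit Defensive.

Import GRing.Theory.

(** Constant-time lookup rests on addressing: addresses are unbounded, so an injective pairing sends
    area, key and index straight to a cell, and cells never written read 0. This zero state is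
    arranged to be the valid state of the empty database (sum structures are created at their first
    insertion, constants are stored minus one), so that preprocessing is a series of insertions.

    The given sum programs act on a whole memory, while each key of a quantified binder wants its
    own structure; they are therefore simulated inside a part of the memory, at no more than four
    times their cost.

    A free binder shows the level above only 0 or 1, according to whether its array is empty. As
    there are no zero divisors, nonzero stored values match the existence of outputs below. A single
    test at the root then guarantees that every loop entered runs at least once, the fact behind the
    delay bound.

    A variable that occurs in comparisons only has no atom to hang on: quantified, it becomes a
    numeric factor; free, a range loop. Constants are positive, so such a loop is not empty
    either. *)

Lemma updE T (f : nat -> T) a x b : upd f a x b = if b == a then x else f b.
Proof. by []. Qed.

Lemma updxx T (f : nat -> T) a x : upd f a x a = x.
Proof. by rewrite /upd eqxx. Qed.

Lemma upd_neq T (f : nat -> T) a x b : b != a -> upd f a x b = f b.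
Proof. by rewrite /upd => /negbTE ->. Qed.

Lemma upd_id T (f : nat -> T) a : upd f a (f a) = f.
Proof. by apply: funext => b; rewrite /upd; case: eqP => [->|]. Qed.

(** * An injective pairing of addresses *)

Fact npair_key : unit. Proof. exact: tt. Qed.

(** A variant of Cantor pairing that takes three instructions: the value lies in the interval from
    [(a + b) ^ 2] to below [(a + b + 1) ^ 2], which determines the sum and then [a]. It is locked so
    that simplification leaves addresses folded. *)
Definition npair : nat -> nat -> nat :=
  locked_with npair_key (fun a b => (a + b) * (a + b) + a).

Lemma npairE a b : npair a b = (a + b) * (a + b) + a.
Proof. by rewrite /npair unlock. Qed.

Lemma npair_eq a b a' b' : (npair a b == npair a' b') = (a == a') && (b == b').
Proof.
apply/eqP/andP => [|[/eqP-> /eqP->] //].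
rewrite !npairE => H; have lt x y u v : x + y < u + v ->
    (x + y) * (x + y) + x < (u + v) * (u + v) + u.
  by move=> h; have := leq_mul h h; nia.
have e : a + b = a' + b'.
  case: (ltngtP (a + b) (a' + b')) => // /lt; lia.
by rewrite e in H; split; apply/eqP; lia.
Qed.

(** * Silent runs *)

Section Runs.
Variables (K : comNzSemiRingType) (P : prims K).
(** The time charged to a loop: every loop that we run silently stops within
    [D] steps, so that [cost] bounds all silent runs. *)
Variable D : nat.
Implicit Types (s : state K) (i : instr K) (c : cmd K) (Q : state K -> Prop).

Fixpoint cost c : nat :=
  match c with
  | Skip => 0
  | Do _ => 1
  | Seq c1 c2 => cost c1 + cost c2
  | If _ c1 c2 => (maxn (cost c1) (cost c2)).+1
  | While _ _ => D
  end.

(** A loop is charged [D] whatever it does, so only the running time capped at [D] can be bounded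
    for all programs; the cap is what carries the induction through loops. *)
Lemma minn_size_exec c s s' t : exec P c s s' t -> minn (size t) D <= cost c.
Proof. by elim => //=; intros; rewrite ?size_cat; lia. Qed.

Definition silent i := if i is Output _ _ then false else true.

(** Total correctness with silence and the time bound built in: a program proof in this form yields
    its running time for free, as [cost]. *)
Definition wp c s Q := exists s' t,
  [/\ exec P c s s' t, size t <= cost c, outputs t = [::] & Q s'].

(** The entry point for programs whose running time is known from outside, namely the relocated sum
    programs. *)
Lemma wp_bounded c s s' t Q : exec P c s s' t -> size t <= D ->
  outputs t = [::] -> Q s' -> wp c s Q.
Proof.
move=> e h o q; exists s', t; split=> //.
by have := minn_size_exec e; rewrite (minn_idPl h).
Qed.

Lemma wp_mono c s Q Q' : (forall s', Q s' -> Q' s') -> wp c s Q -> wp c s Q'.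
Proof. by move=> h [s' [t [? ? ? /h ?]]]; exists s', t. Qed.

Lemma wp_skip s Q : Q s -> wp (Skip K) s Q.
Proof. by move=> q; exists s, [::]; split=> //; constructor. Qed.

Lemma wp_do i s Q : silent i -> Q (step P i s) -> wp (Do i) s Q.
Proof.
move=> si q; exists (step P i s), [:: emit i s]; split=> //; first by constructor.
by case: i si {q}.
Qed.

Lemma outputs_cat (t1 t2 : trace K) : outputs (t1 ++ t2) = outputs t1 ++ outputs t2.
Proof. by rewrite /outputs pmap_cat. Qed.

Lemma wp_seq c1 c2 s Q : wp c1 s (fun s' => wp c2 s' Q) -> wp (Seq c1 c2) s Q.
Proof.
move=> [s1 [t1 [e1 l1 o1 [s2 [t2 [e2 l2 o2 q]]]]]].
exists s2, (t1 ++ t2); split=> //; first exact: exec_Seq e1 e2.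
  by rewrite size_cat /= leq_add.
by rewrite outputs_cat o1 o2.
Qed.

Lemma wp_if r c1 c2 s Q :
  (ireg s r != 0 -> wp c1 s Q) -> (ireg s r = 0 -> wp c2 s Q) ->
  wp (If r c1 c2) s Q.
Proof.
move=> h1 h2; case: (eqVneq (ireg s r) 0) => [e|n].
  have [s2 [t2 [e2 l2 o2 q]]] := h2 e.
  exists s2, (None :: t2); split=> //; first exact: exec_If_false.
  by rewrite /= ltnS leq_max l2 orbT.
have [s2 [t2 [e2 l2 o2 q]]] := h1 n.
exists s2, (None :: t2); split=> //; first exact: exec_If_true.
by rewrite /= ltnS leq_max l2.
Qed.

Fixpoint block (p : seq (instr K)) : cmd K :=
  if p is i :: p' then Seq (Do i) (block p') else Skip K.

Fixpoint steps (p : seq (instr K)) s : state K :=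
  if p is i :: p' then steps p' (step P i s) else s.

Lemma steps_cat p q s : steps (p ++ q) s = steps q (steps p s).
Proof. by elim: p s => //=. Qed.

Lemma wp_runs c s Q : wp c s Q ->
  forall n, cost c <= n -> exists2 s', runs_within P n c s s' & Q s'.
Proof.
move=> [s' [t [? l ? ?]]] n ln; exists s' => //; exists t; split=> //.
exact: leq_trans ln.
Qed.

End Runs.

(** Work registers are those below 32; [remb] holds the registers of a relocated
    program, and the four other families survive silent subroutines. *)
Definition rvar x := 33 + 8 * x.
Definition rcnt x := 35 + 8 * x.
Definition rarg x := 37 + 8 * x.
Definition rcst x := 39 + 8 * x.
Definition remb r := 32 + 2 * r.
Definition rodd k := 33 + 2 * k.

Definition mpair K r a b : seq (instr K) :=
  [:: IAdd _ r a b; IMul _ r r r; IAdd _ r r a].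

Lemma mpairE K P r a b (s : state K) : a != r ->
  steps P (mpair K r a b) s = set_ireg s r (npair (ireg s a) (ireg s b)).
Proof.
case: s => R V M t w /negbTE n; rewrite /mpair /= /set_ireg /=; congr State.
by apply: funext => q; rewrite !updE eqxx n npairE; case: eqP.
Qed.

(** * Relocation

    Every key of a summing binder has its own sum structure: the given programs
    are run inside the lane [L] of the memory, the cells [npair L a]. *)

Section Relocation.
Variables (K : comNzSemiRingType) (P : prims K).
Implicit Types (s : state K) (i : instr K) (c : cmd K) (h : memory K).

Definition lane L h : memory K :=
  Memory (fun a => imem h (npair L a)) (fun a => vmem h (npair L a)).

(** Address computations use register 2; register 1 holds the lane. *)
Definition reloc_addr a : seq (instr K) :=
  mpair K 2 1 (remb a).

(** The simulated machine has empty tapes, so reading becomes loading 0 and the real tapes are left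
    alone. Outputs are dropped; the runs simulated are silent anyway. *)
Definition reloc_instr i : seq (instr K) :=
  match i with
  | IConst r n => [:: IConst _ (remb r) n]
  | IMove r a => [:: IMove _ (remb r) (remb a)]
  | IAdd r a b => [:: IAdd _ (remb r) (remb a) (remb b)]
  | ISub r a b => [:: ISub _ (remb r) (remb a) (remb b)]
  | IMul r a b => [:: IMul _ (remb r) (remb a) (remb b)]
  | IDiv r a b => [:: IDiv _ (remb r) (remb a) (remb b)]
  | ILoad r a => reloc_addr a ++ [:: ILoad _ (remb r) 2]
  | IStore a r => reloc_addr a ++ [:: IStore _ 2 (remb r)]
  | IRead r => [:: IConst _ (remb r) 0]
  | IEqV r u v => [:: IEqV _ (remb r) (remb u) (remb v)]
  | IPrim r j us rs => [:: IPrim _ (remb r) j (map remb us) (map remb rs)]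
  | VConst u k => [:: VConst (remb u) k]
  | VMove u v => [:: VMove _ (remb u) (remb v)]
  | VAdd u v w => [:: VAdd _ (remb u) (remb v) (remb w)]
  | VMul u v w => [:: VMul _ (remb u) (remb v) (remb w)]
  | VNat u a => [:: VNat _ (remb u) (remb a)]
  | VLoad u a => reloc_addr a ++ [:: VLoad _ (remb u) 2]
  | VStore a u => reloc_addr a ++ [:: VStore _ 2 (remb u)]
  | VRead u => [:: VConst (remb u) 0%R]
  | VPrim u j us rs => [:: VPrim _ (remb u) j (map remb us) (map remb rs)]
  | Output _ _ => [::]
  end.

Fixpoint reloc c : cmd K :=
  match c with
  | Skip => Skip K
  | Do i => block (reloc_instr i)
  | Seq c1 c2 => Seq (reloc c1) (reloc c2)
  | If r c1 c2 => If (remb r) (reloc c1) (reloc c2)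
  | While r c1 => While (remb r) (reloc c1)
  end.

(** The simulation relation: [s0] lives in the even registers from 32 on and in lane [L]. *)
Definition emb L s0 s :=
  [/\ forall r, ireg s (remb r) = ireg s0 r,
      forall r, vreg s (remb r) = vreg s0 r,
      lane L (heap s) = heap s0, ireg s 1 = L &
      itape s0 = [::] /\ vtape s0 = [::]].

Definition emb_frame L s s' :=
  [/\ forall r, r < 32 -> r != 2 -> ireg s' r = ireg s r,
      forall k, ireg s' (rodd k) = ireg s (rodd k),
      (forall r, r < 32 -> vreg s' r = vreg s r) /\
        (forall k, vreg s' (rodd k) = vreg s (rodd k)),
      forall L' a, L' != L -> imem (heap s') (npair L' a) = imem (heap s) (npair L' a)
          /\ vmem (heap s') (npair L' a) = vmem (heap s) (npair L' a) &
      itape s' = itape s /\ vtape s' = vtape s].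

Lemma emb_frame_trans L s1 s2 s3 :
  emb_frame L s1 s2 -> emb_frame L s2 s3 -> emb_frame L s1 s3.
Proof.
move=> [a1 b1 [c1 c1'] d1 [e1 f1]] [a2 b2 [c2 c2'] d2 [e2 f2]]; split.
- by move=> r hr hr'; rewrite a2 // a1.
- by move=> k; rewrite b2 b1.
- by split=> [r hr|k]; [rewrite c2 // c1 | rewrite c2' c1'].
- by move=> L' a hL; have [-> ->] := d2 L' a hL; apply: d1.
- by rewrite e2 f2.
Qed.

Lemma remb_eq r r' : (remb r == remb r') = (r == r').
Proof. by rewrite /remb eqn_add2l eqn_pmul2l. Qed.
Lemma remb_lo r n : n < 32 -> (n == remb r) = false.
Proof. by rewrite /remb; lia. Qed.
Lemma remb_lo' r n : n < 32 -> (remb r == n) = false.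
Proof. by rewrite /remb; lia. Qed.
Lemma rodd_lo r n : n < 32 -> (rodd r == n) = false.
Proof. by rewrite /rodd; lia. Qed.
Lemma rodd_remb r r' : (rodd r == remb r') = false.
Proof. by rewrite /rodd /remb; lia. Qed.

Lemma map_remb (T : Type) (f g : nat -> T) us :
  (forall r, f (remb r) = g r) -> map f (map remb us) = map g us.
Proof. by move=> h; rewrite -map_comp; apply: eq_map => r /=. Qed.

Let regs := (remb_eq, fun r => @remb_lo' r 1 isT, fun r => @remb_lo' r 2 isT,
  rodd_remb, fun r => @rodd_lo r 1 isT, fun r => @rodd_lo r 2 isT,
  fun r => @remb_lo r 1 isT).

Lemma emb_set_ireg L s0 s r n n' : n = n' -> emb L s0 s ->
  emb L (set_ireg s0 r n) (set_ireg s (remb r) n') /\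
  emb_frame L s (set_ireg s (remb r) n').
Proof.
move=> -> [hi hv hl h1 ht]; split; split=> //=.
- by move=> q; rewrite !updE !regs hi.
- by move=> q h _; rewrite updE remb_lo.
- by move=> k; rewrite updE regs.
Qed.

Lemma emb_set_vreg L s0 s r n n' : n = n' -> emb L s0 s ->
  emb L (set_vreg s0 r n) (set_vreg s (remb r) n') /\
  emb_frame L s (set_vreg s (remb r) n').
Proof.
move=> -> [hi hv hl h1 ht]; split; split=> //=.
- by move=> q; rewrite !updE !regs hv.
- by split=> [q h|k]; rewrite updE; [rewrite remb_lo | rewrite regs].
Qed.

Lemma emb_addr L s0 s a : emb L s0 s ->
  [/\ emb L s0 (steps P (reloc_addr a) s),
      emb_frame L s (steps P (reloc_addr a) s) &
      ireg (steps P (reloc_addr a) s) 2 = npair L (ireg s0 a)].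
Proof.
move=> [hi hv hl h1 ht]; rewrite /reloc_addr mpairE //; split.
- by split=> // q; rewrite /= updE regs.
- by split=> // r h /negbTE e; rewrite /= updE e.
- by rewrite /= updxx h1 hi.
Qed.

Lemma emb_store L s0 s a M W : emb L s0 s ->
  (forall b, imem M (npair L b) = imem W b) -> (forall b, vmem M (npair L b) = vmem W b) ->
  (forall b, b != npair L a -> imem M b = imem (heap s) b /\ vmem M b = vmem (heap s) b) ->
  emb L (Defs.set_mem s0 W) (Defs.set_mem s M) /\ emb_frame L s (Defs.set_mem s M).
Proof.
move=> [hi hv hl h1 ht] hI hV hM; split; split=> //=.
  by case: W hI hV => I V /= hI hV; congr Memory; apply: funext.
by move=> L' b n; apply: hM; rewrite npair_eq (negbTE n).
Qed.

Lemma reloc_instr_ok i L s0 s : emb L s0 s ->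
  emb L (step P i s0) (steps P (reloc_instr i) s) /\
  emb_frame L s (steps P (reloc_instr i) s).
Proof.
move=> E; have [hi hv hl h1 [hti htv]] := E.
have X s1 s2 s3 : emb_frame L s s1 -> emb L s2 s3 /\ emb_frame L s1 s3 ->
    emb L s2 s3 /\ emb_frame L s s3.
  by move=> f [e f']; split=> //; apply: emb_frame_trans f'.
have T s1 s2 : emb L (set_tapes s1 [::] [::]) s2 -> itape s1 = [::] -> vtape s1 = [::] -> emb L s1 s2.
  by case: s1 => ? ? ? ? ? /= + -> ->.
case: i => [r n|r a|r a b|r a b|r a b|r a b|r a|a r|r|r u v|r j us rs
           |u k|u v|u v w|u v w|u a|u a|a u|u|u j us rs|rs u];
  rewrite /reloc_instr ?steps_cat.
- exact: emb_set_ireg.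
- exact: emb_set_ireg.
- by apply: emb_set_ireg; rewrite ?hi.
- by apply: emb_set_ireg; rewrite ?hi.
- by apply: emb_set_ireg; rewrite ?hi.
- by apply: emb_set_ireg; rewrite ?hi.
- move: (emb_addr a E); move: (steps P (reloc_addr a) s) => s1 [E1 F1 e];
    apply: (X _ _ _ F1); apply: emb_set_ireg => //.
  by rewrite e; have [_ _ <- _ _] := E1.
- move: (emb_addr a E); move: (steps P (reloc_addr a) s) => s1 [E1 F1 e]; apply: (X _ _ _ F1) => /=.
  have [hi1 hv1 hl1 _ _] := E1.
  apply: (@emb_store _ _ _ (ireg s0 a)) => // b; rewrite /= ?e -?hl1 //= ?updE ?npair_eq ?eqxx ?hi1 //.
  by move/negbTE => ->.
- have [e f] := @emb_set_ireg L s0 s r 0 0 erefl E.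
  split; last exact: f.
  by apply: T; rewrite /= ?hti ?htv //; case: e.
- by apply: emb_set_ireg; rewrite ?hv.
- by apply: emb_set_ireg; rewrite ?(map_remb _ hi) ?(map_remb _ hv).
- exact: emb_set_vreg.
- exact: emb_set_vreg.
- by apply: emb_set_vreg; rewrite ?hv.
- by apply: emb_set_vreg; rewrite ?hv.
- by apply: emb_set_vreg; rewrite ?hi.
- move: (emb_addr a E); move: (steps P (reloc_addr a) s) => s1 [E1 F1 e];
    apply: (X _ _ _ F1); apply: emb_set_vreg => //.
  by rewrite e; have [_ _ <- _ _] := E1.
- move: (emb_addr a E); move: (steps P (reloc_addr a) s) => s1 [E1 F1 e]; apply: (X _ _ _ F1) => /=.
  have [hi1 hv1 hl1 _ _] := E1.
  apply: (@emb_store _ _ _ (ireg s0 a)) => // b; rewrite /= ?e -?hl1 //= ?updE ?npair_eq ?eqxx ?hv1 //.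
  by move/negbTE => ->.
- have [e f] := @emb_set_vreg L s0 s u 0%R 0%R erefl E.
  split; last exact: f.
  by apply: T; rewrite /= ?hti ?htv //; case: e.
- by apply: emb_set_vreg; rewrite ?(map_remb _ hi) ?(map_remb _ hv).
- by split.
Qed.

Lemma exec_block p s : all (@silent K) p ->
  exists t, [/\ exec P (block p) s (steps P p s) t, size t = size p & outputs t = [::]].
Proof.
elim: p s => [|i p IH] s /=; first by exists [::]; split=> //; constructor.
case/andP=> si /IH-/(_ (step P i s))[t [e l o]].
exists ([:: emit i s] ++ t); split.
- by apply: exec_Seq e; constructor.
- by rewrite /= l.
- by case: i si {e}.
Qed.

(** The factor 4 comes from memory accesses: three instructions compute the paired address, one
    accesses it. *)
Lemma reloc_ok c s0 s0' t0 : exec P c s0 s0' t0 -> forall L s, emb L s0 s ->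
  exists s' t, [/\ exec P (reloc c) s s' t, size t <= 4 * size t0,
    outputs t = [::], emb L s0' s' & emb_frame L s s'].
Proof.
elim=> {c s0 s0' t0}.
- by move=> s0 L s E; exists s, [::]; split=> //; constructor.
- move=> i s0 L s /(reloc_instr_ok i) [E F].
  have [|t [e l o]] := @exec_block (reloc_instr i) s; first by case: (i).
  by exists (steps P (reloc_instr i) s), t; split=> //; rewrite l; case: (i).
- move=> c1 c2 s1 s2 s3 t1 t2 _ IH1 _ IH2 L s /IH1[s' [t [e l o /IH2[s'' [t' [e' l' o' E' F']]] F]]].
  exists s'', (t ++ t'); split=> //; first exact: exec_Seq e e'.
  - by rewrite !size_cat mulnDr leq_add.
  - by rewrite outputs_cat o o'.
  - exact: emb_frame_trans F F'.
- move=> r c1 c2 s0 s0' t0 n _ IH L s E; have [s' [t [e l o E' F]]] := IH _ _ E.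
  exists s', (None :: t); split=> //; last by rewrite /=; lia.
  by apply: exec_If_true => //; case: E => ->.
- move=> r c1 c2 s0 s0' t0 n _ IH L s E; have [s' [t [e l o E' F]]] := IH _ _ E.
  exists s', (None :: t); split=> //; last by rewrite /=; lia.
  by apply: exec_If_false => //; case: E => ->.
- move=> r c s1 s2 s3 t1 t2 n _ IH1 _ IH2 L s E.
  have [s' [t [e l o /IH2[s'' [t' [e' l' o' E' F']]] F]]] := IH1 _ _ E.
  exists s'', (None :: t ++ t'); split=> //.
  - by apply: exec_While_true e e'; case: E => ->.
  - by rewrite /= !size_cat; lia.
  - by rewrite /= outputs_cat o o'.
  - exact: emb_frame_trans F F'.
- move=> r c s0 n L s E; exists s, [:: None]; split=> //.
  by apply: exec_While_false; case: E => ->.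
Qed.

End Relocation.

(** * Query plans *)

(** [Leaf q xs bs] is the atom of symbol [q] at the variables [xs], where [(i, c)]
    in [bs] bounds the [i]-th argument by the constant [c]; [Cst c cs] is the
    minimum of constants as a multiple of 1, [Rng x c cs] bounds the free
    variable [x] by that minimum; [Bind fr x t] enumerates [x] if [fr] and sums
    over [x] otherwise. *)
Inductive tree :=
| Leaf (q : nat) (xs : seq nat) (bs : seq (nat * nat))
| Cst (c : nat) (cs : seq nat)
| Rng (x c : nat) (cs : seq nat)
| Mul (t1 t2 : tree)
| Bind (fr : bool) (x : nat) (t : tree).

Fixpoint fv t : seq nat :=
  match t with
  | Leaf _ _ _ | Cst _ _ => [::]
  | Rng x _ _ => [:: x]
  | Mul t1 t2 => fv t1 ++ fv t2
  | Bind fr x t => if fr then x :: fv t else fv t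
  end.

(** Nodes are numbered by the memory areas that they own: one for the values of
    an atom, three for the children of a binder. *)
Fixpoint areas t : nat :=
  match t with
  | Leaf _ _ _ => 1
  | Cst _ _ | Rng _ _ _ => 0
  | Mul t1 t2 => areas t1 + areas t2
  | Bind _ _ t => 3 + areas t
  end.

Fixpoint leaf_at b t j : option (nat * seq nat * seq (nat * nat)) :=
  match t with
  | Leaf q xs bs => if j == b then Some (q, xs, bs) else None
  | Cst _ _ | Rng _ _ _ => None
  | Mul t1 t2 => if j < b + areas t1 then leaf_at b t1 j
                 else leaf_at (b + areas t1) t2 j
  | Bind _ _ t => leaf_at (3 + b) t j
  end.

Lemma leaf_at_bound b t j l : leaf_at b t j = Some l -> b <= j < b + areas t.
Proof.
elim: t b => [q xs bs|c cs|x c cs|t1 IH1 t2 IH2|fr x t IH] b //=.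
- by case: eqP => // -> _; lia.
- by case: ifP => h; [move/IH1|move/IH2]; lia.
- by move/IH; lia.
Qed.

Fixpoint key s (nu : nat -> nat) : nat :=
  if s is x :: s' then npair (nu x) (key s' nu) else 0.

Lemma key_eq s nu nu' : (key s nu == key s nu') = all (fun x => nu x == nu' x) s.
Proof. by elim: s => //= x s IH; rewrite npair_eq IH. Qed.

Lemma keyP s nu nu' : reflect {in s, nu =1 nu'} (key s nu == key s nu').
Proof.
rewrite key_eq; apply: (iffP allP) => h x /h; first by move/eqP.
by move=> ->.
Qed.

Lemma key_upd s nu x v : x \notin s -> key s (upd nu x v) = key s nu.
Proof.
move=> xs; apply/eqP/keyP => y ys; rewrite upd_neq //.
by apply: contraNneq xs => <-.
Qed.

Section Semantics.
Variable K : comNzSemiRingType.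
Variable ar : nat -> nat.
Variable cv : nat -> nat.
Implicit Types (C : nat -> seq nat -> K) (nu : nat -> nat) (F : nat -> K).

Definition mincst c cs : nat := foldl (fun m c => minn m (cv c)) (cv c) cs.

Definition agg (fr : bool) (F : nat -> K) : K :=
  if fr then (if `[< exists v, F v != 0%R >] then 1 else 0)%R
  else (\sum_(v \in [set: nat]%classic) F v)%R.

(** [s] lists the variables bound above; an atom has to contain all of them. *)
Fixpoint wf s t : Prop :=
  match t with
  | Leaf q xs bs => [/\ xs =i s, size xs = ar q & all (fun p => p.1 < size xs) bs]
  | Cst _ _ | Rng _ _ _ => s = [::]
  | Mul t1 t2 => wf s t1 /\ wf s t2
  | Bind fr x t => [/\ x \notin s, wf (x :: s) t & fr || (fv t == [::])]
  end.

(** A free binder only tells whether a witness exists; [oeval] sees through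
    free binders and gives the value of an output tuple. *)
Fixpoint eval C b t nu : K :=
  match t with
  | Leaf _ xs _ => C b (map nu xs)
  | Cst c cs => ((mincst c cs)%:R)%R
  | Rng _ _ _ => 1%R
  | Mul t1 t2 => (eval C b t1 nu * eval C (b + areas t1) t2 nu)%R
  | Bind fr x t => agg fr (fun v => eval C (3 + b) t (upd nu x v))
  end.

Fixpoint oeval C b t nu : K :=
  match t with
  | Rng x c cs => if 0 < nu x <= mincst c cs then 1%R else 0%R
  | Mul t1 t2 => (oeval C b t1 nu * oeval C (b + areas t1) t2 nu)%R
  | Bind true x t => oeval C (3 + b) t nu
  | _ => eval C b t nu
  end.

Lemma agg0 fr : agg fr (fun=> 0%R) = 0%R.
Proof.
case: fr => /=; last by rewrite fsbig1.
by case: asboolP => // -[v]; rewrite eqxx.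
Qed.

Lemma agg_sum F L : uniq L -> (forall v, F v != 0%R -> v \in L) ->
  agg false F = (\sum_(v <- L) F v)%R.
Proof.
move=> uL sL; rewrite /agg (fsbig_seq _ _ uL); apply/esym.
apply: fsbig_widen => // v /= [_ vL].
by apply/eqP/negP => /negP /sL.
Qed.

Lemma eval_dep C b s t nu nu' : wf s t -> {in s, nu =1 nu'} ->
  eval C b t nu = eval C b t nu'.
Proof.
elim: t b s nu nu' => [q xs bs|c cs|x c cs|t1 IH1 t2 IH2|fr x t IH] b s nu nu' //=.
- by case=> e _ _ h; congr C; apply/eq_in_map => y; rewrite e => /h.
- by case=> w1 w2 h; rewrite (IH1 _ _ _ _ w1 h) (IH2 _ _ _ _ w2 h).
- case=> xs w _ h; congr agg; apply: funext => v; apply: IH w _ => y.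
  by rewrite !updE inE; case: eqP => //= _ /h.
Qed.

Lemma eval_ids C C' b t nu :
  (forall i w, b <= i < b + areas t -> C' i w = C i w) ->
  eval C' b t nu = eval C b t nu.
Proof.
elim: t b nu => [q xs bs|c cs|x c cs|t1 IH1 t2 IH2|fr x t IH] b nu //= h.
- by apply: h; lia.
- by rewrite IH1 ?IH2 // => i w hi; apply: h; lia.
- by congr agg; apply: funext => v; apply: IH => i w hi; apply: h; lia.
Qed.

Definition updC C j w k : nat -> seq nat -> K :=
  fun i w' => if (i == j) && (w' == w) then k else C i w'.

(** The reason why updates take constant time: an atom contains all variables bound above it, so a
    change of one of its tuples is felt only under the key that this tuple determines. *)
Lemma eval_other C b s t j q xs bs k nu0 nu : wf s t ->
  leaf_at b t j = Some (q, xs, bs) -> key s nu != key s nu0 ->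
  eval (updC C j (map nu0 xs) k) b t nu = eval C b t nu.
Proof.
elim: t b s nu => [q' xs' bs'|c cs|x c cs|t1 IH1 t2 IH2|fr x t IH] b s nu //=.
- case=> e _ _; case: (eqVneq j b) => [-> [_ <- _] n|//].
  rewrite /updC eqxx /=; case: eqP => // /eq_in_map h.
  by case/negP: n; apply/keyP => y ys; apply: h; rewrite e.
- case=> w1 w2; case: ifP => hj l n.
    rewrite (IH1 _ _ _ w1 l n); congr (_ * _)%R; apply: eval_ids => i w hi.
    by rewrite /updC; case: eqP => // e; lia.
  rewrite (IH2 _ _ _ w2 l n); congr (_ * _)%R; apply: eval_ids => i w hi.
  by rewrite /updC; case: eqP => // e; lia.
- case=> xs' w _ l n; congr agg; apply: funext => v; apply: IH w l _ => /=.
  by rewrite npair_eq key_upd // negb_and n orbT.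
Qed.

(** Below a binder [wf] admits neither constants nor ranges, so every branch ends in an atom. At the
    root this fails: a constant may well be nonzero there. *)
Lemma eval_zero b s t nu : wf s t -> s != [::] -> eval (fun _ _ => 0%R) b t nu = 0%R.
Proof.
elim: t b s nu => [q xs bs|c cs|x c cs|t1 IH1 t2 IH2|fr x t IH] b s nu //=.
- by move=> ->.
- by move=> ->.
- by case=> w1 _ n; rewrite (IH1 _ _ _ w1 n) mul0r.
- case=> _ w _ _; rewrite -[RHS](agg0 fr); congr agg; apply: funext => v.
  exact: IH w _.
Qed.

End Semantics.

Arguments steps : simpl never.
Arguments npair : simpl never.
Arguments mpair : simpl never.
Arguments upd : simpl never.
Arguments block : simpl never.

(** * Maintaining the children of a binder *)

Section Blocks.
Variables (K : comNzSemiRingType) (P : prims K) (D : nat).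
Implicit Types (s : state K) (p : seq (instr K)).

Lemma wp_bind c1 c2 s R Q : wp P D c1 s R ->
  (forall s', R s' -> wp P D c2 s' Q) -> wp P D (Seq c1 c2) s Q.
Proof. by move=> w1 w2; apply: wp_seq; apply: wp_mono w1. Qed.

Lemma wp_nil s Q : Q s -> wp P D (block [::]) s Q.
Proof. exact: wp_skip. Qed.

Lemma wp_cons i p s Q : silent i -> wp P D (block p) (step P i s) Q ->
  wp P D (block (i :: p)) s Q.
Proof. by move=> si w; apply/wp_seq/wp_do. Qed.

Lemma wp_mpair r a b p s Q : a != r ->
  (forall v, v = npair (ireg s a) (ireg s b) ->
     wp P D (block p) (set_ireg s r v) Q) ->
  wp P D (block (mpair K r a b ++ p)) s Q.
Proof.
move=> n /(_ _ erefl) w; rewrite /mpair /=; do 3 apply: wp_cons => //.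
by move: w; rewrite -(mpairE P b s n).
Qed.

Lemma wp_load r a p s Q :
  (forall v, v = imem (heap s) (ireg s a) -> wp P D (block p) (set_ireg s r v) Q) ->
  wp P D (block (ILoad K r a :: p)) s Q.
Proof. by move=> /(_ _ erefl) w; apply: wp_cons. Qed.

End Blocks.

Ltac norm_state := rewrite /= /set_ireg /set_vreg /Defs.set_mem /=.
Ltac wstep := first
  [ apply: wp_mpair; [by []|];
    let v := fresh "v" in let E := fresh "E" in move=> v E;
    rewrite /= in E; norm_state
  | apply: wp_load; let v := fresh "v" in let E := fresh "E" in move=> v E;
    rewrite /= in E; norm_state
  | apply: wp_cons; [by []|]; norm_state
  | apply: wp_nil ].
Ltac wsteps := repeat wstep; subst.

Section Frames.
Variables (K : comNzSemiRingType).
Implicit Types (s : state K) (h : memory K).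

(** Odd registers from 33 on and semiring register 33 hold what must survive
    a silent subroutine. *)
Definition keep s s' :=
  [/\ forall k, ireg s' (rodd k) = ireg s (rodd k), vreg s' 33 = vreg s 33,
      itape s' = itape s & vtape s' = vtape s].

Lemma keep_trans s1 s2 s3 : keep s1 s2 -> keep s2 s3 -> keep s1 s3.
Proof.
move=> [a b c d] [a' b' c' d']; split; first by move=> k; rewrite a' a.
all: congruence.
Qed.

Definition hkeep (A : nat -> nat -> bool) h h' := forall m k a, ~~ A m k ->
  imem h' (npair (npair m k) a) = imem h (npair (npair m k) a) /\
  vmem h' (npair (npair m k) a) = vmem h (npair (npair m k) a).

Lemma hkeep_trans A h1 h2 h3 : hkeep A h1 h2 -> hkeep A h2 h3 -> hkeep A h1 h3.
Proof. by move=> a b m k x n; have [-> ->] := b m k x n; apply: a. Qed.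

Lemma hkeep_sub (A A' : nat -> nat -> bool) h h' :
  (forall m k, A m k -> A' m k) -> hkeep A h h' -> hkeep A' h h'.
Proof. by move=> sAA' H m k a n; apply: H; apply: contra n; apply: sAA'. Qed.

Lemma hkeep_lane A h h' m k : hkeep A h h' -> ~~ A m k ->
  lane (npair m k) h' = lane (npair m k) h.
Proof. by move=> H n; congr Memory; apply: funext => a; have [] := H m k a n. Qed.

Lemma emb_frame_keep L s s' : emb_frame L s s' -> keep s s'.
Proof. by case=> _ a [_ b] _ [c d]; split=> //; apply: (b 0). Qed.

End Frames.

Section Containers.
Variables (K : comNzSemiRingType) (P : prims K).
Variables (rep : memory K -> {mset K}%mset -> Prop) (cnew csum cins cdel : cmd K).
Variables (d0 D : nat).
Implicit Types (s : state K) (h : memory K) (F : nat -> K).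

Definition arrinv n (arr idx : nat -> nat) (S : pred nat) :=
  (forall i, i < n -> S (arr i) /\ idx (arr i) = i) /\
  (forall v, S v -> idx v < n /\ arr (idx v) = v).

(** The header of area [b] under key [k]. Its semiring part caches the value of the node; its
    integer part is the length of the array at a free binder and a flag for the existence of the sum
    structure at a quantified one. *)
Definition cell b k := npair (npair b k) 0.

(** The children of a binder under one key: for a free variable an array
    with the witnesses and the inverse of that array, for a quantified one
    the multiset of the non-zero values in its own lane, which is created at
    the first insertion. *)
Definition cinv (fr : bool) h b k F : Prop :=
  vmem h (cell b k) = agg fr F /\
  if fr then
    arrinv (imem h (cell b k)) (fun i => imem h (npair (npair b.+1 k) i))
      (fun v => imem h (npair (npair b.+2 k) v)) (fun v => F v != 0%R)
  else exists (L : seq nat) (m : {mset K}%mset),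
    [/\ uniq L, forall v, (v \in L) = (F v != 0%R),
        perm_eq (enum_mset m) (map F L) &
        if imem h (cell b k) == 0
        then lane (npair b.+1 k) h = blank_memory K /\ m = mset0
        else rep (lane (npair b.+1 k) h) m].

Lemma cinv_keep A fr h h' b k F : hkeep A h h' ->
  (forall m, b <= m < 3 + b -> ~~ A m k) -> cinv fr h b k F -> cinv fr h' b k F.
Proof.
move=> H n; have n0 : ~~ A b k by apply: n; lia.
have n1 : ~~ A b.+1 k by apply: n; lia.
have n2 : ~~ A b.+2 k by apply: n; lia.
have [e0 e0'] := H b k 0 n0.
rewrite /cinv /cell e0 e0' (hkeep_lane H n1) => -[-> h2]; split=> //.
case: fr h2 => // -[a1 a2]; split=> [i|v].
  by move/a1; have [-> _] := H b.+1 k i n1; have [-> _] := H b.+2 k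
    (imem h (npair (npair b.+1 k) i)) n2.
by move/a2; have [-> _] := H b.+2 k v n2; have [-> _] := H b.+1 k
    (imem h (npair (npair b.+2 k) v)) n1.
Qed.

(** Afterwards register 1 holds the lane of area [b.+1] (array or sum structure) and register 10 the
    address of the header; [idxlane] puts the lane of the inverse array into register 8. *)
Definition laneb b (p : seq (instr K)) : seq (instr K) :=
  IConst K 4 b.+1 :: mpair K 1 4 3 ++ IConst K 4 b :: mpair K 6 4 3 ++
  IConst K 5 0 :: mpair K 10 6 5 ++ p.

Definition idxlane b (p : seq (instr K)) : seq (instr K) :=
  laneb b (IConst K 4 b.+2 :: mpair K 8 4 3 ++ p).

(** Semiring register 32 is [remb 0], through which relocated programs take their argument and
    return their result. *)
Definition bins (fr : bool) b : cmd K :=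
  if fr then block (idxlane b (
    ILoad K 7 10 :: mpair K 11 1 7 ++ IStore K 11 9 :: mpair K 11 8 9 ++
    [:: IStore K 11 7; IConst K 4 1; IAdd K 7 7 4; IStore K 10 7;
        VConst 2 1%R; VStore K 10 2]))
  else Seq (block (laneb b [:: ILoad K 7 10]))
    (Seq (If 7 (Skip K) (Seq (reloc cnew) (block [:: IConst K 7 1; IStore K 10 7])))
    (Seq (block [:: VMove K 32 1])
    (Seq (reloc cins) (Seq (reloc csum) (block [:: VStore K 10 32]))))).

(** The last element of the array moves into the hole. The two final subtractions compute the
    minimum of 1 and the new length, which is the value of a free binder after the deletion. *)
Definition bdel (fr : bool) b : cmd K :=
  if fr then block (idxlane b (
    ILoad K 7 10 :: IConst K 4 1 :: ISub K 7 7 4 :: mpair K 11 8 9 ++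
    ILoad K 12 11 :: mpair K 11 1 7 ++ ILoad K 13 11 :: mpair K 11 1 12 ++
    IStore K 11 13 :: mpair K 11 8 13 ++
    [:: IStore K 11 12; IStore K 10 7; ISub K 5 7 4; ISub K 5 7 5;
        VNat K 2 5; VStore K 10 2]))
  else Seq (block (laneb b [:: VMove K 32 1]))
    (Seq (reloc cdel) (Seq (reloc csum) (block [:: VStore K 10 32]))).

Definition own b k : nat -> nat -> bool := fun m k' => (b <= m < 3 + b) && (k' == k).

(** Integer register 3 holds the key and 9 the child; the new or old value of
    the child is in semiring register 1. *)
Definition ins_spec (ins : bool -> nat -> cmd K) := forall fr b s F,
  F (ireg s 9) = 0%R -> vreg s 1 != 0%R -> cinv fr (heap s) b (ireg s 3) F ->
  wp P D (ins fr b) s (fun s' => [/\ keep s s',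
    hkeep (own b (ireg s 3)) (heap s) (heap s') &
    cinv fr (heap s') b (ireg s 3) (upd F (ireg s 9) (vreg s 1))]).

Definition del_spec (del : bool -> nat -> cmd K) := forall fr b s F,
  F (ireg s 9) = vreg s 1 -> vreg s 1 != 0%R -> cinv fr (heap s) b (ireg s 3) F ->
  wp P D (del fr b) s (fun s' => [/\ keep s s',
    hkeep (own b (ireg s 3)) (heap s) (heap s') &
    cinv fr (heap s') b (ireg s 3) (upd F (ireg s 9) 0%R)]).

Let rlo k (n : nat) : n < 32 -> (rodd k == n) = false := @rodd_lo k n.

Lemma arr_ins n arr idx S v : arrinv n arr idx S -> ~~ S v ->
  arrinv n.+1 (upd arr n v) (upd idx v n) (fun w => (w == v) || S w).
Proof.
move=> [a1 a2] nv; split=> [i|w].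
  rewrite ltnS leq_eqVlt => /orP[/eqP-> | lt]; first by rewrite !updxx eqxx.
  have [b1 b2] := a1 _ lt; rewrite (upd_neq _ _ (_ : i != n)) ?neq_ltn ?lt //.
  rewrite b1 orbT upd_neq //; by apply: contraNneq nv => <-.
case: eqVneq => [-> _|n1 /= /a2[b1 b2]]; first by rewrite !updxx ltnSn.
by rewrite upd_neq // leqW // upd_neq // neq_ltn b1.
Qed.

(** If [v] is itself the last element, both writes restore what was there, and [v] disappears only
    through the shorter length. *)
Lemma arr_del n arr idx S v : arrinv n arr idx S -> S v ->
  arrinv n.-1 (upd arr (idx v) (arr n.-1)) (upd idx (arr n.-1) (idx v))
    (fun w => (w != v) && S w).
Proof.
move=> [a1 a2] Sv; have [iv av] := a2 _ Sv.
have lt : n.-1 < n by lia.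
have [b1 b2] := a1 _ lt.
split=> [i lti|w /andP[wv Sw]].
  have [c1 c2] := a1 i ltac:(lia).
  case: (eqVneq i (idx v)) => [e|ne].
    rewrite e !updxx b1 andbT; split=> //.
    by apply: contraTneq lti => ew; rewrite -ew b2 in e; lia.
  rewrite upd_neq // c1 andbT; split.
    by apply: contraNneq ne => <-; rewrite c2.
  rewrite upd_neq //; apply: contraTneq lti => ew; rewrite -ew c2 in b2; lia.
have [iw aw] := a2 _ Sw.
have niv : idx w != idx v by apply: contraNneq wv => e; rewrite -aw e av.
case: (eqVneq w (arr n.-1)) => [e|ne].
  rewrite e !updxx; split=> //.
  by rewrite e b2 in niv; lia.
rewrite !(upd_neq _ _ ne) upd_neq //; split=> //.
have : idx w != n.-1 by apply: contraNneq ne => <-; rewrite aw.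
lia.
Qed.

Lemma agg_true F : agg true F = if `[< exists v, F v != 0%R >] then 1%R else 0%R.
Proof. by []. Qed.

Lemma area_neq b : ((b.+1 == b.+2) = false) * ((b.+2 == b.+1) = false) *
  ((b == b.+1) = false) * ((b == b.+2) = false) * ((b.+1 == b) = false) *
  ((b.+2 == b) = false) * (forall x : nat, (x == x) = true).
Proof. by do ?split; try lia; move=> x; rewrite eqxx. Qed.

Arguments upd T f a x b /.

Lemma bins_true_ok b s F : F (ireg s 9) = 0%R -> vreg s 1 != 0%R ->
  cinv true (heap s) b (ireg s 3) F ->
  wp P D (bins true b) s (fun s' => [/\ keep s s',
    hkeep (own b (ireg s 3)) (heap s) (heap s') &
    cinv true (heap s') b (ireg s 3) (upd F (ireg s 9) (vreg s 1))]).
Proof.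
case: s => R V h t w /= Fv nV [hv hA]; rewrite /bins /idxlane /laneb.
set Q := fun s' => _; wsteps; split.
- by split=> // k; rewrite /= ?updE ?rlo.
- move=> m k a; rewrite /own /= ?updE !npair_eq => n.
  by do ?case: ifP => //; lia.
rewrite /cinv /= /cell; split.
  rewrite ?updE eqxx; case: asboolP => // -[]; exists (R 9).
  by rewrite ?updE eqxx.
have := arr_ins hA (_ : ~~ (F (R 9) != 0%R)).
rewrite negbK Fv eqxx => /(_ isT) hA'; congr arrinv: hA'.
- by rewrite ?updE !npair_eq !area_neq /= ?addn1.
- by apply: funext => i; rewrite ?updE !npair_eq !area_neq /=.
- by apply: funext => i; rewrite ?updE !npair_eq !area_neq /=.
- by apply: funext => i; rewrite ?updE; case: eqP.
Qed.

Lemma bdel_true_ok b s F : F (ireg s 9) != 0%R ->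
  cinv true (heap s) b (ireg s 3) F ->
  wp P D (bdel true b) s (fun s' => [/\ keep s s',
    hkeep (own b (ireg s 3)) (heap s) (heap s') &
    cinv true (heap s') b (ireg s 3) (upd F (ireg s 9) 0%R)]).
Proof.
case: s => R V h t w /= Fv [hv hA]; rewrite /bdel /idxlane /laneb.
set Q := fun s' => _; wsteps; split.
- by split=> // k; rewrite /= ?updE ?rlo.
- move=> m k a; rewrite /own /= ?updE !npair_eq => n.
  by do ?case: ifP => //; lia.
have hA' := arr_del hA Fv.
rewrite /cinv /= /cell; split; last first.
  congr arrinv: hA'.
  - by rewrite ?updE !npair_eq !area_neq /= ?subn1.
  - by apply: funext => i; rewrite ?updE !npair_eq !area_neq /= ?subn1.
  - by apply: funext => i; rewrite ?updE !npair_eq !area_neq /= ?subn1.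
  - by apply: funext => i; rewrite ?updE; case: (eqVneq i (R 9)); rewrite //= eqxx.
rewrite ?updE eqxx; have [a1 a2] := hA'.
case: asboolP => [[v]|nv].
  rewrite ?updE; case: (eqVneq v (R 9)) => [_|n nv]; first by rewrite eqxx.
  have [|lt _] := a2 v; first by rewrite n.
  by rewrite (_ : _ - _ = 1) //; move: lt; rewrite /cell; lia.
rewrite (_ : _ - _ = 0) //; move: a1; rewrite /cell => a1.
case E: (imem h (npair (npair b (R 3)) 0)).-1 => [|m]; first lia.
rewrite E in a1; case: nv; have [/andP[n1 n2] _] := a1 0 isT.
by move: n1 n2; set z := upd _ _ _ 0 => n1 n2; exists z; rewrite /= (negbTE n1).
Qed.

Lemma emb_own b k s s' : emb_frame (npair b.+1 k) s s' ->
  hkeep (own b k) (heap s) (heap s') /\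
  imem (heap s') (cell b k) = imem (heap s) (cell b k).
Proof.
case=> _ _ _ H _; split=> [m k' a n|].
  by apply: H; rewrite npair_eq; apply: contra n; rewrite /own; lia.
by have [] := H (npair b k) 0; rewrite // npair_eq; lia.
Qed.

Hypothesis D_ge : 4 * d0 <= D.
Hypothesis cnewP : forall s, heap s = blank_memory K ->
  exists2 s', runs_within P d0 cnew s s' & rep (heap s') mset0.
Hypothesis csumP : forall s m, rep (heap s) m ->
  exists2 s', runs_within P d0 csum s s' &
    rep (heap s') m /\ vreg s' 0 = (\sum_(k <- enum_mset m) k)%R.
Hypothesis cinsP : forall s m, rep (heap s) m ->
  exists2 s', runs_within P d0 cins s s' & rep (heap s') (vreg s 0 +` m)%mset.
Hypothesis cdelP : forall s m, rep (heap s) m -> vreg s 0 \in m ->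
  exists2 s', runs_within P d0 cdel s s' & rep (heap s') (m `\ vreg s 0)%mset.

(** Every state embeds one: read off the lane and the even registers and add empty tapes. What
    earlier runs left in these registers is harmless, since the specifications of the sum programs
    constrain only the memory and semiring register 0. *)
Lemma wp_emb c s (R : state K -> Prop) :
  (forall s0, heap s0 = lane (ireg s 1) (heap s) -> vreg s0 0 = vreg s 32 ->
     exists2 s0', runs_within P d0 c s0 s0' & R s0') ->
  wp P D (reloc c) s (fun s' => emb_frame (ireg s 1) s s' /\
    exists2 s0', R s0' & lane (ireg s 1) (heap s') = heap s0' /\
                         vreg s' 32 = vreg s0' 0).
Proof.
pose s0 := State (fun r => ireg s (remb r)) (fun r => vreg s (remb r))
  (lane (ireg s 1) (heap s)) [::] [::].
move=> /(_ s0 erefl erefl)[s0' [t0 [e0 l0 _]] q].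
have E : emb (ireg s 1) s0 s by [].
have [s' [t [e l o [_ hv hl _ _] F]]] := reloc_ok e0 E.
apply: (wp_bounded e) => //; first lia.
by split=> //; exists s0'; rewrite // hl -hv.
Qed.

Lemma sum_ok b k s m : ireg s 1 = npair b.+1 k -> ireg s 10 = cell b k ->
  rep (lane (npair b.+1 k) (heap s)) m -> imem (heap s) (cell b k) != 0 ->
  wp P D (Seq (reloc csum) (block [:: VStore K 10 32])) s (fun s' =>
    [/\ keep s s', hkeep (own b k) (heap s) (heap s'),
        vmem (heap s') (cell b k) = (\sum_(k <- enum_mset m) k)%R,
        imem (heap s') (cell b k) != 0 &
        rep (lane (npair b.+1 k) (heap s')) m]).
Proof.
move=> e1 e10 r n0; apply: wp_bind.
  apply: (@wp_emb _ _ (fun s0 => rep (heap s0) m /\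
      vreg s0 0 = (\sum_(k <- enum_mset m) k)%R)) => s0 h0 _.
  by apply: csumP; rewrite h0 e1.
move=> s1; rewrite e1 => -[F [s0 [r0 v0] [l0 w0]]].
have [h1 i1] := emb_own F; have [/(_ 10 isT isT) f10 _ _ _ _] := F.
apply: wp_cons => //; apply: wp_nil; rewrite [step _ _ _]/= f10 e10; split.
- exact: emb_frame_keep F.
- apply: hkeep_trans h1 _ => m' k' a; rewrite /= ?updE npair_eq /own => n.
  by split=> //; case: ifP => //; move: n; rewrite npair_eq; lia.
- by rewrite /= ?updE eqxx w0.
- by rewrite /= i1.
- rewrite -l0 in r0; congr rep: r0; congr Memory; apply: funext => a /=.
  by rewrite ?updE /cell !npair_eq; case: ifP => //; lia.
Qed.

Lemma mset1D_perm k (m : {mset K}%mset) (s : seq K) :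
  perm_eq (enum_mset m) s -> perm_eq (enum_mset (k +` m)%mset) (k :: s).
Proof.
move=> pm; have -> : (k +` m)%mset = seq_mset (k :: s).
  apply/msetP => x; rewrite mset1DE mset_seqE /= -(permP pm) count_mem_mset.
  by rewrite eq_sym.
exact: perm_eq_seq_mset.
Qed.

Lemma mset1B_perm k (m : {mset K}%mset) (s : seq K) :
  perm_eq (enum_mset m) (k :: s) -> perm_eq (enum_mset (m `\ k)%mset) s.
Proof.
move=> pm; have -> : (m `\ k)%mset = seq_mset s.
  apply/msetP => x; rewrite msetB1E mset_seqE -count_mem_mset (permP pm) /=.
  by rewrite eq_sym addKn.
exact: perm_eq_seq_mset.
Qed.

Lemma bins_false_ok b s F : F (ireg s 9) = 0%R -> vreg s 1 != 0%R ->
  cinv false (heap s) b (ireg s 3) F ->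
  wp P D (bins false b) s (fun s' => [/\ keep s s',
    hkeep (own b (ireg s 3)) (heap s) (heap s') &
    cinv false (heap s') b (ireg s 3) (upd F (ireg s 9) (vreg s 1))]).
Proof.
move=> Fv nV [hv [L [m [uL memL pm hm]]]].
set kap := ireg s 3 in hv hm *; set v := ireg s 9 in Fv *.
set k := vreg s 1 in nV *; pose A := own b kap; pose ln := npair b.+1 kap.
apply: (@wp_bind _ _ _ _ _ _ (fun s1 => [/\ keep s s1, heap s1 = heap s,
   ireg s1 1 = ln /\ ireg s1 10 = cell b kap, vreg s1 1 = k &
   ireg s1 7 = imem (heap s) (cell b kap)])).
  rewrite /k /kap /ln /kap; case: (s) => R V h t w; rewrite /laneb.
  by set Q := fun s' => _; wsteps; split.
move=> s1 [k1 h1 [e1 e10] v1 e7].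
apply: (@wp_bind _ _ _ _ _ _ (fun s2 => [/\ keep s s2,
   hkeep A (heap s) (heap s2), ireg s2 1 = ln /\ ireg s2 10 = cell b kap,
   vreg s2 1 = k & imem (heap s2) (cell b kap) != 0 /\ rep (lane ln (heap s2)) m])).
  apply: wp_if; rewrite e7 => c7.
    apply: wp_skip; rewrite h1; split=> //; split=> //.
    by move: hm; rewrite (negbTE c7).
  move: hm; rewrite c7 eqxx => -[bl ->].
  apply: wp_bind.
    apply: (@wp_emb _ _ (fun s0 => rep (heap s0) mset0)) => s0 h0 _.
    by apply: cnewP; rewrite h0 e1 h1.
  move=> s2; rewrite e1 => -[Fr [s0 r0 [l0 _]]]; have [H2 i2] := emb_own Fr.
  have [F1 _ [F2 _] _ _] := Fr.
  apply: wp_cons => //; apply: wp_cons => //; apply: wp_nil; split.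
  - by apply: (keep_trans k1); have := emb_frame_keep Fr; case=> *; split=> // q;
      rewrite /= ?updE ?rlo.
  - rewrite -h1; apply: hkeep_trans H2 _ => m' k' a.
    rewrite /= F1 // e10 npair_eq /own => n.
    by split=> //; case: ifP => //; move: n; rewrite npair_eq; lia.
  - by rewrite /= !F1.
  - by rewrite /= F2.
  - split; first by rewrite /= F1 // e10 eqxx.
    rewrite -l0 in r0; congr rep: r0; congr Memory; apply: funext => a /=.
    by rewrite F1 // e10 /cell !npair_eq; case: ifP => //; lia.
move=> s2 [k2 h2 [e21 e210] v2 [c2 r2]].
apply: wp_bind.
  apply: wp_cons => //; apply: wp_nil.
  by exact: (erefl : _ = set_vreg s2 32 (vreg s2 1)).
move=> s3 E3; apply: wp_bind.
  apply: (@wp_emb _ _ (fun s0 => rep (heap s0) (k +` m)%mset)) => s0 h0 v0.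
  rewrite -v2 (_ : vreg s2 1 = vreg s0 0); last by rewrite v0 -E3 /= .
  by apply: cinsP; rewrite h0 -E3 /= e21.
move=> s4; rewrite -E3 /= e21 => -[Fr [s0 r0 [l0 _]]].
have [H4 i4] := emb_own Fr; have [F1 _ _ _ _] := Fr.
rewrite -l0 in r0.
apply: wp_mono (sum_ok _ _ r0 _); rewrite ?F1 ?i4 //.
move=> s5 [k5 h5 sum5 n5 r5]; split.
- apply: keep_trans k2 _; apply: keep_trans k5.
  by have := emb_frame_keep Fr; case=> *; split.
- exact: hkeep_trans h2 (hkeep_trans H4 h5).
have vL : v \notin L by rewrite memL Fv eqxx.
have memL' w : (w \in v :: L) = (upd F v k w != 0%R).
  by rewrite inE /upd; case: eqP => [_|_] /=; rewrite ?nV // memL.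
have FL : map (upd F v k) L = map F L.
  by apply/eq_in_map => w wL; rewrite upd_neq //; apply: contraNneq vL => <-.
have pm' : perm_eq (enum_mset (k +` m)%mset) (map (upd F v k) (v :: L)).
  by rewrite map_cons FL updxx; apply: mset1D_perm.
split; last first.
  exists (v :: L), (k +` m)%mset; rewrite (negbTE n5); split=> //=.
  by rewrite vL.
rewrite sum5 (perm_big _ pm') big_map; apply/esym/agg_sum => [|w].
  by rewrite /= vL.
by rewrite memL'.
Qed.

Lemma bdel_false_ok b s F : F (ireg s 9) = vreg s 1 -> vreg s 1 != 0%R ->
  cinv false (heap s) b (ireg s 3) F ->
  wp P D (bdel false b) s (fun s' => [/\ keep s s',
    hkeep (own b (ireg s 3)) (heap s) (heap s') &
    cinv false (heap s') b (ireg s 3) (upd F (ireg s 9) 0%R)]).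
Proof.
move=> Fv nV [hv [L [m [uL memL pm hm]]]].
set kap := ireg s 3 in hv hm *; set v := ireg s 9 in Fv *.
set k := vreg s 1 in Fv nV *; pose A := own b kap; pose ln := npair b.+1 kap.
have vL : v \in L by rewrite memL Fv.
have pm0 : perm_eq (enum_mset m) (k :: map F (rem v L)).
  by apply: (perm_trans pm); rewrite -Fv -map_cons perm_map // perm_to_rem.
have km : k \in m by rewrite in_mset -count_mem_mset (permP pm0) /= eqxx.
(* A multiset that has an element is not the one of a lane still blank, so its structure exists
   already. *)
have n0 : imem (heap s) (cell b kap) != 0.
  by apply/negP => c; move: hm km; rewrite c => -[_ ->]; rewrite in_mset0.
have rm : rep (lane ln (heap s)) m by move: hm; rewrite (negbTE n0).
apply: (@wp_bind _ _ _ _ _ _ (fun s1 => [/\ keep s s1, heap s1 = heap s,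
   ireg s1 1 = ln /\ ireg s1 10 = cell b kap & vreg s1 32 = k])).
  rewrite /k /kap /ln /kap; case: (s) => R V h t w; rewrite /laneb.
  by set Q := fun s' => _; wsteps; split.
move=> s1 [k1 h1 [e1 e10] v1]; apply: wp_bind.
  apply: (@wp_emb _ _ (fun s0 => rep (heap s0) (m `\ k)%mset)) => s0 h0 v0.
  by rewrite -v1 -v0; apply: cdelP; rewrite ?v0 ?v1 // h0 e1 h1.
move=> s4; rewrite e1 => -[Fr [s0 r0 [l0 _]]].
have [H4 i4] := emb_own Fr; have [F1 _ _ _ _] := Fr.
rewrite -l0 in r0.
apply: wp_mono (sum_ok _ _ r0 _); rewrite ?F1 ?i4 ?h1 //.
move=> s5 [k5 h5 sum5 n5 r5]; split.
- exact: keep_trans k1 (keep_trans (emb_frame_keep Fr) k5).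
- by rewrite -h1; apply: hkeep_trans H4 h5.
have memL' w : (w \in rem v L) = (upd F v 0%R w != 0%R).
  by rewrite mem_rem_uniq // inE memL /upd; case: eqP => //=; rewrite eqxx.
have FL : map (upd F v 0%R) (rem v L) = map F (rem v L).
  apply/eq_in_map => w wL; rewrite upd_neq //.
  by move: wL; rewrite mem_rem_uniq // inE => /andP[].
have pm' : perm_eq (enum_mset (m `\ k)%mset) (map (upd F v 0%R) (rem v L)).
  by rewrite FL; apply: mset1B_perm.
split; last first.
  exists (rem v L), (m `\ k)%mset; rewrite (negbTE n5); split=> //=.
  exact: rem_uniq.
rewrite sum5 (perm_big _ pm') big_map; apply/esym/agg_sum => [|w].
  exact: rem_uniq.
by rewrite memL'.
Qed.

Lemma bins_ok : ins_spec bins.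
Proof. by case; [apply: bins_true_ok | apply: bins_false_ok]. Qed.

Lemma bdel_ok : del_spec bdel.
Proof.
case=> b s F Fv nV; last exact: bdel_false_ok.
by apply: bdel_true_ok; rewrite Fv.
Qed.

End Containers.

Arguments upd : simpl never.

Lemma rvarE x : rvar x = rodd (4 * x). Proof. by rewrite /rvar /rodd; lia. Qed.
Lemma rcntE x : rcnt x = rodd (4 * x + 1). Proof. by rewrite /rcnt /rodd; lia. Qed.
Lemma rargE x : rarg x = rodd (4 * x + 2). Proof. by rewrite /rarg /rodd; lia. Qed.
Lemma rcstE x : rcst x = rodd (4 * x + 3). Proof. by rewrite /rcst /rodd; lia. Qed.

Arguments rvar : simpl never.
Arguments rcnt : simpl never.
Arguments rarg : simpl never.
Arguments rcst : simpl never.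
Arguments rodd : simpl never.

(** * Updates *)

Section TreeMemory.
Variables (K : comNzSemiRingType) (P : prims K) (D : nat).
Variable rep : memory K -> {mset K}%mset -> Prop.
Variables ins del : bool -> nat -> cmd K.
Hypothesis insP : ins_spec P rep D ins.
Hypothesis delP : del_spec P rep D del.
Variables (ar cv : nat -> nat).
Implicit Types (C : nat -> seq nat -> K) (nu : nat -> nat) (F : nat -> K).
Implicit Types (s : seq nat) (st : state K) (t : tree) (h : memory K).

Definition env st : nat -> nat := fun x => ireg st (rvar x).
(** Constants are stored minus one, so that registers never written stand for
    a positive constant too. *)
Definition consts st := forall c, (ireg st (rcst c)).+1 = cv c.

Definition look st st' := keep st st' /\ heap st' = heap st.

Lemma look_trans st1 st2 st3 : look st1 st2 -> look st2 st3 -> look st1 st3.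
Proof. by move=> [a b] [c d]; split; [exact: keep_trans c|rewrite d]. Qed.

Lemma keep_env st st' : keep st st' -> env st' = env st.
Proof. by case=> h _ _ _; apply: funext => x; rewrite /env rvarE h. Qed.

Lemma keep_consts st st' : keep st st' -> consts st -> consts st'.
Proof. by case=> h _ _ _ hc c; rewrite rcstE h -rcstE. Qed.

Lemma look_set_ireg st r n : r < 32 -> look st (set_ireg st r n).
Proof.
move=> lr; split=> //; split=> //= k; rewrite updE; case: eqP => // e.
by rewrite -e /rodd in lr; lia.
Qed.

Lemma look_set_vreg st r n : r < 32 -> look st (set_vreg st r n).
Proof.
by move=> lr; split=> //; split=> //=; rewrite updE; case: eqP => // e; lia.
Qed.

(** Code is generated in continuation style, [p] being what follows, so that a whole evaluation is
    one straight-line block. *)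
Fixpoint kcode s (p : seq (instr K)) : seq (instr K) :=
  if s is x :: s' then kcode s' (mpair K 4 (rvar x) 3 ++ IMove K 3 4 :: p)
  else IConst K 3 0 :: p.

Definition ccode b (p : seq (instr K)) : seq (instr K) :=
  IConst K 4 b :: mpair K 6 4 3 ++ IConst K 5 0 :: mpair K 10 6 5 ++ p.

(** [m - (m - n)] is the minimum of [m] and [n], subtraction being truncated. *)
Definition mcode c cs (p : seq (instr K)) : seq (instr K) :=
  IMove K 4 (rcst c) ::
  foldr (fun c q => [:: ISub K 5 4 (rcst c), ISub K 4 4 5 & q])
    [:: IConst K 5 1, IAdd K 4 4 5 & p] cs.

Lemma rvar_lo x n : n < 32 -> (rvar x == n) = false.
Proof. by rewrite /rvar; lia. Qed.
Lemma wp_kcode s p st Q :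
  (forall st', look st st' -> vreg st' = vreg st -> ireg st' 3 = key s (env st) ->
     wp P D (block p) st' Q) ->
  wp P D (block (kcode s p)) st Q.
Proof.
elim: s p Q => [|x s IH] p Q H /=.
  by apply: wp_cons => //; apply: H => //; apply: look_set_ireg.
apply: IH => st' l v e; apply: wp_mpair; first by rewrite rvar_lo.
move=> w ew; apply: wp_cons => //; apply: H => /=.
- apply: look_trans l _; apply: (look_trans (st2 := set_ireg st' 4 w));
    exact: look_set_ireg.
- exact: v.
- by rewrite !updE /= ew e -(keep_env (proj1 l)).
Qed.

Lemma wp_ccode b p st Q :
  (forall st', look st st' -> vreg st' = vreg st -> ireg st' 3 = ireg st 3 ->
     ireg st' 10 = cell b (ireg st 3) -> wp P D (block p) st' Q) ->
  wp P D (block (ccode b p)) st Q.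
Proof.
move=> H; rewrite /ccode; apply: wp_cons => //; apply: wp_mpair => // v Ev.
apply: wp_cons => //; apply: wp_mpair => // w Ew; apply: H => //=.
by rewrite updE /= Ew /= !updE /= Ev /=.
Qed.

Lemma wp_mcode c cs p st Q : consts st ->
  (forall st', look st st' -> vreg st' = vreg st -> ireg st' 4 = mincst cv c cs ->
     wp P D (block p) st' Q) ->
  wp P D (block (mcode c cs p)) st Q.
Proof.
move=> hc H; rewrite /mcode; apply: wp_cons => //=.
have [l v e] : [/\ look st (set_ireg st 4 (ireg st (rcst c))),
    vreg (set_ireg st 4 (ireg st (rcst c))) = vreg st &
    (ireg (set_ireg st 4 (ireg st (rcst c))) 4).+1 = cv c].
  by split; [exact: look_set_ireg | by [] | rewrite /= updE eqxx].
move: (set_ireg st 4 _) l v e H => st1; rewrite /mincst.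
elim: cs (cv c) st1 => [|c' cs IH] m st1 l v e H /=.
  do 2 apply: wp_cons => //; apply: H => //.
  by rewrite /= !updE /= -e addn1.
do 2 apply: wp_cons => //; apply: (IH (minn m (cv c'))) => //.
by rewrite /= !updE /= -e -(keep_consts (proj1 l) hc); lia.
Qed.

(** Multiplies semiring register 0 by the value of the plan. The value of a binder is taken from its
    header, so the time depends on the plan alone; with [o] set, free binders are traversed instead,
    which gives the value of an output tuple. *)
Fixpoint rd (o : bool) b s t (p : seq (instr K)) : seq (instr K) :=
  let leaf := kcode s (ccode b [:: VLoad K 1 10, VMul K 0 0 1 & p]) in
  match t with
  | Leaf _ _ _ => leaf
  | Cst c cs => mcode c cs [:: VNat K 1 4, VMul K 0 0 1 & p]
  | Rng _ _ _ => p
  | Mul t1 t2 => rd o b s t1 (rd o (b + areas t1) s t2 p)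
  | Bind fr x t1 => if o && fr then rd o (3 + b) (x :: s) t1 p else leaf
  end.

Fixpoint stored b s t C h : Prop :=
  match t with
  | Leaf _ xs _ => forall nu, vmem h (cell b (key s nu)) = C b (map nu xs)
  | Cst _ _ | Rng _ _ _ => True
  | Mul t1 t2 => stored b s t1 C h /\ stored (b + areas t1) s t2 C h
  | Bind fr x t1 =>
      (forall nu, cinv rep fr h b (key s nu)
         (fun v => eval cv C (3 + b) t1 (upd nu x v))) /\
      stored (3 + b) (x :: s) t1 C h
  end.

Lemma wp_cellcode b s p st Q w : vmem (heap st) (cell b (key s (env st))) = w ->
  (forall st', look st st' -> vreg st' 0 = (vreg st 0 * w)%R ->
     wp P D (block p) st' Q) ->
  wp P D (block (kcode s (ccode b [:: VLoad K 1 10, VMul K 0 0 1 & p]))) st Q.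
Proof.
move=> e H; apply: wp_kcode => st1 l1 v1 k1; apply: wp_ccode => st2 l2 v2 _ a2.
do 2 apply: wp_cons => //; apply: H.
  apply: look_trans (look_trans l1 l2) _.
  by apply: look_trans (look_set_vreg _ _ _) (look_set_vreg _ _ _).
by rewrite /= !updE /= a2 k1 v2 v1 (proj2 l2) (proj2 l1) e.
Qed.

(** A range contributes no code in either mode. In output mode the product is therefore claimed only
    where the output value is nonzero, and the loops visit no other valuation. *)
Lemma wp_rd o b s t p st C Q : stored b s t C (heap st) -> consts st ->
  (forall st' w, look st st' -> vreg st' 0 = (vreg st 0 * w)%R ->
     (if o then oeval cv C b t (env st) != 0%R -> w = oeval cv C b t (env st)
      else w = eval cv C b t (env st)) ->
     wp P D (block p) st' Q) ->
  wp P D (block (rd o b s t p)) st Q.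
Proof.
elim: t b s p st Q => [q xs bs|c cs|x c cs|t1 IH1 t2 IH2|fr x t IH] b s p st Q /=.
- by move=> e _ H; apply: (wp_cellcode (e _)) => st' l v; apply: H v _ => //; case: (o).
- move=> _ hc H; apply: wp_mcode => // st1 l1 v1 m1.
  do 2 apply: wp_cons => //; apply: (H _ (mincst cv c cs)%:R%R).
  + apply: look_trans l1 _.
    by apply: look_trans (look_set_vreg _ _ _) (look_set_vreg _ _ _).
  + by rewrite /= !updE /= m1 v1.
  + by case: (o).
- move=> _ _ H; apply: (H st 1%R) => //; first by rewrite mulr1.
  by case: (o) => //; case: ifP => // _; rewrite eqxx.
- move=> [i1 i2] hc H; apply: IH1 => // st1 w1 l1 v1 e1.
  have [E1 E2] := (keep_env (proj1 l1), proj2 l1).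
  apply: IH2; rewrite ?E2 //; first exact: keep_consts (proj1 l1) _.
  move=> st2 w2 l2 v2 e2; apply: (H _ (w1 * w2)%R).
  + exact: look_trans l2.
  + by rewrite v2 v1 mulrA.
  + rewrite E1 in e2; case: (o) e1 e2 => [e1 e2 n|-> -> //].
    have n1 : oeval cv C b t1 (env st) != 0%R.
      by apply: contraNneq n => ->; rewrite mul0r.
    have n2 : oeval cv C (b + areas t1) t2 (env st) != 0%R.
      by apply: contraNneq n => ->; rewrite mulr0.
    by rewrite (e1 n1) (e2 n2).
- move=> [ic it] hc H.
  case: (boolP (o && fr)) => [/andP[o1 f1]|of'].
    apply: (IH (3 + b) (x :: s)) => // st' w l v; rewrite o1 => e.
    by apply: (H _ w) => //; rewrite o1 f1.
  apply: (wp_cellcode (proj1 (ic _))) => st' l v.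
  apply: H v _ => //; move: of'; case: (o) => //.
  by case: (fr).
Qed.

Lemma stored_ext b s t C C' h : (forall i w, b <= i < b + areas t -> C' i w = C i w) ->
  stored b s t C h -> stored b s t C' h.
Proof.
elim: t b s => [q xs bs|c cs|x c cs|t1 IH1 t2 IH2|fr x t IH] b s //= H.
- by move=> e nu; rewrite e H //; lia.
- by case=> i1 i2; split; [apply: IH1 i1|apply: IH2 i2] => i w hi; apply: H; lia.
- case=> ic it; split; last by apply: IH it => i w hi; apply: H; lia.
  move=> nu; congr cinv: (ic nu); apply: funext => v.
  by apply/esym/eval_ids => i w hi; apply: H; lia.
Qed.

Lemma stored_keep A b s t C h h' : hkeep A h h' ->
  (forall m k, b <= m < b + areas t -> ~~ A m k) ->
  stored b s t C h -> stored b s t C h'.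
Proof.
move=> hk; elim: t b s => [q xs bs|c cs|x c cs|t1 IH1 t2 IH2|fr x t IH] b s //= H.
- move=> e nu; rewrite -e; have [|_ ->//] := hk b (key s nu) 0.
  by apply: H; lia.
- by case=> i1 i2; split; [apply: IH1 i1|apply: IH2 i2] => m k hi; apply: H; lia.
- case=> ic it; split; last by apply: IH it => i w hi; apply: H; lia.
  by move=> nu; apply: cinv_keep hk _ (ic nu) => m hm; apply: H; lia.
Qed.

(** Zero values are not stored, so [op] is skipped for them. The same code serves to delete the old
    value before the subtree changes and to insert the new one afterwards. *)
Definition touch b s x t (op : cmd K) : cmd K :=
  Seq (block (VConst 0 1%R :: rd false (3 + b) (x :: s) t
    (kcode s [:: IMove K 9 (rvar x); VMove K 1 0; VConst 2 0%R; IEqV K 7 1 2])))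
  (If 7 (Skip K) op).

Lemma wp_touch b s x t op st C Q :
  let w := eval cv C (3 + b) t (env st) in
  stored (3 + b) (x :: s) t C (heap st) -> consts st ->
  (w = 0%R -> forall st', look st st' -> Q st') ->
  (w != 0%R -> forall st', look st st' -> ireg st' 3 = key s (env st) ->
     ireg st' 9 = env st x -> vreg st' 1 = w -> wp P D op st' Q) ->
  wp P D (touch b s x t op) st Q.
Proof.
move=> w it hc H0 H1; apply: (@wp_bind _ _ _ _ _ _ (fun st' => [/\ look st st',
  ireg st' 3 = key s (env st), ireg st' 9 = env st x, vreg st' 1 = w &
  ireg st' 7 = (w == 0%R)])).
  apply: wp_cons => //; apply: (wp_rd (C := C)) => // st1 w1 l1 v1 e1.
  apply: wp_kcode => st2 l2 v2 k2.
  have l0 : look st (set_vreg st 0 1%R) by apply: look_set_vreg.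
  have l := look_trans l0 (look_trans l1 l2).
  have ew : vreg st2 0 = w by rewrite v2 v1 /= updxx mul1r e1.
  do 4 apply: wp_cons => //; apply: wp_nil.
  split.
  - by apply: look_trans l _.
  - by rewrite /= !updE /= k2 (keep_env (proj1 l1)).
  - by rewrite /= !updE /= -(keep_env (proj1 l)).
  - by rewrite /= !updE /= ew.
  - by rewrite /= !updE /= ew.
move=> st' [l k3 r9 v1 r7]; apply: wp_if; rewrite r7 => c7.
  by apply: wp_skip; apply: H0 l; move: c7; case: (w =P 0%R).
by apply: H1 l _ _ _ => //; move: c7; case: (w =P 0%R) => // + _ _; apply/eqP.
Qed.

(** The old value of a child is recomputed from the subtree, hence its deletion precedes the
    recursive update. Semiring register 33 carries the inserted value, as it survives the
    subroutines. *)
Fixpoint upc (isn : bool) b s t j : cmd K :=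
  match t with
  | Leaf _ _ _ => block (kcode s (ccode b
      (if isn then [:: VLoad K 1 10; VAdd K 1 1 33; VStore K 10 1]
       else [:: VConst 1 0%R; VStore K 10 1])))
  | Cst _ _ | Rng _ _ _ => Skip K
  | Mul t1 t2 => if j < b + areas t1 then upc isn b s t1 j
                 else upc isn (b + areas t1) s t2 j
  | Bind fr x t1 => Seq (touch b s x t1 (del fr b))
      (Seq (upc isn (3 + b) (x :: s) t1 j) (touch b s x t1 (ins fr b)))
  end.

Definition within b n : nat -> nat -> bool := fun m _ => b <= m < b + n.

Lemma leaf_store b s q xs bs C h k nu0 : xs =i s -> stored b s (Leaf q xs bs) C h ->
  stored b s (Leaf q xs bs) (updC C b (map nu0 xs) k)
    (Memory (imem h) (upd (vmem h) (cell b (key s nu0)) k)).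
Proof.
move=> e i nu /=; rewrite updE /updC /cell !npair_eq !eqxx andbT /=.
rewrite (_ : (key s nu == key s nu0) = (map nu xs == map nu0 xs)) ?i //.
apply/keyP/eqP => [H|/eq_in_map H x]; last by rewrite -e => /H.
by apply/eq_in_map => x; rewrite e => /H.
Qed.

Lemma upc_ok isn b s t j q xs bs C st w0 k : wf ar s t ->
  leaf_at b t j = Some (q, xs, bs) -> stored b s t C (heap st) -> consts st ->
  w0 = map (env st) xs -> k = (if isn then C j w0 + vreg st 33 else 0)%R ->
  wp P D (upc isn b s t j) st (fun st' => [/\ keep st st',
    hkeep (within b (areas t)) (heap st) (heap st') &
    stored b s t (updC C j w0 k) (heap st')]).
Proof.
elim: t b s C st k => [q' xs' bs'|c cs|x c cs|t1 IH1 t2 IH2|fr x t IH] b s C st k.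
- case=> e _ _ /=; case: eqP => // ej [_ ex _]; subst j xs' => i hc ew ek.
  apply: wp_kcode => st1 l1 v1 k1; apply: wp_ccode => st2 l2 v2 _ a2.
  have [l v] := (look_trans l1 l2, etrans v2 v1).
  have e0 : vmem (heap st2) (ireg st2 10) = C b w0.
    by rewrite (proj2 l) a2 k1 i ew.
  have fin st3 : keep st2 st3 -> heap st3 = Memory (imem (heap st2))
      (upd (vmem (heap st2)) (ireg st2 10) k) ->
      [/\ keep st st3, hkeep (within b 1) (heap st) (heap st3) &
       stored b s (Leaf q xs bs') (updC C b w0 k) (heap st3)].
    move=> k3 ->; rewrite (proj2 l) a2 k1; split.
    - exact: keep_trans (proj1 l) k3.
    - move=> m k' a n; split=> //=; rewrite updE /cell !npair_eq.
      by move: n; rewrite /within; case: ifP => //; lia.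
    - by rewrite ew; apply: leaf_store.
  case: (isn) ek => ek.
    do 3 apply: wp_cons => //; apply: wp_nil; apply: fin.
      by split=> //=.
    rewrite /= !updE /= e0 ek; congr Memory; congr upd.
    by have [_ -> _ _] := proj1 l.
  do 2 apply: wp_cons => //; apply: wp_nil; apply: fin => //.
  by rewrite /= !updE /= ek.
- by [].
- by [].
- case=> w1 w2 /=; case: ifP => hj lf [i1 i2] hc ew ek.
    apply: wp_mono (IH1 _ _ _ _ _ w1 lf i1 hc ew ek) => st' [k' h' i']; split=> //.
      by apply: hkeep_sub h' => m k''; rewrite /within; lia.
    split=> //; apply: stored_keep h' _ _.
      by move=> m k''; rewrite /within; lia.
    apply: stored_ext i2 => i w hi; rewrite /updC; case: eqP => // ei; lia.
  apply: wp_mono (IH2 _ _ _ _ _ w2 lf i2 hc ew ek) => st' [k' h' i']; split=> //.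
    by apply: hkeep_sub h' => m k''; rewrite /within; lia.
  split=> //; apply: stored_keep h' _ _.
    by move=> m k''; rewrite /within; lia.
  have jb := leaf_at_bound lf.
  apply: stored_ext i1 => i w hi; rewrite /updC; case: eqP => // ei; lia.
case=> xs' wt _ lf [ic it] hc ew ek.
have jb := leaf_at_bound lf.
pose nu0 := env st; pose v0 := nu0 x; pose kap := key s nu0.
pose G C' nu := fun v => eval cv C' (3 + b) t (upd nu x v).
pose C' := updC C j w0 k.
have Gv0 C'' : G C'' nu0 v0 = eval cv C'' (3 + b) t nu0 by rewrite /G upd_id.
(* With the affected child set to zero, the families before and after the update coincide by
   [eval_other]. This common family is the state between deletion and insertion. *)
have upd0 : upd (G C nu0) v0 0%R = upd (G C' nu0) v0 0%R.
  apply: funext => v; rewrite !updE; case: eqP => // /eqP nv.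
  apply/esym; rewrite /G /C' ew; apply: eval_other wt lf _.
  by rewrite /= npair_eq updxx (negbTE nv).
rewrite [upc _ _ _ _ _]/=.
apply: (@wp_bind _ _ _ _ _ _ (fun st1 => [/\ keep st st1,
    hkeep (own b kap) (heap st) (heap st1) &
    cinv rep fr (heap st1) b kap (upd (G C nu0) v0 0%R)])).
  apply: (wp_touch (C := C)) => // [z|nz] st1 [k1 h1].
    split=> //; first by rewrite h1.
    rewrite h1; congr cinv: (ic nu0); apply/esym.
    by apply: (etrans _ (upd_id (G C nu0) v0)); rewrite Gv0 z.
  move=> e3 e9 e1; apply: wp_mono (@delP _ _ _ (G C nu0) _ _ _).
  - move=> st2; rewrite e3 e9 h1 => -[k2 h2 c2]; split=> //.
    exact: keep_trans k2.
  - by rewrite e9 e1 Gv0.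
  - by rewrite e1.
  - by rewrite h1 e3; apply: ic.
move=> st1 [k1 h1 c1]; have E1 := keep_env k1.
have it1 : stored (3 + b) (x :: s) t C (heap st1).
  by apply: stored_keep h1 _ it => m k'; rewrite /own; lia.
apply: wp_bind.
  apply: (IH _ _ _ _ k wt lf it1 (keep_consts k1 hc)); first by rewrite E1.
  by have [_ -> _ _] := k1.
move=> st2 [k2 h2 it2]; have E2 := keep_env k2.
have c2 : cinv rep fr (heap st2) b kap (upd (G C' nu0) v0 0%R).
  by rewrite -upd0; apply: cinv_keep h2 _ c1 => m hm; rewrite /within; lia.
have k02 := keep_trans k1 k2.
have fin st3 : keep st2 st3 -> hkeep (own b kap) (heap st2) (heap st3) ->
   cinv rep fr (heap st3) b kap (G C' nu0) ->
   [/\ keep st st3, hkeep (within b (areas (Bind fr x t))) (heap st) (heap st3) &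
    stored b s (Bind fr x t) C' (heap st3)].
  move=> k3 h3 c3; split; first exact: keep_trans k3.
    have sub (A : nat -> nat -> bool) h h' : (forall m k', A m k' -> within b (3 + areas t) m k') ->
        hkeep A h h' -> hkeep (within b (areas (Bind fr x t))) h h'.
      by move=> sA; apply: hkeep_sub.
    apply: (hkeep_trans (sub _ _ _ _ h1)); first by move=> m k'; rewrite /own /within; lia.
    apply: (hkeep_trans (sub _ _ _ _ h2)); first by move=> m k'; rewrite /within; lia.
    by apply: sub h3 => m k'; rewrite /own /within; lia.
  split; last by apply: stored_keep h3 _ it2 => m k'; rewrite /own; lia.
  (* A valuation with the updated key agrees with [nu0] on [s], and the children depend on nothing
     else apart from [x]; under any other key no child sees the changed tuple. *)
  move=> nu; case: (eqVneq (key s nu) kap) => [ek'|nk].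
    rewrite ek'; congr cinv: c3; apply: funext => v; apply: eval_dep wt _ => y.
    move/eqP/keyP: ek' => ek'; rewrite inE !updE; case: eqP => //= _ ys.
    by rewrite ek'.
  have ownN m : b <= m < 3 + b -> ~~ own b kap m (key s nu).
    by rewrite /own (negbTE nk) andbF.
  apply: (cinv_keep h3 ownN); apply: (cinv_keep h2).
    by move=> m hm; rewrite /within; lia.
  apply: (cinv_keep h1 ownN); congr cinv: (ic nu); apply: funext => v.
  apply/esym; rewrite /C' ew; apply: eval_other wt lf _.
  by rewrite /= npair_eq key_upd // negb_and nk orbT.
have E02 := keep_env k02.
apply: (wp_touch (C := C')) => //; first exact: keep_consts k02 hc.
  rewrite E02 => z st3 [k3 h3]; rewrite -h3 in c2; apply: fin => //.
    by rewrite h3.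
  by congr cinv: c2; rewrite -z -Gv0 upd_id.
rewrite E02 => nz st3 [k3 h3] e3 e9 e1.
apply: wp_mono (@insP _ _ _ (upd (G C' nu0) v0 0%R) _ _ _).
- move=> st4; rewrite e3 e9 h3 => -[k4 h4 c4]; apply: fin => //.
    exact: keep_trans k4.
  congr cinv: c4; apply: funext => v; rewrite !updE; case: eqP => // ->.
  by rewrite e1 -Gv0.
- by rewrite e9 updxx.
- by rewrite e1.
- by rewrite h3 e3.
Qed.

End TreeMemory.

(** * Enumeration *)

Section Gaps.
Variables (K : comNzSemiRingType) (P : prims K) (D : nat).
Implicit Types (t : trace K) (st : state K) (c : cmd K).

(** [g] is the time elapsed since the last output; [safe d g t] says that it
    never exceeds [d] along [t], and [gap g t] is its value after [t]. *)
Fixpoint safe d g t : bool :=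
  match t with
  | [::] => true
  | None :: t => (g < d) && safe d g.+1 t
  | Some _ :: t => safe d 0 t
  end.

Fixpoint gap g t : nat :=
  match t with
  | [::] => g
  | None :: t => gap g.+1 t
  | Some _ :: t => gap 0 t
  end.

Lemma safe_cat d g t1 t2 : safe d g (t1 ++ t2) = safe d g t1 && safe d (gap g t1) t2.
Proof. by elim: t1 g => [|[o|] t1 IH] g //=; rewrite IH ?andbA. Qed.

Lemma gap_cat g t1 t2 : gap g (t1 ++ t2) = gap (gap g t1) t2.
Proof. by elim: t1 g => [|[o|] t1 IH] g /=. Qed.

Lemma gap_silent g t : outputs t = [::] -> gap g t = g + size t.
Proof. by elim: t g => [|[o|] t IH] g //= o; rewrite ?IH //; lia. Qed.

Lemma safe_silent d g t : outputs t = [::] -> g + size t <= d -> safe d g t.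
Proof.
elim: t g => [|[o|] t IH] g //= o h; rewrite IH //; lia.
Qed.

Lemma safe_delay d t : safe d 0 t -> delay_at_most d t.
Proof.
move=> s t1 n t2 e; rewrite e !safe_cat in s.
move: s => /and3P[_ s _]; move: s; move: (gap 0 t1).
suff H g : safe d g (nseq n None) -> (n == 0) || (g + n <= d) by move=> g /H; lia.
by elim: n {e} g => // n IH g /= /andP[lt /IH]; lia.
Qed.

(** The analogue of [wp] for programs that output: [g] is the gap on entry, [q] bounds the gap on
    exit, and [O] lists the outputs in order. *)
Definition erun d g c st (Q : state K -> Prop) O q := exists st' t,
  [/\ exec P c st st' t, safe d g t, gap g t <= q, outputs t = O & Q st'].

Lemma erun_seq d g c1 c2 st R Q O1 O2 q1 q : erun d g c1 st R O1 q1 ->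
  (forall st' g', g' <= q1 -> R st' -> erun d g' c2 st' Q O2 q) ->
  erun d g (Seq c1 c2) st Q (O1 ++ O2) q.
Proof.
move=> [st1 [t1 [e1 s1 g1 o1 r]]] /(_ _ _ g1 r)[st2 [t2 [e2 s2 g2 o2 r2]]].
exists st2, (t1 ++ t2); split=> //; first exact: exec_Seq e1 e2.
- by rewrite safe_cat s1.
- by rewrite gap_cat.
- by rewrite outputs_cat o1 o2.
Qed.

Lemma erun_wp d g c st R : wp P D c st R -> g + cost D c <= d ->
  erun d g c st R [::] (g + cost D c).
Proof.
move=> [st1 [t [e l o r]]] h; exists st1, t; split=> //.
- by apply: safe_silent => //; lia.
- by rewrite gap_silent //; lia.
Qed.

Lemma erun_while d g r c st Q O q : ireg st r != 0 -> g < d ->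
  erun d g.+1 (Seq c (While r c)) st Q O q -> erun d g (While r c) st Q O q.
Proof.
move=> n lt [st' [t [e s gq o q']]]; exists st', (None :: t); split=> //=.
  inversion e as [| |c1 c2 s1 s2 s3 t1 t2 e1 e2| | | |]; subst.
  exact: exec_While_true n e1 e2.
by rewrite lt.
Qed.

Lemma erun_done d g r c st (Q : state K -> Prop) q : ireg st r = 0 -> g < d -> g < q -> Q st ->
  erun d g (While r c) st Q [::] q.
Proof.
move=> z lt lq qs; exists st, [:: None]; split=> //=; last by rewrite lt.
exact: exec_While_false.
Qed.

Lemma erun_mono d g c st (Q Q' : state K -> Prop) O q q' : q <= q' ->
  (forall st', Q st' -> Q' st') -> erun d g c st Q O q -> erun d g c st Q' O q'.
Proof.
move=> le h [st' [t [e s gq o qs]]]; exists st', t; split=> //.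
  exact: leq_trans le.
exact: h.
Qed.

End Gaps.

Fixpoint setv (nu : nat -> nat) xs w : nat -> nat :=
  match xs, w with
  | x :: xs, v :: w => setv (upd nu x v) xs w
  | _, _ => nu
  end.

Lemma setv_cat nu xs ys w1 w2 : size w1 = size xs ->
  setv nu (xs ++ ys) (w1 ++ w2) = setv (setv nu xs w1) ys w2.
Proof. by elim: xs nu w1 => [|x xs IH] nu [|v w1] //= [] /IH. Qed.

Lemma setv_out nu xs w y : y \notin xs -> setv nu xs w y = nu y.
Proof.
elim: xs nu w => [|x xs IH] nu [|v w] //=; rewrite inE negb_or => /andP[n ny].
by rewrite IH // upd_neq.
Qed.

Lemma setv_map nu nu' xs y : y \in xs -> setv nu xs (map nu' xs) y = nu' y.
Proof.
elim: xs nu => [|x xs IH] nu //=; rewrite inE.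
case: (boolP (y \in xs)) => [/IH-> //|n]; rewrite orbF => /eqP<-.
by rewrite setv_out // updxx.
Qed.

Lemma map_setv nu xs w : uniq xs -> size w = size xs -> map (setv nu xs w) xs = w.
Proof.
elim: xs nu w => [|x xs IH] nu [|v w] //= /andP[n u] [sz].
by rewrite IH // setv_out // updxx.
Qed.

Lemma setv_ext nu nu' xs w (A : pred nat) :
  (forall y, A y -> y \notin xs -> nu y = nu' y) -> size w = size xs ->
  forall y, A y -> setv nu xs w y = setv nu' xs w y.
Proof.
elim: xs nu nu' w => [|x xs IH] nu nu' [|v w] //= h sz y Ay.
  exact: h.
case: sz => sz; apply: IH => // z Az nz; rewrite !updE; case: eqP => // /eqP n.
by apply: h => //; rewrite inE negb_or n.
Qed.

Lemma flatten_allpairs (R S U V : Type) (F : U -> seq V) (f : R -> S -> U) s (t : R -> seq S) :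
  flatten [seq F z | z <- [seq f x y | x <- s, y <- t x]] =
  flatten [seq flatten [seq F (f x y) | y <- t x] | x <- s].
Proof. by elim: s => //= x s IH; rewrite map_cat flatten_cat IH -map_comp. Qed.

(** * Solutions of a plan and the loop nest that visits them *)

Section Enumeration.
Variables (K : comNzSemiRingType) (P : prims K) (D : nat).
Hypothesis semi_integralK : semi_integral K.
Variable rep : memory K -> {mset K}%mset -> Prop.
Variables (ar cv : nat -> nat) (C : nat -> seq nat -> K) (h : memory K).
Implicit Types (nu : nat -> nat) (s : seq nat) (st : state K) (t : tree).

Notation stored b s t := (stored rep cv b s t C h).
Notation eval := (eval cv C).
Notation oeval := (oeval cv C).

Definition arr b s nu i := imem h (npair (npair b.+1 (key s nu)) i).

(** Listed in the order in which the loops visit them; the counters run downwards, hence [rev]. *)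
Fixpoint sols b s t nu : seq (seq nat) :=
  match t with
  | Leaf _ _ _ | Cst _ _ => [:: [::]]
  | Rng x c cs => [seq [:: v] | v <- rev (iota 1 (mincst cv c cs))]
  | Mul t1 t2 => [seq w1 ++ w2 | w1 <- sols b s t1 nu, w2 <- sols (b + areas t1) s t2 nu]
  | Bind fr x t1 =>
      if fr then [seq v :: w | v <- map (arr b s nu) (rev (iota 0 (imem h (cell b (key s nu))))),
                               w <- sols (3 + b) (x :: s) t1 (upd nu x v)]
      else [:: [::]]
  end.

Lemma mulf_neq0' (a b : K) : a != 0%R -> b != 0%R -> (a * b)%R != 0%R.
Proof.
move=> na nb; apply/eqP => /semi_integralK[] e.
  by rewrite e eqxx in na.
by rewrite e eqxx in nb.
Qed.

Lemma mul_neq0 (a b : K) : (a * b)%R != 0%R -> a != 0%R /\ b != 0%R.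
Proof.
by move=> n; split; apply: contraNneq n => ->; rewrite ?mul0r ?mulr0.
Qed.

(** No zero divisors are used at products, where both stored factors are nonzero. Hence the child
    that leads to an output is kept in the array of its binder. *)
Lemma eval_live b t nu : oeval b t nu != 0%R -> eval b t nu != 0%R.
Proof.
elim: t b nu => [q xs bs|c cs|x c cs|t1 IH1 t2 IH2|fr x t IH] b nu //=.
- by rewrite oner_neq0.
- by move/mul_neq0 => [/IH1 n1 /IH2 n2]; apply: mulf_neq0'.
- case: fr => // /IH n; rewrite agg_true; case: asboolP => [_|[]].
    exact: oner_neq0.
  by exists (nu x); rewrite upd_id.
Qed.

Lemma oeval_dep b s t nu nu' : wf ar s t -> {in s ++ fv t, nu =1 nu'} ->
  oeval b t nu = oeval b t nu'.
Proof.
elim: t b s nu nu' => [q xs bs|c cs|x c cs|t1 IH1 t2 IH2|fr x t IH] b s nu nu' w H.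
- by apply: (eval_dep _ _ _ w) => y ys; apply: H; rewrite mem_cat ys.
- by [].
- by rewrite /= H // mem_cat mem_head orbT.
- case: w => w1 w2 /=; rewrite (IH1 _ _ _ nu' w1) ?(IH2 _ _ _ nu' w2) //.
    by move=> y; rewrite mem_cat => ys; apply: H; rewrite /= !mem_cat; case/orP: ys => ->; rewrite ?orbT.
  by move=> y; rewrite mem_cat => ys; apply: H; rewrite /= !mem_cat; case/orP: ys => ->; rewrite ?orbT.
- case: fr w H => w H; last first.
    by apply: (eval_dep _ _ _ w) => y ys; apply: H; rewrite mem_cat ys.
  have [_ w' _] := w; apply: IH w' _ => y /=; rewrite inE mem_cat => ys; apply: H.
  by rewrite mem_cat inE orbCA.
Qed.

Lemma sols_dep b s t nu nu' : wf ar s t -> {in s, nu =1 nu'} ->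
  sols b s t nu = sols b s t nu'.
Proof.
elim: t b s nu nu' => [q xs bs|c cs|x c cs|t1 IH1 t2 IH2|fr x t IH] b s nu nu' //=.
  by case=> w1 w2 H; rewrite (IH1 _ _ _ _ w1 H) (IH2 _ _ _ _ w2 H).
case=> xs w _ H; case: fr => //.
have e : key s nu = key s nu' by apply/eqP/keyP.
rewrite e; have -> : arr b s nu = arr b s nu' by rewrite /arr e.
congr flatten; apply: eq_map => v; congr map; apply: IH w _ => y.
by rewrite inE !updE; case: eqP => //= _ /H.
Qed.

Lemma sols_ok b s t nu : wf ar s t -> stored b s t -> uniq (fv t) ->
  {in fv t, forall y, y \notin s} -> eval b t nu != 0%R ->
  [/\ forall w, w \in sols b s t nu ->
        size w = size (fv t) /\ oeval b t (setv nu (fv t) w) != 0%R,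
      forall nu', {in s, nu' =1 nu} -> oeval b t nu' != 0%R ->
        map nu' (fv t) \in sols b s t nu &
      uniq (sols b s t nu)].
Proof.
elim: t b s nu => [q xs bs|c cs|x c cs|t1 IH1 t2 IH2|fr x t IH] b s nu /=.
- by move=> *; split=> // w; rewrite inE => /eqP ->.
- by move=> *; split=> // w; rewrite inE => /eqP ->.
- move=> _ _ _ _ _; split=> [w /mapP[v]|nu' _|].
  + rewrite mem_rev mem_iota => hv ->; split=> //=; rewrite updxx.
    by rewrite (_ : 0 < v <= _) ?oner_neq0 //; lia.
  + case: ifP => [hv _|_]; last by rewrite eqxx.
    by apply/mapP; exists (nu' x) => //; rewrite mem_rev mem_iota; lia.
  + by rewrite map_inj_uniq ?rev_uniq ?iota_uniq // => u v [].
- case=> w1 w2 [i1 i2]; rewrite cat_uniq => /and3P[u1 dis u2] ds /mul_neq0[n1 n2].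
  have [|S1 M1 U1] := IH1 b s nu w1 i1 u1 _ n1.
    by move=> y yf; apply: ds; rewrite mem_cat yf.
  have [|S2 M2 U2] := IH2 (b + areas t1) s nu w2 i2 u2 _ n2.
    by move=> y yf; apply: ds; rewrite mem_cat yf orbT.
  split.
  + move=> w /allpairsP[[v1 v2] /= [/S1[z1 o1] /S2[z2 o2] ->]].
    rewrite !size_cat z1 z2 setv_cat //; split=> //.
    have ag y : y \notin fv t2 -> setv (setv nu (fv t1) v1) (fv t2) v2 y = setv nu (fv t1) v1 y.
      exact: setv_out.
    apply: mulf_neq0'.
      rewrite (oeval_dep _ w1 (nu' := setv nu (fv t1) v1)) // => y; rewrite mem_cat => ys.
      apply: ag; case/orP: ys => ys; last by apply: contra dis => y2; apply/hasP; exists y.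
      by apply: contraL ys => y2; apply: ds; rewrite mem_cat y2 orbT.
    rewrite (oeval_dep _ w2 (nu' := setv nu (fv t2) v2)) // => y; rewrite mem_cat => ys.
    apply: (setv_ext (A := fun y => y \in s ++ fv t2)) => //; last by rewrite mem_cat.
    move=> z; rewrite mem_cat => /orP[zs|->//] nz; apply: setv_out.
    by apply: contraL zs => z1'; apply: ds; rewrite mem_cat z1'.
  + move=> nu' ag /mul_neq0[o1 o2]; rewrite map_cat.
    by apply/allpairsP; exists (map nu' (fv t1), map nu' (fv t2)); split; [exact: M1|exact: M2|].
  + apply: allpairs_uniq => // -[a1 a2] [b1 b2] /allpairsP[[? ?] [/= /S1[za _] _ [-> _]]].
    move=> /allpairsP[[? ?] [/= /S1[zb _] _ [-> _]]] /= /eqP.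
    by rewrite eqseq_cat ?za ?zb // => /andP[/eqP-> /eqP->].
- case=> xs w; case: fr => [_ [ic it] /= /andP[xf u] ds|/= /eqP-> _ _ _ n]; last first.
    by split=> // v; rewrite inE => /eqP->.
  case: asboolP => [_ _|_]; last by rewrite eqxx.
  have [_ [a1 a2]] := ic nu.
  have ds' : {in fv t, forall y, y \notin x :: s}.
    move=> y yf; rewrite inE negb_or ds ?inE ?yf ?orbT // andbT.
    by apply: contraNneq xf => <-.
  have vals v : v \in map (arr b s nu) (rev (iota 0 (imem h (cell b (key s nu))))) ->
      eval (3 + b) t (upd nu x v) != 0%R.
    by case/mapP=> i; rewrite mem_rev mem_iota => /andP[_ /a1[nz _]] ->.
  split.
  + move=> v /allpairsPdep[a [v' [/vals na]]].
    have [S _ _] := IH _ _ _ w it u ds' na.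
    by move=> /S[z o] ->; rewrite /= z.
  + move=> nu' ag n; apply/allpairsPdep; exists (nu' x), (map nu' (fv t)).
    have n' : eval (3 + b) t (upd nu x (nu' x)) != 0%R.
      rewrite (eval_dep _ _ _ w (nu' := nu')); first exact: eval_live n.
      by move=> y; rewrite inE updE; case: eqP => [->|_ /= /ag].
    have [_ M _] := IH _ _ _ w it u ds' n'.
    split=> //; last first.
      apply: M n => y; rewrite inE updE; case: eqP => [->|_ /= /ag] //.
    have [lt e] := a2 _ n'.
    by rewrite -{1}e; apply: map_f; rewrite mem_rev mem_iota.
  + apply: allpairs_uniq_dep => [|a ha|].
    * rewrite map_inj_in_uniq ?rev_uniq ?iota_uniq // => i j.
      rewrite !mem_rev !mem_iota => /andP[_ /a1[_ ei]] /andP[_ /a1[_ ej]] e.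
      by rewrite -ei -ej /=; move: e; rewrite /arr => ->.
    * by have [] := IH _ _ _ w it u ds' (vals _ ha).
    * by move=> [a w1] [a' w1'] _ _ /= [-> ->].
Qed.

(** In a product the second factor is enumerated in the body of the first. A range variable is its
    own counter and takes the values from the bound down to 1; an array index is decremented before
    it is used. The key is recomputed in each round because the body overwrites the work
    registers. *)
Fixpoint en b s t (body : cmd K) : cmd K :=
  match t with
  | Leaf _ _ _ | Cst _ _ => body
  | Rng x c cs => Seq (block (mcode c cs [:: IMove K (rvar x) 4]))
      (While (rvar x) (Seq body (block [:: IConst K 4 1; ISub K (rvar x) (rvar x) 4])))
  | Mul t1 t2 => en b s t1 (en (b + areas t1) s t2 body)
  | Bind fr x t1 => if fr then
      Seq (block (kcode s (ccode b [:: ILoad K (rcnt x) 10])))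
        (While (rcnt x) (Seq
          (block (IConst K 4 1 :: ISub K (rcnt x) (rcnt x) 4 ::
            kcode s (IConst K 4 b.+1 :: mpair K 6 4 3 ++
                     mpair K 10 6 (rcnt x) ++ [:: ILoad K (rvar x) 10])))
          (en (3 + b) (x :: s) t1 body)))
      else body
  end.

(** Steps that the loop headers add on the way to the body, and likewise on the way from it out of
    the nest. The 3 for a range pays for the loop test and the two instructions that decrement. *)
Fixpoint slack b s t : nat :=
  match t with
  | Leaf _ _ _ | Cst _ _ => 0
  | Rng x c cs => cost D (block (mcode c cs [:: IMove K (rvar x) 4])) + 3
  | Mul t1 t2 => slack b s t1 + slack (b + areas t1) s t2
  | Bind fr x t1 => if fr then
      cost D (block (kcode s (ccode b [:: ILoad K (rcnt x) 10]))) +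
      cost D (block (IConst K 4 1 :: ISub K (rcnt x) (rcnt x) 4 ::
            kcode s (IConst K 4 b.+1 :: mpair K 6 4 3 ++
                     mpair K 10 6 (rcnt x) ++ [:: ILoad K (rvar x) 10]))) + 1 +
      slack (3 + b) (x :: s) t1
      else 0
  end.

(** [X] collects the variables whose registers a loop nest may change. *)
Definition efr (X : seq nat) st st' := heap st' = heap st /\
  forall k, (forall x, x \in X -> rodd k != rvar x /\ rodd k != rcnt x) ->
    ireg st' (rodd k) = ireg st (rodd k).

(** Valid for every entry gap up to [p], with exit gap at most [q]; [pre] and [outs] refer to the
    valuation at entry. *)
Definition espec X d p q c (pre : (nat -> nat) -> Prop) outs := forall st g,
  heap st = h -> consts cv st -> pre (env st) -> g <= p ->
  erun P d g c st (efr X st) (outs (env st)) q.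

Definition dep (X : seq nat) (T : Type) (f : (nat -> nat) -> T) :=
  forall nu nu', (forall y, y \notin X -> nu y = nu' y) -> f nu = f nu'.

Lemma efr_trans X st1 st2 st3 : efr X st1 st2 -> efr X st2 st3 -> efr X st1 st3.
Proof.
move=> [a b] [a' b']; split; first by rewrite a'.
by move=> k n; rewrite b' // b.
Qed.

Lemma efr_sub X Y st st' : {subset X <= Y} -> efr X st st' -> efr Y st st'.
Proof. by move=> sub [a b]; split=> // k n; apply: b => x /sub; apply: n. Qed.

Lemma efr_look X st st' : look st st' -> efr X st st'.
Proof. by move=> [[a _ _ _] b]; split. Qed.

Lemma efr_env X st st' y : efr X st st' -> y \notin X -> env st' y = env st y.
Proof.
move=> [_ H] n; rewrite /env rvarE; apply: H => x xX; rewrite -rvarE /rvar /rcnt.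
by have ne : x <> y; [move=> e; rewrite -e xX in n | lia].
Qed.

Lemma efr_cnt X st st' y : efr X st st' -> y \notin X ->
  ireg st' (rcnt y) = ireg st (rcnt y).
Proof.
move=> [_ H] n; rewrite rcntE; apply: H => x xX; rewrite -rcntE /rvar /rcnt.
by have ne : x <> y; [move=> e; rewrite -e xX in n | lia].
Qed.

Lemma efr_consts X st st' : efr X st st' -> consts cv st -> consts cv st'.
Proof.
move=> [_ H] hc c; rewrite -hc rcstE; congr _.+1; apply: H => x _.
by rewrite -rcstE /rvar /rcnt /rcst; lia.
Qed.

Definition oute (T : Type) b s t (outs : (nat -> nat) -> seq T) nu :=
  flatten [seq outs (setv nu (fv t) w) | w <- sols b s t nu].

Definition pree b s t (pre : (nat -> nat) -> Prop) nu :=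
  eval b t nu != 0%R /\ forall w, w \in sols b s t nu -> pre (setv nu (fv t) w).

Lemma sols_size b s t nu w : w \in sols b s t nu -> wf ar s t -> size w = size (fv t).
Proof.
elim: t b s nu w => [q xs bs|c cs|x c cs|t1 IH1 t2 IH2|fr x t IH] b s nu w /=.
- by rewrite inE => /eqP->.
- by rewrite inE => /eqP->.
- by case/mapP=> v _ ->.
- by case/allpairsP=> -[v1 v2] [/= /IH1 a /IH2 b' ->] [/a e1 /b' e2]; rewrite !size_cat e1 e2.
- case: fr => [|]; last by rewrite inE => /eqP-> [_ _ /= /eqP ->].
  by case/allpairsPdep=> v [v' [_ /IH e ->]] [_ /e /= ->].
Qed.

Lemma setv_dep X t nu nu' w : (forall y, y \notin fv t ++ X -> nu y = nu' y) ->
  size w = size (fv t) ->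
  forall y, y \notin X -> setv nu (fv t) w y = setv nu' (fv t) w y.
Proof.
move=> H sz; apply: (setv_ext (A := fun y => y \notin X)) sz => y n1 n2.
by apply: H; rewrite mem_cat negb_or n2.
Qed.

Lemma dep_scope X s t nu nu' : {in fv t ++ X, forall y, y \notin s} ->
  (forall y, y \notin fv t ++ X -> nu y = nu' y) -> {in s, nu =1 nu'}.
Proof. by move=> ds H y ys; apply: H; apply: contraL ys => /ds. Qed.

Lemma dep_oute X (T : Type) b s t (outs : (nat -> nat) -> seq T) : wf ar s t ->
  {in fv t ++ X, forall y, y \notin s} -> dep X outs -> dep (fv t ++ X) (oute b s t outs).
Proof.
move=> w ds dX nu nu' H; rewrite /oute.
rewrite -(sols_dep b w (dep_scope ds H)); congr flatten; apply/eq_in_map => v vs.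
by apply: dX; apply: setv_dep => //; apply: sols_size vs w.
Qed.

Lemma dep_pree X b s t pre : wf ar s t ->
  {in fv t ++ X, forall y, y \notin s} -> dep X pre -> dep (fv t ++ X) (pree b s t pre).
Proof.
move=> w ds dX nu nu' H; have ag := dep_scope ds H.
rewrite /pree (eval_dep _ _ _ w ag) (sols_dep b w ag); congr and.
have e v : v \in sols b s t nu' -> pre (setv nu (fv t) v) = pre (setv nu' (fv t) v).
  by move=> vs; apply: dX; apply: setv_dep => //; apply: sols_size vs w.
by apply: propext; split=> F v vs; [rewrite -e //|rewrite e //]; apply: F.
Qed.

(** Only the first round can start with a gap as large as [a], the later ones start with at most
    [z]. One round thus suffices to bring the exit gap down to [z.+1]; without any round the entry
    gap itself has to be at most [z]. *)
Lemma erun_loop (I : nat -> state K -> Prop) (outs : nat -> seq (seq nat * K)) r c d a z :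
  (forall n st g, I n.+1 st -> g <= a -> erun P d g.+1 c st (I n) (outs n) z) ->
  (forall n st, I n st -> ireg st r = n) -> z <= a -> a < d ->
  forall n st g, I n st -> g <= (if n == 0 then z else a) ->
  erun P d g (While r c) st (I 0) (flatten [seq outs i | i <- rev (iota 0 n)]) z.+1.
Proof.
move=> hc hr za ad; elim=> [|n IH] st g Ist gle.
  by rewrite /= in gle; apply: erun_done => //; [exact: hr | lia].
rewrite /= in gle; apply: erun_while; [by rewrite (hr _ _ Ist) | lia |].
rewrite -[in iota 0 _]addn1 iotaD rev_cat /=; apply: erun_seq (hc _ _ _ Ist gle) _.
by move=> st' g' gz Ist'; apply: IH => //; case: ifP => // _; lia.
Qed.

(** On the way in the gap grows from [p] by at most the slack; the body resets it to at most [q],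
    and the way out adds the slack again. By [q + slack <= p] a loop can start its next round within
    the same budget. All this relies on loops that are never empty. *)
Lemma en_ok t b s body (outs : (nat -> nat) -> seq (seq nat * K)) pre X d p q :
  wf ar s t -> stored b s t -> uniq (fv t ++ X) ->
  {in fv t ++ X, forall y, y \notin s} -> dep X outs -> dep X pre ->
  espec X d (p + slack b s t) q body pre outs ->
  q + slack b s t <= p -> p + slack b s t <= d ->
  espec (fv t ++ X) d p (q + slack b s t) (en b s t body) (pree b s t pre)
    (oute b s t outs).
Proof.
elim: t b s body outs pre X p q => [q' xs bs|c cs|x c cs|t1 IH1 t2 IH2|fr x t IH]
  b s body outs pre X p q wt it uX ds dO dP hb le1 le2 st g eh hc [nz Hpre] gp.
- rewrite /oute /= cats0 addn0; apply: hb => //; last by rewrite addn0.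
  by apply: (Hpre [::]); rewrite inE.
- rewrite /oute /= cats0 addn0; apply: hb => //; last by rewrite addn0.
  by apply: (Hpre [::]); rewrite inE.
- have xX : x \notin X by case/andP: uX.
  rewrite [en _ _ _ _]/= -[oute _ _ _ _ _]cat0s.
  set m := mincst cv c cs.
  (* The range is not empty, since constants are positive. *)
  have m0 : 0 < m.
    have pos c' : 0 < cv c' by rewrite -hc.
    rewrite /m /mincst; elim: cs (cv c) (pos c) {le1 le2 wt it ds uX nz Hpre hb m} => //=.
    by move=> c' cs IH n n0; apply: IH; have := pos c'; lia.
  have sl : slack b s (Rng x c cs) = cost D (block (mcode c cs [:: IMove K (rvar x) 4])) + 3 by [].
  rewrite sl in le1 le2 hb *; pose nu := env st.
  apply: (@erun_seq _ _ _ _ _ _ _ (fun st' => efr (x :: X) st st' /\ ireg st' (rvar x) = m)).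
    apply: (erun_wp (D := D)); last lia.
    apply: (wp_mcode (cv := cv)) => // st1 l1 v1 m1.
    apply: wp_cons => //; apply: wp_nil; split; last by rewrite /= updE eqxx m1.
    apply: efr_trans (efr_look _ l1) _; split=> // k' /(_ x (mem_head _ _))[n _].
    by rewrite /= upd_neq.
  move=> st1 g1 g1le [f1 x1].
  have -> : oute b s (Rng x c cs) outs (env st) =
      flatten [seq outs (upd nu x i.+1) | i <- rev (iota 0 m)].
    rewrite /oute /= -map_comp -[1]addn0 iotaDl -map_rev -map_comp.
    by congr flatten; apply: eq_map => i /=; rewrite add1n.
  have wr st' : efr (x :: X) st st' -> heap st' = h /\ consts cv st'.
    by move=> f; split; [rewrite (proj1 f) | apply: efr_consts f hc].
  have lp := @erun_loop (fun n st' => [/\ efr (x :: X) st st', ireg st' (rvar x) = n & n <= m])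
     (fun i => outs (upd nu x i.+1)) (rvar x)
     (Seq body (block [:: IConst K 4 1; ISub K (rvar x) (rvar x) 4])) d
     (p + cost D (block (mcode c cs [:: IMove K (rvar x) 4]))) (q + 2).
  apply: (erun_mono (q := (q + 2).+1) (Q := fun st' =>
    [/\ efr (x :: X) st st', ireg st' (rvar x) = 0 & 0 <= m])).
  + lia.
  + by move=> st' [].
  apply: lp => //; [|by move=> n st' []|lia|lia|]; last first.
    by rewrite (_ : (m == 0) = false); lia.
  move=> n st' g' [f e le] gle.
  have [E1 E2] := wr st' f.
  have ag y : y \notin X -> env st' y = upd nu x n.+1 y.
    move=> yX; rewrite updE; case: eqP => [-> //|/eqP nx].
    by apply: (efr_env f); rewrite inE negb_or nx.
  rewrite -(dO _ _ ag) -[outs _]cats0.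
  apply: (@erun_seq _ _ _ _ _ _ _ (fun st2 => efr X st' st2) _ _ _ q).
    apply: hb => //; last lia.
    rewrite (dP _ _ ag); apply: (Hpre [:: n.+1]); apply: map_f.
    by rewrite mem_rev mem_iota; lia.
  move=> st2 g2 g2le f2.
  apply: (@erun_mono _ _ _ _ _ _ (fun st3 => efr (x :: X) st2 st3 /\
      ireg st3 (rvar x) = (ireg st2 (rvar x)).-1) _ _ (g2 + 2)); [lia| |].
    move=> st3 [f3 x3]; split; last lia.
      apply: efr_trans f _; apply: efr_trans f3; apply: efr_sub f2.
      by move=> y yX; rewrite inE yX orbT.
    by rewrite x3; have := efr_env f2 xX; rewrite /env => ->; rewrite e.
  apply: (erun_wp (D := D)); last by rewrite /=; lia.
  do 2 apply: wp_cons => //; apply: wp_nil; split.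
    split=> // k' /(_ x (mem_head _ _))[nk _]; rewrite /= upd_neq //= upd_neq //.
  by rewrite /= !updE eqxx /= ?rvar_lo // subn1.
- move: uX ds; rewrite /= -catA => uX ds.
  case: wt nz => wt1 wt2 /mul_neq0 [nz1 nz2]; case: it => it1 it2.
  rewrite /= in le1 le2 hb.
  have uX2 : uniq (fv t2 ++ X) by move: uX; rewrite cat_uniq => /and3P[].
  have ds2 : {in fv t2 ++ X, forall y, y \notin s}.
    by move=> y yf; apply: ds; rewrite mem_cat yf orbT.
  have hb2 := IH2 (b + areas t1) s body outs pre X (p + slack b s t1) q wt2 it2 uX2
    ds2 dO dP.
  have hb1 := IH1 b s (en (b + areas t1) s t2 body) (oute (b + areas t1) s t2 outs)
    (pree (b + areas t1) s t2 pre) (fv t2 ++ X) p (q + slack (b + areas t1) s t2)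
    wt1 it1 uX ds (dep_oute _ wt2 ds2 dO) (dep_pree _ wt2 ds2 dP).
  have ag w y : y \in s -> setv (env st) (fv t1) w y = env st y.
    move=> ys; apply: setv_out; apply: contraL ys => y1; apply: ds.
    by rewrite mem_cat y1.
  have agE w : sols (b + areas t1) s t2 (setv (env st) (fv t1) w) =
               sols (b + areas t1) s t2 (env st).
    by apply: sols_dep wt2 _; apply: ag.
  have -> : oute b s (Mul t1 t2) outs (env st) =
      oute b s t1 (oute (b + areas t1) s t2 outs) (env st).
    rewrite /oute /= flatten_allpairs; congr flatten.
    apply/eq_in_map => w ws /=; rewrite agE; congr flatten; apply: eq_map => w' /=.
    by rewrite setv_cat // (sols_size ws wt1).
  rewrite addnA addnAC; apply: hb1 => //.
  + apply: hb2; [|lia|lia].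
    by rewrite -addnA.
  + lia.
  + lia.
  + split=> // w ws; split; first by rewrite (eval_dep _ _ _ wt2 (ag w)).
    move=> w'; rewrite agE => ws'; rewrite -setv_cat ?(sols_size ws wt1) //.
    by apply: Hpre; apply/allpairsP; exists (w, w').
- case: fr wt it uX ds hb le1 le2 nz Hpre => wt it uX ds hb le1 le2 nz Hpre; last first.
    have f0 : fv t = [::] by case: wt => _ _ /= /eqP.
    rewrite /oute /= f0 /= cats0 addn0 in uX ds hb Hpre *; rewrite addn0; apply: hb => //.
    by apply: (Hpre [::]); rewrite inE.
  case: (wt) => xs w _; case: it => ic it; rewrite /= in uX ds.
  pose B1 := block (kcode s (ccode b [:: ILoad K (rcnt x) 10])).
  pose B2 := block (IConst K 4 1 :: ISub K (rcnt x) (rcnt x) 4 ::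
    kcode s (IConst K 4 b.+1 :: mpair K 6 4 3 ++
             mpair K 10 6 (rcnt x) ++ [:: ILoad K (rvar x) 10])).
  pose sl := slack (3 + b) (x :: s) t.
  have sle : slack b s (Bind true x t) = cost D B1 + cost D B2 + 1 + sl by [].
  have -> : en b s (Bind true x t) body =
    Seq B1 (While (rcnt x) (Seq B2 (en (3 + b) (x :: s) t body))) by [].
  rewrite sle in hb le1 le2 *; rewrite -[oute _ _ _ _ _]cat0s.
  pose nu := env st; pose N := imem h (cell b (key s nu)).
  case/andP: uX => xf uX.
  have xs' : x \notin fv t ++ X := xf.
  have ds' : {in fv t ++ X, forall y, y \notin x :: s}.
    move=> y yf; rewrite inE negb_or ds ?inE ?yf ?orbT // andbT.
    by apply: contraNneq xf => <-.
  have [_ [a1 a2]] := ic nu; rewrite -/N in a1 a2.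
  (* A nonzero value of a free binder has a witness, so its array is not empty. *)
  have N0 : 0 < N.
    move: nz; rewrite /=; case: asboolP => [[v /a2[lt _]] _|_]; first lia.
    by rewrite eqxx.
  have wr st' : efr (x :: fv t ++ X) st st' ->
      [/\ heap st' = h, consts cv st' & {in s, env st' =1 nu}].
    move=> f; split; [by rewrite (proj1 f) | exact: efr_consts f hc |].
    by move=> y ys; apply: (efr_env f); apply: contraL ys => /ds.
  have ke st' : efr (x :: fv t ++ X) st st' -> key s (env st') = key s nu.
    by move=> /wr[_ _ H]; apply/eqP/keyP.
  apply: (@erun_seq _ _ _ _ _ _ _ (fun st' => efr (x :: fv t ++ X) st st' /\ ireg st' (rcnt x) = N)).
    apply: (erun_wp (D := D)); last lia.
    apply: wp_kcode => st1 l1 v1 k1; apply: wp_ccode => st2 l2 v2 _ a10.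
    have l := look_trans l1 l2.
    apply: wp_cons => //; apply: wp_nil; split; last first.
      by rewrite /= updE eqxx a10 k1 (proj2 l) eh.
    apply: efr_trans (efr_look _ l) _; split=> // k' /(_ x (mem_head _ _))[_ n].
    by rewrite /= upd_neq.
  move=> st1 g1 g1le [f1 x1].
  have -> : oute b s (Bind true x t) outs (env st) =
      flatten [seq oute (3 + b) (x :: s) t outs (upd nu x (arr b s nu i)) | i <- rev (iota 0 N)].
    rewrite /oute /= flatten_allpairs -map_comp; congr flatten.
  have lp := @erun_loop (fun n st' => [/\ efr (x :: fv t ++ X) st st', ireg st' (rcnt x) = n & n <= N])
     (fun i => oute (3 + b) (x :: s) t outs (upd nu x (arr b s nu i))) (rcnt x)
     (Seq B2 (en (3 + b) (x :: s) t body)) d (p + cost D B1) (q + sl).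
  apply: (erun_mono (q := (q + sl).+1) (Q := fun st' =>
    [/\ efr (x :: fv t ++ X) st st', ireg st' (rcnt x) = 0 & 0 <= N])).
  + lia.
  + by move=> st' [].
  apply: lp => //; [|by move=> n st' []|lia|lia|]; last first.
    by rewrite (_ : (N == 0) = false); lia.
  move=> n st' g' [f e le] gle.
  have [E1 E2 E3] := wr st' f.
  rewrite -[oute _ _ _ _ _]cat0s.
  apply: (@erun_seq _ _ _ _ _ _ _ (fun st2 => [/\ efr (x :: fv t ++ X) st' st2,
      ireg st2 (rcnt x) = n & env st2 x = arr b s nu n])).
    apply: (erun_wp (D := D)); last lia.
    do 2 apply: wp_cons => //; set st2 := step _ _ _; apply: wp_kcode => st3 l3 v3 k3.
    have f2 : efr (x :: fv t ++ X) st' st2.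
      split=> // k' /(_ x (mem_head _ _))[_ nk]; rewrite /= upd_neq // upd_neq //.
    have c2 : ireg st2 (rcnt x) = n.
      rewrite /= !updE eqxx /= e.
      by rewrite ?updE /= subn1.
    have f3 := efr_trans f2 (efr_look (x :: fv t ++ X) l3).
    have c3 : ireg st3 (rcnt x) = n.
      by have [[H _ _ _] _] := l3; rewrite rcntE H -rcntE.
    apply: wp_cons => //; apply: wp_mpair => // u eu; apply: wp_mpair => // u' eu'.
    apply: wp_cons => //; apply: wp_nil.
    have h3 : heap st3 = h by rewrite (proj2 l3).
    have ks : ireg st3 3 = key s nu by rewrite k3 (ke _ (efr_trans f f2)).
    split.
    * apply: efr_trans f3 _; split=> // k' /(_ x (mem_head _ _))[nk _].
      by rewrite /= upd_neq.
    * by rewrite -c3 /= /rcnt /rvar upd_neq //; lia.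
    * rewrite /env /= updE eqxx updE /= h3 eu' /= updE /= eu /= !updE /= ks.
      by rewrite /arr -c3.
  move=> st2 g2 g2le [f2 c2 x2].
  have ff2 := efr_trans f f2; have [F1 F2 F3] := wr st2 ff2.
  have hb' := IH (3 + b) (x :: s) body outs pre X (p + cost D B1 + cost D B2 + 1) q
     w it uX ds' dO dP.
  have ag y : y \notin fv t ++ X -> env st2 y = upd nu x (arr b s nu n) y.
    move=> yX; rewrite updE; case: eqP => [-> //|/eqP nx].
    by apply: (efr_env ff2); rewrite inE negb_or nx.
  rewrite -(dep_oute _ w ds' dO ag).
  apply: (@erun_mono _ _ _ _ _ _ (efr (fv t ++ X) st2) _ _ (q + sl)); [lia| |].
    move=> st3 f3; split; last lia.
      by apply: efr_trans ff2 _; apply: efr_sub f3 => y yX; rewrite inE yX orbT.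
    by rewrite (efr_cnt f3).
  apply: hb'; [|lia|lia|by []|by []| |lia].
  + by move: hb; rewrite /espec !addnA.
  + rewrite (dep_pree _ w ds' dP ag); split.
      by have [] := a1 n le.
    move=> w' ws'; apply: (Hpre (arr b s nu n :: w')).
    apply/allpairsPdep; exists (arr b s nu n), w'; split=> //.
    by apply: map_f; rewrite mem_rev mem_iota.
Qed.

End Enumeration.

(** * From facts to atoms: reading a fact and updating the atoms that it matches *)

Definition upd_fact (K : comNzSemiRingType) (isn : bool) (E : seq nat -> K) e0 (k : K) : seq nat -> K :=
  fun e => if e == e0 then (if isn then (E e0 + k)%R else 0%R) else E e.

Section LeafContents.
Variables (K : comNzSemiRingType) (T : tree) (cv : nat -> nat).
Implicit Types (E : seq nat -> K).

(** Comparing each argument with the one at the first occurrence of its variable tests that the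
    tuple respects repeated variables. *)
Definition fits (xs : seq nat) (bs : seq (nat * nat)) w : bool :=
  ([seq nth 0 w (index x xs) | x <- xs] == w) &&
  all (fun p => nth 0 w p.1 <= cv p.2) bs.

(** Repeated variables and comparisons are absorbed by the atom: a tuple that violates them counts
    as absent. *)
Definition cont E i w : K :=
  if leaf_at 0 T i is Some (q, xs, bs) then
    if fits xs bs w then E (q :: w) else 0%R
  else 0%R.

End LeafContents.

Section TreeUpdate.
Variables (K : comNzSemiRingType) (P : prims K) (D : nat).
Variable rep : memory K -> {mset K}%mset -> Prop.
Variables ins del : bool -> nat -> cmd K.
Hypothesis insP : ins_spec P rep D ins.
Hypothesis delP : del_spec P rep D del.
Variables (ar cv : nat -> nat) (T : tree) (nsym : nat).
Hypothesis wfT : wf ar [::] T.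
Implicit Types (E : seq nat -> K) (st : state K).

Notation stored := (stored rep cv 0 [::] T).
Notation cont := (cont T cv).

(** Moves are emitted from the last position backwards, so a repeated variable ends up with the
    argument at its first occurrence, as [fits] assumes. *)
Fixpoint assign xs i (p : seq (instr K)) : seq (instr K) :=
  if xs is x :: xs' then assign xs' i.+1 (IMove K (rvar x) (rarg i) :: p) else p.

(** Register 8 accumulates the violations. *)
Fixpoint eqs xs i (p : seq (instr K)) : seq (instr K) :=
  if xs is x :: xs' then
    [:: ISub K 4 (rvar x) (rarg i), ISub K 5 (rarg i) (rvar x), IAdd K 4 4 5,
        IAdd K 8 8 4 & eqs xs' i.+1 p]
  else p.

(** Constants are stored minus one, which explains the additional subtraction of 1. *)
Fixpoint bounds (bs : seq (nat * nat)) (p : seq (instr K)) : seq (instr K) :=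
  if bs is (i, c) :: bs' then
    [:: ISub K 4 (rarg i) (rcst c), IConst K 5 1, ISub K 4 4 5,
        IAdd K 8 8 4 & bounds bs' p]
  else p.

Definition proc isn j xs bs : cmd K :=
  Seq (block (IConst K 8 0 :: assign xs 0 (eqs xs 0 (bounds bs [::]))))
    (If 8 (Skip K) (upc ins del isn 0 [::] T j)).

Definition same st st' := [/\ heap st' = heap st, vreg st' = vreg st,
  itape st' = itape st & vtape st' = vtape st].

Definition mild st st' := [/\ forall i, ireg st' (rarg i) = ireg st (rarg i),
  forall i, ireg st' (rcst i) = ireg st (rcst i) &
  forall i, ireg st' (rcnt i) = ireg st (rcnt i)].

Lemma mild_trans st1 st2 st3 : mild st1 st2 -> mild st2 st3 -> mild st1 st3.
Proof. by move=> [a b c] [a' b' c']; split=> i; rewrite ?a' ?b' ?c'. Qed.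

Lemma same_trans st1 st2 st3 : same st1 st2 -> same st2 st3 -> same st1 st3.
Proof. by move=> [a b c d] [a' b' c' d']; split; congruence. Qed.

Lemma keep_mild st st' : keep st st' -> mild st st'.
Proof. by case=> H _ _ _; split=> i; rewrite ?rargE ?rcstE ?rcntE H. Qed.

Lemma mild_lo st r n : r < 32 -> mild st (set_ireg st r n).
Proof.
by move=> lr; split=> i; rewrite /= upd_neq // ?rargE ?rcstE ?rcntE rodd_lo.
Qed.

Lemma mild_rvar st x n : mild st (set_ireg st (rvar x) n).
Proof.
by split=> i; rewrite /= upd_neq // /rarg /rcst /rcnt /rvar; lia.
Qed.

Lemma wp_assign xs i p st Q :
  (forall st', same st st' -> mild st st' -> ireg st' 8 = ireg st 8 ->
     (forall x, x \in xs -> env st' x = ireg st (rarg (i + index x xs))) ->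
     wp P D (block p) st' Q) ->
  wp P D (block (assign xs i p)) st Q.
Proof.
elim: xs i p st Q => [|x xs IH] i p st Q H /=; first exact: H.
apply: IH => st' s1 m1 e8 hx; apply: wp_cons => //; apply: H.
- by case: s1.
- by apply: mild_trans m1 _; apply: mild_rvar.
- by [].
move=> y; rewrite inE /env /= updE; have [-> _ _] := m1.
rewrite (_ : (rvar y == rvar x) = (x == y)); last by rewrite /rvar; lia.
rewrite [y == x]eq_sym; case: eqP => [_ _|n /= yx]; first by rewrite addn0.
by have := hx _ yx; rewrite /env addnS => ->.
Qed.

Definition args_are i w st := forall k, k < size w -> ireg st (rarg (i + k)) = nth 0 w k.

Lemma args_mild i w st st' : mild st st' -> args_are i w st -> args_are i w st'.
Proof. by move=> [a _ _] h k lt; rewrite a h. Qed.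

Lemma args_cons i v w st : args_are i (v :: w) st ->
  ireg st (rarg i) = v /\ args_are i.+1 w st.
Proof.
move=> h; split; first by have := h 0 isT; rewrite addn0.
by move=> k lt; rewrite addSnnS h.
Qed.

Lemma wp_eqs xs i p st w Q : size w = size xs -> args_are i w st ->
  (forall st', same st st' -> mild st st' -> env st' = env st ->
     (ireg st' 8 == 0) = (ireg st 8 == 0) && (map (env st) xs == w) ->
     wp P D (block p) st' Q) ->
  wp P D (block (eqs xs i p)) st Q.
Proof.
elim: xs i st w => [|x xs IH] i st [|v w] //=.
  by move=> _ _ H; apply: H => //; rewrite eqxx andbT.
case=> sz /args_cons[e a] H; do 4 apply: wp_cons => //.
set st1 := step P _ _; have m1 : mild st st1.
  by split=> k; rewrite /= ?updE ?rargE ?rcstE ?rcntE ?rodd_lo.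
have ee : env st1 = env st.
  by apply: funext => y; rewrite /env /= ?updE ?rvar_lo.
apply: (IH i.+1 st1 w sz (args_mild m1 a)) => st' s' m' e' r8.
apply: H; [by apply: same_trans s' | exact: mild_trans m1 m' | by rewrite e' |].
rewrite r8 ee eqseq_cons andbA; congr (_ && _).
rewrite /= !updE /= ?rargE -?rargE e /env; lia.
Qed.

Lemma wp_bounds bs p st w Q : args_are 0 w st -> consts cv st ->
  all (fun p => p.1 < size w) bs ->
  (forall st', same st st' -> mild st st' -> env st' = env st ->
     (ireg st' 8 == 0) = (ireg st 8 == 0) && all (fun p => nth 0 w p.1 <= cv p.2) bs ->
     wp P D (block p) st' Q) ->
  wp P D (block (bounds bs p)) st Q.
Proof.
elim: bs st => [|[i c] bs IH] st /=.
  by move=> _ _ _ H; apply: H => //; rewrite andbT.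
move=> a hc /andP[lt sz] H; do 4 apply: wp_cons => //.
set st1 := step P _ _; have m1 : mild st st1.
  by split=> k; rewrite /= ?updE ?rargE ?rcstE ?rcntE ?rodd_lo.
have ee : env st1 = env st.
  by apply: funext => y; rewrite /env /= ?updE ?rvar_lo.
have hc1 : consts cv st1 by case: m1 => _ e _ k; rewrite e.
apply: (IH st1 (args_mild m1 a) hc1 sz) => st' s' m' e' r8.
apply: H; [by apply: same_trans s' | exact: mild_trans m1 m' | by rewrite e' |].
rewrite r8 andbA; congr (_ && _).
have := a _ lt; rewrite add0n => <-.
rewrite /= !updE /= -hc; lia.
Qed.

Lemma wp_check xs bs st w Q : size w = size xs -> args_are 0 w st -> consts cv st ->
  all (fun p => p.1 < size xs) bs ->
  (forall st', same st st' -> mild st st' ->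
     (ireg st' 8 == 0) = fits cv xs bs w -> (fits cv xs bs w -> map (env st') xs = w) ->
     Q st') ->
  wp P D (block (IConst K 8 0 :: assign xs 0 (eqs xs 0 (bounds bs [::])))) st Q.
Proof.
move=> sz a hc sb H; apply: wp_cons => //.
have m0 : mild st (set_ireg st 8 0) by apply: mild_lo.
apply: wp_assign => st1 s1 m1 e1 hx.
have m01 := mild_trans m0 m1; have [_ ce _] := m01.
apply: (wp_eqs sz (args_mild m01 a)) => st2 s2 m2 e2 r2.
have hc2 : consts cv st2 by case: (m2) => _ e _ k; rewrite e ce.
have m02 := mild_trans m01 m2; rewrite -sz in sb.
apply: (wp_bounds (args_mild m02 a) hc2 sb) => st3 s3 m3 e3 r3.
have em : map (env st1) xs = [seq nth 0 w (index x xs) | x <- xs].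
  apply/eq_in_map => x xxs; rewrite hx // add0n /= upd_neq; last by rewrite rargE rodd_lo.
  by have := a (index x xs); rewrite add0n => ->; rewrite // sz index_mem.
have r : (ireg st3 8 == 0) = fits cv xs bs w.
  by rewrite r3 r2 e1 /= ?updE /= em.
apply: wp_nil; apply: H.
- by apply: (same_trans (st2 := set_ireg st 8 0)) => //; apply: same_trans s1 (same_trans s2 s3).
- exact: mild_trans m02 m3.
- exact: r.
- by case/andP=> /eqP e _; rewrite e3 e2 em.
Qed.

(** Leaves below which the update of the fact [e0] has not been carried out
    yet are those listed in [js]. *)
Definition mix isn E e0 k (js : seq nat) i w : K :=
  if i \in js then cont E i w else cont (upd_fact isn E e0 k) i w.

Definition through st st' := [/\ mild st st', vreg st' 33 = vreg st 33,
  itape st' = itape st & vtape st' = vtape st].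

Lemma through_trans st1 st2 st3 :
  through st1 st2 -> through st2 st3 -> through st1 st3.
Proof.
move=> [a b c d] [a' b' c' d']; split; [exact: mild_trans a'| | |]; congruence.
Qed.

Lemma mild_consts st st' : mild st st' -> consts cv st -> consts cv st'.
Proof. by case=> _ e _ hc c; rewrite e. Qed.

Lemma leaf_wf b s t j q xs bs : wf ar s t -> leaf_at b t j = Some (q, xs, bs) ->
  size xs = ar q /\ all (fun p => p.1 < size xs) bs.
Proof.
elim: t b s => [q' xs' bs'|c cs|x c cs|t1 IH1 t2 IH2|fr x t IH] b s //=.
- by case=> _ sz al; case: eqP => // _ [<- <- <-].
- by case=> w1 w2; case: ifP => _; [exact: IH1 w1|exact: IH2 w2].
- by case=> _ w _; exact: IH w.
Qed.

Lemma stored_eq C C' h : (forall i w, C' i w = C i w) -> stored C h -> stored C' h.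
Proof. by move=> e; apply: stored_ext => i w _. Qed.

Lemma proc_ok isn E q w0 k j js xs bs st : j \notin js -> size w0 = ar q ->
  args_are 0 w0 st -> consts cv st -> vreg st 33 = k ->
  leaf_at 0 T j = Some (q, xs, bs) ->
  stored (mix isn E (q :: w0) k (j :: js)) (heap st) ->
  wp P D (proc isn j xs bs) st (fun st' => through st st' /\
    stored (mix isn E (q :: w0) k js) (heap st')).
Proof.
move=> nj sz a hc ek lf hs; have [sx sb] := leaf_wf wfT lf.
apply: wp_seq; apply: (wp_check (w := w0)) => //; first by rewrite sz sx.
move=> st1 [h1 v1 t1 t1'] m1 r8 hm.
have thr : through st st1 by split=> //; rewrite v1.
apply: wp_if => c8.
  have nf : fits cv xs bs w0 = false by rewrite -r8; apply: negbTE.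
  apply: wp_skip; split=> //; rewrite h1; apply: stored_eq hs => i w.
  rewrite /mix inE; case: (eqVneq i j) => [->|//]; rewrite (negbTE nj) /= /cont lf.
  case: ifP => // f; rewrite /upd_fact eqseq_cons eqxx /=.
  by case: eqP => // e; rewrite -e f in nf.
have f : fits cv xs bs w0 by rewrite -r8 c8.
have e1 := esym (hm f).
apply: wp_mono (upc_ok insP delP
  (cv := cv) (C := mix isn E (q :: w0) k (j :: js)) (w0 := w0) wfT lf _ _ e1 erefl).
- move=> st2 [k2 _ i2]; split.
    apply: (through_trans thr); split; [exact: keep_mild | by case: k2..].
  apply: stored_eq i2 => i w; rewrite /mix /updC !inE.
  case: (eqVneq i j) => [->|//]; rewrite (negbTE nj) eqxx /= /cont lf.
  rewrite /upd_fact eqseq_cons eqxx /= f v1 ek.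
  by case: (eqVneq w w0) => [->|_]; rewrite ?f.
- by rewrite h1.
- exact: mild_consts m1 hc.
Qed.

Definition procs isn q js : cmd K := foldr (fun j c => Seq
  (if leaf_at 0 T j is Some (q', xs, bs) then
     if q' == q then proc isn j xs bs else Skip K
   else Skip K) c) (Skip K) js.

(** In a self-join one fact concerns several atoms. They are treated one after the other, and [mix]
    describes the intermediate databases in which some atoms are updated and others are not. *)
Lemma procs_ok isn E q w0 k js st : uniq js -> size w0 = ar q ->
  args_are 0 w0 st -> consts cv st -> vreg st 33 = k ->
  stored (mix isn E (q :: w0) k js) (heap st) ->
  wp P D (procs isn q js) st (fun st' => through st st' /\
    stored (mix isn E (q :: w0) k [::]) (heap st')).
Proof.
elim: js st => [|j js IH] st /=; first by move=> *; apply: wp_skip.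
case/andP=> nj uj sz a hc ek hs.
have skip : (forall w, cont E j w = cont (upd_fact isn E (q :: w0) k) j w) ->
    stored (mix isn E (q :: w0) k js) (heap st).
  move=> e; apply: stored_eq hs => i w; rewrite /mix inE.
  by case: (eqVneq i j) => [->|//]; rewrite (negbTE nj) /= e.
apply: (@wp_bind _ _ _ _ _ _ (fun st' => through st st' /\
  stored (mix isn E (q :: w0) k js) (heap st'))).
  case lf: (leaf_at 0 T j) => [[[q' xs] bs]|]; last first.
    by apply: wp_skip; split=> //; apply: skip => w; rewrite /cont lf.
  case: eqP => [e|n]; last first.
    apply: wp_skip; split=> //; apply: skip => w; rewrite /cont lf /upd_fact eqseq_cons.
    by rewrite (negbTE (introN eqP n)).
  by rewrite e in lf; exact: proc_ok.
move=> st1 [t1 s1]; have [m1 v1 _ _] := t1.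
apply: wp_mono (IH st1 uj sz (args_mild m1 a) (mild_consts m1 hc) _ s1); last by rewrite v1.
by move=> st2 [t2 s2]; split=> //; apply: through_trans t2.
Qed.

Fixpoint rdargs n i (p : seq (instr K)) : seq (instr K) :=
  if n is n'.+1 then IRead K (rarg i) :: rdargs n' i.+1 p else p.

(** A chain of tests on the symbol number, a sum of two truncated subtractions being the distance to
    it. Inside a branch the symbol is known, hence also its arity and the atoms concerned. *)
Definition rdfact isn : cmd K := Seq (block [:: IRead K 10])
  (foldr (fun q c => Seq (block [:: IConst K 4 q; ISub K 5 10 4; ISub K 6 4 10; IAdd K 5 5 6])
     (If 5 c (Seq (block (rdargs (ar q) 0 (if isn then [:: VRead K 33] else [::])))
                  (procs isn q (iota 0 (areas T))))))
     (Skip K) (iota 0 nsym)).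

Definition kept st st' := (forall i, ireg st' (rcst i) = ireg st (rcst i)) /\
  (forall i, ireg st' (rcnt i) = ireg st (rcnt i)).

Lemma kept_trans st1 st2 st3 : kept st1 st2 -> kept st2 st3 -> kept st1 st3.
Proof. by move=> [a b] [a' b']; split=> i; rewrite ?a' ?b' ?a ?b. Qed.

Lemma wp_rdargs w i p st rest Q : itape st = w ++ rest ->
  (forall st', heap st' = heap st -> vtape st' = vtape st -> kept st st' ->
     itape st' = rest -> args_are i w st' ->
     (forall j, j < i -> ireg st' (rarg j) = ireg st (rarg j)) ->
     wp P D (block p) st' Q) ->
  wp P D (block (rdargs (size w) i p)) st Q.
Proof.
elim: w i st => [|v w IH] i st e H /=; first by apply: H.
apply: wp_cons => //; set st1 := step P _ _.
apply: (IH i.+1 st1) => [|st2 h2 v2 [k2 k2'] e2 a2 o2]; first by rewrite /= e.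
apply: H => //.
- split=> j; rewrite ?k2 ?k2' /= upd_neq // /rcst /rcnt /rarg; lia.
- case=> [|j] lj; last by rewrite -addSnnS a2.
  by rewrite addn0 o2 // /= updE eqxx e.
- move=> j lj; rewrite o2 ?(ltnW lj) //; last by rewrite ltnS ltnW.
  by rewrite /= upd_neq // /rarg; lia.
Qed.

Lemma rdfact_ok isn E q w0 k st it vt : q < nsym -> size w0 = ar q ->
  itape st = q :: w0 ++ it -> vtape st = (if isn then k :: vt else vt) ->
  consts cv st -> stored (cont E) (heap st) ->
  wp P D (rdfact isn) st (fun st' =>
    [/\ kept st st', itape st' = it, vtape st' = vt &
        stored (cont (upd_fact isn E (q :: w0) k)) (heap st')]).
Proof.
move=> lq sz ei ev hc hs; apply: wp_seq; apply: wp_cons => //; apply: wp_nil.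
set st1 := step P _ _.
have [e10 i1 v1 h1] : [/\ ireg st1 10 = q, itape st1 = w0 ++ it,
   vtape st1 = vtape st & heap st1 = heap st].
  by rewrite /= ei updE eqxx.
have k1 : kept st st1.
  by split=> j; rewrite /= upd_neq // /rcst /rcnt; lia.
have : q \in iota 0 nsym by rewrite mem_iota.
clearbody st1; elim: (iota 0 nsym) st1 e10 i1 v1 h1 k1 => //= q' qs IH st1 e10 i1 v1 h1 k1 hq.
apply: wp_seq; do 4 apply: wp_cons => //; apply: wp_nil.
set st2 := step P _ _.
have e5 : ireg st2 5 = (q - q') + (q' - q) by rewrite /= !updE /= e10.
have k2 : kept st st2.
  by apply: kept_trans k1 _; split=> j; rewrite /= ?updE.
have [e10' i2 v2 h2] : [/\ ireg st2 10 = q, itape st2 = w0 ++ it,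
   vtape st2 = vtape st & heap st2 = heap st].
  by rewrite /= ?updE.
clearbody st2; apply: wp_if; rewrite e5 => c5.
  apply: IH => //; move: hq; rewrite inE; case: eqP => // eq'; lia.
have eq' : q' = q by lia.
subst q'; rewrite -sz; apply: wp_seq; apply: (wp_rdargs (rest := it)) => //.
move=> st3 h3 v3 k3 i3 a3 _; have hc3 : consts cv st3.
  by move=> c; rewrite (proj1 k3) (proj1 k2) hc.
have hs3 st' : heap st' = heap st3 -> stored (mix isn E (q :: w0) k (iota 0 (areas T))) (heap st').
  move=> ->; rewrite h3 h2; apply: stored_ext hs => i w hi.
  by rewrite /mix mem_iota hi.
have fin st4 st5 : kept st3 st4 -> itape st4 = it -> vtape st4 = vt ->
    through st4 st5 /\ stored (mix isn E (q :: w0) k [::]) (heap st5) ->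
    [/\ kept st st5, itape st5 = it, vtape st5 = vt &
        stored (cont (upd_fact isn E (q :: w0) k)) (heap st5)].
  move=> k4 i4 v4 [[[_ mc mn] _ i5 v5] s5]; split.
  - apply: kept_trans k2 (kept_trans k3 (kept_trans k4 _)); by split.
  - by rewrite i5.
  - by rewrite v5.
  - by apply: stored_eq s5.
case: (isn) ev hs3 fin => ev hs3 fin.
  apply: wp_cons => //; apply: wp_nil; set st4 := step P _ _.
  apply: (wp_mono (Q := fun st5 => through st4 st5 /\
     stored (mix true E (q :: w0) k [::]) (heap st5))).
    by move=> st5; apply: fin => //; rewrite /= v3 v2 ev.
  by apply: procs_ok => //; rewrite ?iota_uniq //= ?v3 ?v2 ?ev // ?updE //; apply: hs3.
apply: wp_nil.
(* A deletion ignores the last argument of [upd_fact], so whatever register 33 contains may stand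
   for it. *)
apply: (wp_mono (Q := fun st5 => through st3 st5 /\
     stored (mix false E (q :: w0) (vreg st3 33) [::]) (heap st5))).
  move=> st5 [t5 s5]; apply: (fin st3) => //; first by rewrite v3 v2 ev.
by apply: procs_ok => //; rewrite ?iota_uniq //; apply: hs3.
Qed.

End TreeUpdate.

(** * The dynamic problem of a query plan *)

Section FlatDatabase.
Variables (K : comNzSemiRingType) (sg : vocabulary).
Implicit Types (db : database K sg) (f : fact sg).

(** The database as the tapes present it, on lists of numbers; lists that encode no fact get 0. *)
Definition flat db (e : seq nat) : K :=
  (\sum_(f <- finsupp (facts db) | enc_fact f == e) facts db f)%R.

(** Index 0 is the constant symbol 1 and the others follow. The default of [nth] gives all further
    indices the value 1, which is what registers never written stand for. *)
Definition flat_cst db c : nat :=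
  (nth 0 (0 :: [seq (val (cval db c')).-1 | c' <- enum (csym sg)]) c).+1.

Definition flat_ar q : nat := nth 0 [seq arity R | R <- enum (rsym sg)] q.

Lemma enc_fact_inj : injective (@enc_fact sg).
Proof.
move=> [R u] [R' u'] [/= e1]; have {e1} e1 := enum_rank_inj (ord_inj e1).
case: R' / e1 u' => u' /(inj_map val_inj) e2.
by congr Tagged; apply: val_inj.
Qed.

Lemma flat_fact db f : flat db (enc_fact f) = facts db f.
Proof.
rewrite /flat (eq_bigl (pred1 f)) => [|g]; last by rewrite (inj_eq enc_fact_inj).
case: (boolP (f \in finsupp (facts db))) => hf.
  by rewrite -big_filter filter_pred1_uniq ?fset_uniq // big_seq1.
rewrite big1_seq ?fsfun_dflt // => g /andP[/eqP-> gf].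
by rewrite gf in hf.
Qed.

Lemma flat_none db e : (forall f, enc_fact f <> e) -> flat db e = 0%R.
Proof. by move=> h; rewrite /flat big1 // => f /eqP /h. Qed.

Lemma flat_arP f : size (tagged f) = flat_ar (enum_rank (tag f)).
Proof.
rewrite size_tuple /flat_ar (nth_map (tag f)) ?nth_enum_rank //.
by rewrite -cardE.
Qed.

Lemma flat_case e : {f : fact sg | e = enc_fact f} + (forall f : fact sg, enc_fact f <> e).
Proof.
case: (pselect (exists f : fact sg, e = enc_fact f)) => [/cid|h]; first by left.
by right=> f ef; apply: h; exists f.
Qed.

Lemma flat_insert db f k : flat (db_apply db (Insert f k)) =
  upd_fact true (flat db) (enc_fact f) k.
Proof.
apply: funext => e; rewrite /upd_fact; case: (flat_case e) => [[g ->]|h].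
  rewrite !flat_fact (inj_eq enc_fact_inj) /= fsfun_withE.
  by [].
case: (e =P enc_fact f) => [ef|_]; first by case: (h f (esym ef)).
by rewrite !flat_none.
Qed.

Lemma flat_delete db f : flat (db_apply db (Delete K f)) =
  upd_fact false (flat db) (enc_fact f) 0%R.
Proof.
apply: funext => e; rewrite /upd_fact; case: (flat_case e) => [[g ->]|h].
  rewrite !flat_fact (inj_eq enc_fact_inj) /= fsfun_withE.
  by [].
case: (e =P enc_fact f) => [ef|_]; first by case: (h f (esym ef)).
by rewrite !flat_none.
Qed.

End FlatDatabase.

Section TreeProblem.
Variables (K : comNzSemiRingType) (P : prims K) (sg : vocabulary).
Variables (T : tree) (hd : seq nat).
Hypothesis semi_integralK : semi_integral K.

Definition tree_val (db : database K sg) (nu : nat -> nat) : K :=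
  oeval (flat_cst db) (cont T (flat_cst db) (flat db)) 0 T nu.

Definition DynEvalTree : dyn_problem K :=
  {| inst := database K sg;
     update := fun=> db_update K sg;
     apply_update := @db_apply K sg;
     inst_size := fun db => size (finsupp (facts db));
     enc_inst := @enc_db K sg;
     enc_update := fun _ x => enc_db_update x;
     answer := fun db d k =>
       exists nu : nat -> nat, [/\ d = map nu hd, k = tree_val db nu & k != 0%R] |}.

Definition tree_answer (db : database K sg) := @answer K DynEvalTree db.

Hypothesis wfT : wf (flat_ar sg) [::] T.

Variable D : nat.
Variable rep : memory K -> {mset K}%mset -> Prop.
Variables ins del : bool -> nat -> cmd K.
Hypothesis insP : ins_spec P rep D ins.
Hypothesis delP : del_spec P rep D del.

Lemma cinv_blank fr b k : cinv rep fr (blank_memory K) b k (fun=> 0%R).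
Proof.
split; first by rewrite agg0.
case: fr; first by split=> // v; rewrite eqxx.
exists [::], mset0; split=> //; first by move=> v; rewrite eqxx.
by rewrite enum_mset0.
Qed.

(** Blank memory satisfies the invariant of the empty database, so no initialisation pass over the
    areas precedes the insertions. *)
Lemma stored_blank cv b s t : wf (flat_ar sg) s t ->
  stored rep cv b s t (fun _ _ => 0%R) (blank_memory K).
Proof.
elim: t b s => [q xs bs|c cs|x c cs|t1 IH1 t2 IH2|fr x t IH] b s //=.
- by case=> w1 w2; split; [exact: IH1|exact: IH2].
- case=> _ w _; split; last exact: IH.
  move=> nu; congr cinv: (cinv_blank fr b (key s nu)); apply: funext => v.
  by rewrite (eval_zero _ _ _ _ w).
Qed.

Let ncst := #|csym sg|.
Let nsym := #|rsym sg|.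

Definition kept_inv cv E st :=
  stored rep cv 0 [::] T (cont T cv E) (heap st) /\ consts cv st.

Definition tree_inv (db : database K sg) st := kept_inv (flat_cst db) (flat db) st.

Let read isn := rdfact ins del (flat_ar sg) T nsym isn.

Lemma rank_lt (f : fact sg) : enum_rank (tag f) < nsym.
Proof. exact: ltn_ord. Qed.

Lemma read_ok cv isn E (f : fact sg) k st it vt : kept_inv cv E st ->
  itape st = enc_fact f ++ it -> vtape st = (if isn then k :: vt else vt) ->
  wp P D (read isn) st (fun st' => [/\ kept st st', itape st' = it, vtape st' = vt &
    kept_inv cv (upd_fact isn E (enc_fact f) k) st']).
Proof.
move=> [hs hc] ei ev.
apply: wp_mono (rdfact_ok insP delP wfT (w0 := [seq val n | n <- tagged f]) (q := enum_rank (tag f))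
   (rank_lt f) _ ei ev hc hs).
  move=> st' [k' i' v' s']; split=> //; split=> //.
  by move=> c; rewrite (proj1 k') hc.
by rewrite size_map flat_arP.
Qed.

Definition upd_cmd : cmd K :=
  Seq (block [:: IRead K 12]) (If 12 (read false) (read true)).

Lemma upd_cmd_ok db (x : db_update K sg) st : tree_inv db st ->
  wp P D upd_cmd (set_tapes st (enc_db_update x).1 (enc_db_update x).2)
    (tree_inv (db_apply db x)).
Proof.
have ce y : flat_cst (db_apply db y) = flat_cst db by case: y.
move=> [hs hc]; apply: wp_seq; apply: wp_cons => //; apply: wp_nil.
set st1 := step P _ _.
have [h1 c1] : heap st1 = heap st /\ consts (flat_cst db) st1.
  by split=> // c; rewrite -hc /= upd_neq // /rcst; lia.
have i1 : kept_inv (flat_cst db) (flat db) st1 by split=> //; rewrite h1.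
have e12 : ireg st1 12 = head 0 (enc_db_update x).1 by rewrite /= updE.
have [it1 vt1] : itape st1 = behead (enc_db_update x).1 /\
  vtape st1 = (enc_db_update x).2 by [].
clearbody st1; rewrite /tree_inv ce.
case: x e12 it1 vt1 => [f k|f] /= e12 it1 vt1; apply: wp_if; rewrite e12 // => _.
  rewrite (flat_insert db f k).
  apply: wp_mono (read_ok (isn := true) (f := f) (k := k) (it := [::]) (vt := [::]) i1 _ _) => //.
    by move=> st2 [].
  by rewrite it1 cats0.
rewrite (flat_delete db f).
apply: wp_mono (read_ok (isn := false) (f := f) (k := 0%R) (it := [::]) (vt := [::]) i1 _ _) => //.
  by move=> st2 [].
by rewrite it1 cats0.
Qed.

Fixpoint rdcst n i : seq (instr K) :=
  if n is n'.+1 then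
    [:: IRead K 4, IConst K 5 1, ISub K (rcst i) 4 5 & rdcst n' i.+1]
  else [:: IRead K (rcnt 0)].

(** The facts on the tape are inserted one by one. The register [rcnt 0], elsewhere a counter of the
    enumeration, counts them. *)
Definition pre_cmd : cmd K := Seq (block (rdcst ncst 1))
  (While (rcnt 0) (Seq (read true)
     (block [:: IConst K 4 1; ISub K (rcnt 0) (rcnt 0) 4]))).

Lemma wp_rdcst cs i st n it (Q : state K -> Prop) : itape st = cs ++ n :: it ->
  (forall st', heap st' = heap st -> vtape st' = vtape st -> itape st' = it ->
     ireg st' (rcnt 0) = n ->
     (forall j, j < size cs -> ireg st' (rcst (i + j)) = (nth 0 cs j).-1) ->
     (forall j, (j < i) || (i + size cs <= j) -> ireg st' (rcst j) = ireg st (rcst j)) ->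
     Q st') ->
  wp P D (block (rdcst (size cs) i)) st Q.
Proof.
elim: cs i st => [|c cs IH] i st ei H /=.
  apply: wp_cons => //; apply: wp_nil; apply: H.
  - by [].
  - by [].
  - by rewrite /= ei.
  - by rewrite /= ei.
  - by [].
  - by move=> j _; rewrite /= upd_neq // /rcst /rcnt; lia.
do 3 apply: wp_cons => //; set st1 := step P _ _.
apply: (IH i.+1 st1) => [|st2 h2 v2 i2 r2 c2 o2]; first by rewrite /= ei.
apply: H; rewrite ?h2 ?v2 ?i2 ?r2 //.
- case=> [|j] lj; last by rewrite -addSnnS c2.
  rewrite addn0 o2 ?ltnSn // /= updE eqxx !updE /= ei /= subn1; lia.
- move=> j hj; rewrite o2; last by move: hj => /=; lia.
  rewrite /= upd_neq; last by rewrite /rcst; move: hj => /=; lia.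
  by rewrite !upd_neq // /rcst; lia.
Qed.

Definition add_facts (v : fact sg -> K) (l : seq (fact sg)) (E : seq nat -> K) e : K :=
  (E e + \sum_(f <- l | enc_fact f == e) v f)%R.

(** The number of rounds depends on the input, so [wp], which charges each loop a fixed time, does
    not apply and traces are composed directly. The 3 is the loop test and the decrement. *)
Lemma pre_loop cv (v : fact sg -> K) l E st : kept_inv cv E st -> ireg st (rcnt 0) = size l ->
  itape st = flatten [seq enc_fact f | f <- l] -> vtape st = map v l ->
  exists2 st', runs_within P (size l * (cost D (read true) + 3) + 1)
     (While (rcnt 0) (Seq (read true)
        (block [:: IConst K 4 1; ISub K (rcnt 0) (rcnt 0) 4]))) st st' &
     kept_inv cv (add_facts v l E) st'.
Proof.
elim: l E st => [|f l IH] E st i0 c0 it0 vt0.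
  exists st; first by exists [:: None]; split=> //; exact: exec_While_false.
  have -> // : add_facts v [::] E = E.
  by apply: funext => e; rewrite /add_facts big_nil addr0.
have w : wp P D (Seq (read true) (block [:: IConst K 4 1; ISub K (rcnt 0) (rcnt 0) 4])) st
   (fun st' => [/\ kept_inv cv (upd_fact true E (enc_fact f) (v f)) st',
      ireg st' (rcnt 0) = size l, itape st' = flatten [seq enc_fact f | f <- l] &
      vtape st' = map v l]).
  apply: wp_bind (read_ok (isn := true) (f := f) (k := v f)
    (it := flatten [seq enc_fact g | g <- l]) (vt := map v l) i0 it0 vt0) _ => st1 [k1 i1 v1 [s1 c1]].
  do 2 apply: wp_cons => //; apply: wp_nil; split.
  - split; first exact: s1.
    by move=> c; rewrite -c1 /= !upd_neq // /rcst /rcnt; lia.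
  - by rewrite /= updE eqxx !updE /= (proj2 k1) c0 /= subn1.
  - exact: i1.
  - exact: v1.
have [st1 [t1 [e1 l1 o1 [i1 c1 it1 vt1]]]] := w.
have [st2 [t2 [e2 l2 o2] i2]] := IH _ _ i1 c1 it1 vt1.
exists st2.
  exists (None :: t1 ++ t2); split=> /=.
  - by apply: exec_While_true e1 e2; rewrite c0.
  - rewrite size_cat mulSn; move: l1 l2 => /=; lia.
  - by rewrite outputs_cat o1 o2.
have -> // : add_facts v (f :: l) E = add_facts v l (upd_fact true E (enc_fact f) (v f)).
apply: funext => e; rewrite /add_facts big_cons /upd_fact eq_sym.
by case: eqP => [->|//]; rewrite addrA.
Qed.

Lemma pre_cmd_ok (db : database K sg) w : enc_db db w ->
  exists2 st, runs_within P (cost D (block (rdcst ncst 1)) +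
     (size (finsupp (facts db)) * (cost D (read true) + 3) + 1)) pre_cmd
     (set_tapes (blank_state K) w.1 w.2) st & tree_inv db st.
Proof.
case=> l pl ->; set st0 := set_tapes _ _ _.
pose cs := [seq val (cval db c) | c <- enum (csym sg)].
have scs : size cs = ncst by rewrite size_map -cardE.
have wb : wp P D (block (rdcst ncst 1)) st0 (fun st =>
   [/\ kept_inv (flat_cst db) (fun=> 0%R) st, ireg st (rcnt 0) = size l,
     itape st = flatten [seq enc_fact f | f <- l] & vtape st = map (facts db) l]).
  rewrite -scs; apply: (wp_rdcst (cs := cs) (i := 1)); first by [].
  move=> st h1 v1 i1 c1 r1 o1; split=> //; split.
    rewrite h1; apply: (stored_ext _ (stored_blank _ 0 wfT)) => i w' _.
    by rewrite /cont; case: leaf_at => // -[[q xs] bs]; case: ifP.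
  move=> c; rewrite /flat_cst; congr _.+1; case: c => [|c] /=; first by rewrite o1.
  case: (ltnP c (size cs)) => hc.
    rewrite -[c.+1]add1n r1 //.
    have hc' : c < size (enum (csym sg)) by rewrite scs /ncst cardE in hc.
    case: (enum (csym sg)) @cs {scs r1 o1} hc hc' => // a e cs hc hc'.
    by rewrite /cs !(nth_map a).
  rewrite o1 ?add1n ?ltnS ?hc ?orbT // nth_default // size_map.
  by move: hc; rewrite /cs size_map.
have [st1 [t1 [e1 l1 o1 [i1 c1 it1 vt1]]]] := wb.
have [st2 [t2 [e2 l2 o2] i2]] := pre_loop i1 c1 it1 vt1.
exists st2.
  exists (t1 ++ t2); split; first exact: exec_Seq e1 e2.
    by rewrite size_cat -(perm_size pl) leq_add.
  by rewrite outputs_cat o1 o2.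
rewrite /tree_inv (_ : flat db = add_facts (facts db) l (fun=> 0%R)) //.
by apply: funext => e; rewrite /add_facts add0r /flat (perm_big _ pl).
Qed.

Let c_test : cmd K :=
  block (VConst 0 1%R :: rd false 0 [::] T [:: VConst 2 0%R; IEqV K 7 0 2]).
Let c_val : cmd K := block (VConst 0 1%R :: rd true 0 [::] T [::]).
Let c_body : cmd K := Seq c_val (Do (Output K (map rvar hd) 0)).

Definition enum_cmd : cmd K := Seq c_test (If 7 (Skip K) (en 0 [::] T c_body)).

Let sl := slack K D 0 [::] T.
(** The entry budget of the loop nest has to cover the root test with its branch, and also the way
    out of the loops after an output, hence the first [sl]. The second one pays for the way in, the
    rest for evaluating and emitting a tuple. *)
Definition delay := cost D c_test + 1 + sl + sl + cost D c_val + 1.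

Lemma body_ok db h : stored rep (flat_cst db) 0 [::] T (cont T (flat_cst db) (flat db)) h ->
  espec P (flat_cst db) h [::] delay (cost D c_test + 1 + sl + sl) 0 c_body
    (fun nu => tree_val db nu != 0%R) (fun nu => [:: (map nu hd, tree_val db nu)]).
Proof.
move=> hs st g eh hc nz gle; rewrite -[[:: _]]cat0s.
apply: (@erun_seq _ _ _ _ _ _ _ (fun st' => look st st' /\ vreg st' 0 = tree_val db (env st))).
  apply: (erun_wp (D := D)); last by rewrite /delay; lia.
  apply: wp_cons => //; set st1 := step P _ _.
  have l1 : look st st1 by apply: look_set_vreg.
  apply: (wp_rd (cv := flat_cst db) (C := cont T (flat_cst db) (flat db)) (rep := rep)).
  - by rewrite (proj2 l1) eh.
  - exact: keep_consts (proj1 l1) hc.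
  move=> st2 w l2 v2; rewrite (keep_env (proj1 l1)) => ew.
  apply: wp_nil; split; first exact: look_trans l2.
  by rewrite v2 /= updE eqxx mul1r; apply: ew.
move=> st1 g1 _ [l1 v1].
exists st1, [:: Some (map (ireg st1) (map rvar hd), vreg st1 0)]; split=> //.
- by have := exec_Do P (Output K (map rvar hd) 0) st1.
- rewrite /= v1 -map_comp; congr [:: (_, _)].
  by have := keep_env (proj1 l1) => e; rewrite -e.
- exact: efr_look.
Qed.

Lemma test_ok db st : tree_inv db st -> wp P D c_test st (fun st' => look st st' /\
  ireg st' 7 = (eval (flat_cst db) (cont T (flat_cst db) (flat db)) 0 T (env st) == 0%R)).
Proof.
move=> [hs hc]; apply: wp_cons => //; set st1 := step P _ _.
have l1 : look st st1 by apply: look_set_vreg.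
apply: (wp_rd (cv := flat_cst db) (C := cont T (flat_cst db) (flat db)) (rep := rep)).
- by rewrite (proj2 l1).
- exact: keep_consts (proj1 l1) hc.
move=> st2 w l2 v2; rewrite (keep_env (proj1 l1)) => ew.
do 2 apply: wp_cons => //; apply: wp_nil; split.
  by apply: look_trans l1 _;
    apply: look_trans l2 _; apply: look_trans (look_set_vreg _ _ _) (look_set_ireg _ _ _).
by rewrite /= !updE /= v2 /= updE eqxx mul1r ew.
Qed.

Hypothesis uniq_fv : uniq (fv T).
Hypothesis hd_fv : fv T =i hd.

Lemma enum_cmd_ok db st : tree_inv db st ->
  exists2 st', enumerates P (tree_answer db) delay enum_cmd (set_tapes st [::] [::]) st' &
    tree_inv db st'.
Proof.
set st0 := set_tapes _ _ _ => i0; have {}i0 : tree_inv db st0 by [].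
have [st1 [t1 [e1 s1 g1 o1 [l1 r7]]]] := erun_wp (d := delay) (g := 0) (test_ok i0)
  ltac:(rewrite /delay; lia).
have i1 : tree_inv db st1.
  by case: i0 => a b; split; [rewrite (proj2 l1) | exact: keep_consts (proj1 l1) b].
set C := cont T _ _ in r7; set cv := flat_cst db in C r7.
case: (eqVneq (eval cv C 0 T (env st0)) 0%R) r7 => [z|nz] r7.
  exists st1 => //; exists (t1 ++ [:: None]); split.
  - apply: exec_Seq e1 _; apply: exec_If_true; first by rewrite r7.
    exact: exec_Skip.
  - apply: safe_delay; rewrite safe_cat s1 /= andbT.
    by move: g1; rewrite /delay; lia.
  - by rewrite outputs_cat o1.
  - move=> x k; rewrite outputs_cat o1; split=> // -[nu [_ -> nv]].
    (* An output would make the value at the root nonzero. *)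
    have := eval_live semi_integralK nv; rewrite (eval_dep _ _ _ wfT (nu' := env st0)) //.
    by rewrite z eqxx.
have [hs hc] := i1.
have [S M U] := sols_ok semi_integralK wfT hs uniq_fv (fun _ _ => isT)
  (ltac:(by rewrite (keep_env (proj1 l1))) : eval cv C 0 T (env st1) != 0%R).
have en1 : espec P cv (heap st1) (fv T ++ [::]) delay (cost D c_test + 1 + sl) (0 + sl)
    (en 0 [::] T c_body)
    (pree cv C (heap st1) 0 [::] T (fun nu => tree_val db nu != 0%R))
    (oute cv (heap st1) 0 [::] T (fun nu => [:: (map nu hd, tree_val db nu)])).
  apply: (en_ok wfT hs) => //.
  - by rewrite cats0.
  - by move=> nu nu' H; have -> : nu = nu' by apply: funext => y; apply: H.
  - by move=> nu nu' H; have -> : nu = nu' by apply: funext => y; apply: H.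
  - exact: body_ok hs.
  - by rewrite -/sl; lia.
  - by rewrite /delay -/sl; lia.
have [||st2 [t2 [e2 s2 g2 o2 f2]]] := en1 st1 (gap 0 t1).+1 erefl hc _ _.
  split; first by rewrite (keep_env (proj1 l1)).
  by move=> w /S[].
  by move: g1 => /=; lia.
exists st2; last by split; [rewrite (proj1 f2) | exact: efr_consts f2 hc].
have o : outputs (t1 ++ None :: t2) = [seq (map (setv (env st1) (fv T) w) hd,
    tree_val db (setv (env st1) (fv T) w)) | w <- sols cv (heap st1) 0 [::] T (env st1)].
  by rewrite outputs_cat o1 /= o2 /oute flatten_map1.
exists (t1 ++ None :: t2); split.
- by apply: exec_Seq e1 _; apply: exec_If_false; [exact: r7 | exact: e2].
- apply: safe_delay; rewrite safe_cat s1 /= s2 andbT.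
  by move: g1; rewrite /delay; lia.
(* The head contains every free variable, so distinct solutions yield distinct tuples. *)
- rewrite o /unzip1 -map_comp map_inj_in_uniq // => w w' /S[z _] /S[z' _] /= /eq_in_map e.
  rewrite -(map_setv (env st1) uniq_fv z) -(map_setv (env st1) uniq_fv z').
  by apply/eq_in_map => y yf; apply: e; rewrite -hd_fv.
- move=> x k; rewrite o; split.
    case/mapP=> w /S[z nz'] [-> ->].
    by exists (setv (env st1) (fv T) w).
  case=> nu [-> -> nv]; apply/mapP; exists (map nu (fv T)); first exact: M.
  have ag : {in fv T, setv (env st1) (fv T) (map nu (fv T)) =1 nu}.
    by move=> y yf; apply: setv_map.
  congr (_, _).
    by apply/eq_in_map => y; rewrite -hd_fv => /ag.
  by apply/esym; apply: (oeval_dep _ _ _ wfT) => y /ag.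
Qed.

End TreeProblem.

Theorem tree_solvable (K : comNzSemiRingType) (P : prims K) (sg : vocabulary)
    (T : tree) (hd : seq nat) :
  semi_integral K -> sum_maintainable P -> wf (flat_ar sg) [::] T -> uniq (fv T) ->
  fv T =i hd -> dyn_solvable P (DynEvalTree K sg T hd).
Proof.
move=> siK [rep [cnew [csum [cins [cdel [d0 [newP sumP insP delP]]]]]]] wfT uf hf.
(* Relocated sum programs take at most four times the [d0] steps of the given ones. *)
pose D := 4 * d0; have le : 4 * d0 <= D by [].
have insP' := bins_ok le newP sumP insP.
have delP' := bdel_ok le sumP delP.
pose c0 := cost D (block (rdcst K #|csym sg| 1)).
pose c1 := cost D (rdfact (bins cnew csum cins) (bdel csum cdel) (flat_ar sg) T #|rsym sg| true).
pose c2 := cost D (upd_cmd sg T (bins cnew csum cins) (bdel csum cdel)).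
exists (tree_inv T rep), (pre_cmd sg T (bins cnew csum cins) (bdel csum cdel)),
  (upd_cmd sg T (bins cnew csum cins) (bdel csum cdel)), (enum_cmd K T hd),
  (c0 + c1 + c2 + delay K T D + 4); split.
- move=> db w ew; have [st [t [e l o]] i] := pre_cmd_ok wfT insP' delP' ew.
  exists st => //; exists t; split=> //; apply: leq_trans l _.
  rewrite mulnS addnA addnAC leq_add //; first by rewrite -/c0; lia.
  by rewrite mulnC leq_mul2r; apply/orP; right; rewrite -/c1; lia.
- move=> db x st i; have w := upd_cmd_ok wfT insP' delP' x i.
  by apply: (wp_runs w); rewrite -/c2; lia.
- move=> db st i.
  have [st' [t [e d u a]] i'] := enum_cmd_ok P siK wfT D uf hf i.
  exists st' => //; exists t; split=> // t1 n t2 et; apply: leq_trans (d _ _ _ et) _; lia.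
Qed.

(** * Variable elimination *)

(** The same programs solve both problems: instances and updates have the same tapes, so a machine
    cannot tell them apart. *)
Lemma dyn_reduce (K : comNzSemiRingType) (P : prims K) (D1 D2 : dyn_problem K)
    (f : inst D1 -> inst D2) (g : forall I : inst D1, update I -> update (f I)) :
  (forall I, inst_size (f I) <= inst_size I) ->
  (forall I w, enc_inst I w -> enc_inst (f I) w) ->
  (forall I (x : update I), enc_update (g I x) = enc_update x) ->
  (forall I (x : update I), f (apply_update x) = apply_update (g I x)) ->
  (forall I d k, answer (f I) d k <-> answer I d k) ->
  dyn_solvable P D2 -> dyn_solvable P D1.
Proof.
move=> hsz henc hupd happ hans [i [c1 [c2 [c3 [d [h1 h2 h3]]]]]].
exists (fun I => i (f I)), c1, c2, c3, d; split.
- move=> I w /henc/h1[s [t [e l o]] iS]; exists s => //; exists t; split=> //.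
  by apply: leq_trans l _; rewrite leq_mul2l ltnS hsz orbT.
- by move=> I x s /(h2 _ (g I x))[s' r iS]; exists s'; rewrite -?hupd // happ.
- move=> I s /h3[s' [t [e dl u a]] iS]; exists s' => //; exists t; split=> //.
  by move=> x k; rewrite a.
Qed.

(** * Values of plans over the facts, and iterated sums over a finite domain *)

Section TreeSemantics.
Variables (K : comNzSemiRingType) (ar : nat -> nat).
Variables (E : seq nat -> K) (cv : nat -> nat).
Implicit Types (t : tree) (nu : nat -> nat).

Definition lval q xs (bs : seq (nat * nat)) nu : K :=
  if all (fun p => nth 0 (map nu xs) p.1 <= cv p.2) bs then E (q :: map nu xs)
  else 0%R.

Fixpoint osem t nu : K :=
  match t with
  | Leaf q xs bs => lval q xs bs nu
  | Cst c cs => ((mincst cv c cs)%:R)%R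
  | Rng x c cs => if 0 < nu x <= mincst cv c cs then 1%R else 0%R
  | Mul t1 t2 => (osem t1 nu * osem t2 nu)%R
  | Bind fr x t => if fr then osem t nu else agg false (fun v => osem t (upd nu x v))
  end.

Lemma eval_closed (C : nat -> seq nat -> K) b t nu : fv t = [::] -> eval cv C b t nu = oeval cv C b t nu.
Proof.
elim: t b nu => [q xs bs|c cs|x c cs|t1 IH1 t2 IH2|fr x t IH] b nu //=; last by case: fr.
move=> e; have [e1 e2] : fv t1 = [::] /\ fv t2 = [::] by case: (fv t1) e; case: (fv t2).
by rewrite IH1 ?IH2.
Qed.

(** A tuple read off a valuation respects repeated variables by itself, so of [fits] only the
    comparisons remain. Below a quantified binder nothing is free, where [eval] and [oeval]
    agree. *)
Lemma oeval_osem T b s t nu : wf ar s t ->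
  (forall j l, leaf_at b t j = Some l -> leaf_at 0 T j = Some l) ->
  oeval cv (cont T cv E) b t nu = osem t nu.
Proof.
elim: t b s nu => [q xs bs|c cs|x c cs|t1 IH1 t2 IH2|fr x t IH] b s nu //=.
- move=> _ /(_ b (q, xs, bs)); rewrite eqxx => /(_ erefl) lf; rewrite /cont lf.
  rewrite /fits (_ : _ == _) //; apply/eqP/eq_in_map => x xxs.
  by rewrite (nth_map 0) ?index_mem // nth_index.
- case=> w1 w2 H; rewrite (IH1 _ _ _ w1) ?(IH2 _ _ _ w2) // => j l lf; apply: H.
    by have := leaf_at_bound lf; case: ifP => //; lia.
  by have := leaf_at_bound lf; case: ifP => //; lia.
- case: fr => [] [_ w ft] H; first exact: IH w H.
  congr agg; apply: funext => v; rewrite eval_closed; last exact/eqP.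
  exact: IH w H.
Qed.

Lemma osem_dep s t nu nu' : wf ar s t -> {in s ++ fv t, nu =1 nu'} ->
  osem t nu = osem t nu'.
Proof.
move=> w H; rewrite -(oeval_osem (T := t) (b := 0) nu w) // -(oeval_osem (T := t) (b := 0) nu' w) //.
exact: oeval_dep w H.
Qed.

Variable V : seq nat.
Hypothesis uniqV : uniq V.
Hypothesis suppE : forall q w, E (q :: w) != 0%R -> {subset w <= V}.

Lemma lval_supp q xs bs nu : lval q xs bs nu != 0%R -> forall x, x \in xs -> nu x \in V.
Proof.
rewrite /lval; case: ifP => [_ /suppE h x xs'|_]; last by rewrite eqxx.
by apply: h; apply: map_f.
Qed.

(** Think of [V] as an active domain. An atom below contains every variable bound above, so these
    take values in [V]; this makes the sum at a quantified binder finite. *)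
Lemma osem_supp s t nu : wf ar s t -> osem t nu != 0%R -> forall x, x \in s -> nu x \in V.
Proof.
elim: t s nu => [q xs bs|c cs|x c cs|t1 IH1 t2 IH2|fr x t IH] s nu.
- by case=> e _ _ /= /lval_supp h x; rewrite -e => /h.
- by move=> /= ->.
- by move=> /= ->.
- by case=> w1 _ /= /mul_neq0[n _]; exact: IH1 w1 n.
- case=> xs w _ /=; case: fr => n y ys.
    by apply: (IH _ _ w n); rewrite inE ys orbT.
  case: (pselect (exists v, osem t (upd nu x v) != 0%R)) => [[v nv]|h].
    have := IH _ _ w nv y; rewrite inE ys orbT => /(_ isT).
    by rewrite upd_neq //; apply: contraNneq xs => <-.
  have z : (fun v => osem t (upd nu x v)) = (fun=> 0%R).
    by apply: funext => v; apply/eqP; apply: contra_notT h => nv; exists v.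
  by have := agg0 K false; rewrite -z /agg => e0; rewrite e0 eqxx in n.
Qed.

Lemma osem_bind s x t nu : wf ar (x :: s) t ->
  agg false (fun v => osem t (upd nu x v)) = (\sum_(v <- V) osem t (upd nu x v))%R.
Proof.
move=> w; apply: agg_sum => // v nv.
by have := osem_supp w nv (mem_head _ _); rewrite updxx.
Qed.

Fixpoint isum xs (G : (nat -> nat) -> K) nu : K :=
  if xs is x :: xs' then (\sum_(v <- V) isum xs' G (upd nu x v))%R else G nu.

Lemma isum_cat xs ys G nu : isum (xs ++ ys) G nu = isum xs (isum ys G) nu.
Proof. by elim: xs nu => //= x xs IH nu; apply: eq_bigr => v _. Qed.

Lemma eq_isum xs G G' nu : (forall nu, G nu = G' nu) -> isum xs G nu = isum xs G' nu.
Proof. by move=> e; have -> : G = G' by apply: funext. Qed.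

Lemma isum_mull xs (A B : (nat -> nat) -> K) nu :
  (forall nu x v, x \in xs -> A (upd nu x v) = A nu) ->
  isum xs (fun nu => A nu * B nu)%R nu = (A nu * isum xs B nu)%R.
Proof.
elim: xs nu => //= x xs IH nu h; rewrite mulr_sumr; apply: eq_bigr => v _.
rewrite IH ?h ?mem_head // => nu' y v' ys; apply: h.
by rewrite inE ys orbT.
Qed.

End TreeSemantics.

(** * Elimination of variables and its invariant *)

Definition leafdata := (nat * seq nat * seq (nat * nat))%type.
Definition mkleaf (l : leafdata) : tree := Leaf l.1.1 l.1.2 l.2.

HB.instance Definition _ := gen_eqMixin tree.

(** A plan with its scope, the variables that are still to be bound above it. *)
Definition factor := (seq nat * tree)%type.

Definition mulall (t : tree) (ts : seq tree) : tree := foldr Mul t ts.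

(** All factors with [x] in their scope go under one binder. They turn out to have equal scopes, so
    that of the first one is taken. *)
Definition elim_var (fr : bool) (x : nat) (fs : seq factor) : seq factor :=
  let B := [seq f <- fs | x \notin f.1] in
  if [seq f <- fs | x \in f.1] is f0 :: A then
    ([seq y <- f0.1 | y != x], Bind fr x (mulall f0.2 (map snd A))) :: B
  else B.

Definition elim_vars fr xs fs := foldl (fun fs x => elim_var fr x fs) fs xs.

Section Elimination.
Variables (ar : nat -> nat) (L : seq leafdata).
Hypothesis L_ok : forall l, l \in L ->
  size l.1.2 = ar l.1.1 /\ all (fun p => p.1 < size l.1.2) l.2.

Definition meet (l : leafdata) (X : seq nat) := [seq y <- l.1.2 | y \in X].

(** Scopes are the traces on [X] of the original atoms. That each atom has such a factor ensures
    that a variable still to be eliminated is found in some scope. *)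
Definition balanced X (fs : seq factor) := [/\
  forall f : factor, f \in fs -> exists2 l, l \in L & f.1 =i meet l X,
  forall l, l \in L -> exists2 f : factor, f \in fs & f.1 =i meet l X &
  forall f : factor, f \in fs -> wf ar f.1 f.2].

Definition fvs (fs : seq factor) := flatten [seq fv f.2 | f <- fs].

(** Whenever [x] is about to be eliminated, the atoms containing it agree on
    the variables that remain. *)
Fixpoint leafy xs : Prop :=
  if xs is x :: X then
    (forall l1 l2, l1 \in L -> l2 \in L -> x \in l1.1.2 -> x \in l2.1.2 ->
       forall y, y \in X -> y \in l1.1.2 -> y \in l2.1.2) /\ leafy X
  else True.

Lemma wf_eqi s s' t : s =i s' -> wf ar s t -> wf ar s' t.
Proof.
have nil (r r' : seq nat) : r =i r' -> r = [::] -> r' = [::].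
  by move=> e er; case: r' e => // x r' /(_ x); rewrite er in_nil mem_head.
elim: t s s' => [q xs bs|c cs|x c cs|t1 IH1 t2 IH2|fr x t IH] s s' e /=.
- by case=> h sz al; split=> // y; rewrite h e.
- exact: nil.
- exact: nil.
- by case=> w1 w2; split; [exact: IH1 w1|exact: IH2 w2].
- case=> xs w f; split=> //; first by rewrite -e.
  by apply: IH w => y; rewrite !inE e.
Qed.

Lemma fvs_nil fs f : fvs fs = [::] -> f \in fs -> fv f.2 = [::].
Proof.
elim: fs => // g fs IH; rewrite /fvs /= inE; case e: (fv g.2) => //= /IH h.
by case/orP=> [/eqP->|].
Qed.

Lemma perm_fvs fs gs : perm_eq fs gs -> perm_eq (fvs fs) (fvs gs).
Proof. by move=> p; apply: perm_flatten; apply: perm_map. Qed.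

Lemma fv_mulall t ts : fv (mulall t ts) = flatten (map fv ts) ++ fv t.
Proof. by elim: ts => //= t' ts ->; rewrite catA. Qed.

Lemma osem_mulall (K : comNzSemiRingType) (E : seq nat -> K) cv t ts nu :
  osem E cv (mulall t ts) nu = (\prod_(t' <- t :: ts) osem E cv t' nu)%R.
Proof.
elim: ts => [|t' ts IH] /=; first by rewrite big_seq1.
by rewrite IH !big_cons mulrCA.
Qed.

Definition pval (K : comNzSemiRingType) (E : seq nat -> K) cv (fs : seq factor) nu : K :=
  (\prod_(f <- fs) osem E cv f.2 nu)%R.

Section Step.
Variables (fr : bool) (x : nat) (X : seq nat) (fs : seq factor).
Hypothesis xX : x \notin X.
Hypothesis bal : balanced (x :: X) fs.
Hypothesis occ : exists2 l, l \in L & x \in l.1.2.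
Hypothesis lf : forall l1 l2, l1 \in L -> l2 \in L -> x \in l1.1.2 -> x \in l2.1.2 ->
       forall y, y \in X -> y \in l1.1.2 -> y \in l2.1.2.
Hypothesis fr_fv : fr || (fvs fs == [::]).

Let A := [seq f <- fs | x \in f.1].
Let B := [seq f <- fs | x \notin f.1].

Lemma perm_AB : perm_eq fs (A ++ B).
Proof. by rewrite perm_sym; apply: permEl (perm_filterC _ _). Qed.

Lemma A_cons : exists f0 A', A = f0 :: A'.
Proof.
case: occ => l hl xl; have [_ b2 _] := bal; have [f hf ef] := b2 l hl.
have: f \in A by rewrite mem_filter hf ef mem_filter xl inE eqxx.
by case: A => // f0 A' _; exists f0, A'.
Qed.

(** Both scopes are traces of atoms that contain [x], and [lf], applied in both directions, makes
    these traces equal. This is what well-formedness of the new binder requires. *)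
Lemma A_scope f g : f \in A -> g \in A -> f.1 =i g.1.
Proof.
rewrite !mem_filter => /andP[xf hf] /andP[xg hg]; have [b1 _ _] := bal.
have [l hl el] := b1 f hf; have [l' hl' el'] := b1 g hg.
rewrite el mem_filter in xf; rewrite el' mem_filter in xg.
case/andP: xf => _ xl; case/andP: xg => _ xl'.
move=> y; rewrite el el' !mem_filter inE; case: eqP => [->|_] /=; first by rewrite xl xl'.
by case: (boolP (y \in X)) => //= yX; apply/idP/idP; apply: lf yX.
Qed.

Lemma elim_var_eq : exists f0 A', A = f0 :: A' /\
  elim_var fr x fs = ([seq y <- f0.1 | y != x], Bind fr x (mulall f0.2 (map snd A'))) :: B.
Proof.
have [f0 [A' e]] := A_cons; exists f0, A'; split=> //.
by rewrite /elim_var -/A e.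
Qed.

Lemma elim_wf f0 A' : A = f0 :: A' ->
  wf ar (x :: [seq y <- f0.1 | y != x]) (mulall f0.2 (map snd A')).
Proof.
move=> e; have h f : f \in A -> wf ar (x :: [seq y <- f0.1 | y != x]) f.2.
  move=> fA; have [_ _ b3] := bal; have: f \in fs by move: fA; rewrite mem_filter => /andP[].
  move=> /b3; apply: wf_eqi => y; rewrite (A_scope fA (g := f0)); last by rewrite e mem_head.
  rewrite inE mem_filter; case: eqP => //= ->.
  have: f0 \in A by rewrite e mem_head.
  by rewrite mem_filter => /andP[].
have h0 : wf ar (x :: [seq y <- f0.1 | y != x]) f0.2 by apply: h; rewrite e mem_head.
have: {subset A' <= A} by move=> f fA; rewrite e inE fA orbT.
elim: {e} A' => //= f A' IH sub; split; first by apply: h; apply: sub; rewrite mem_head.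
by apply: IH => g gA; apply: sub; rewrite inE gA orbT.
Qed.

Lemma elim_balanced : balanced X (elim_var fr x fs).
Proof.
have [f0 [A' [e ->]]] := elim_var_eq; have [b1 b2 b3] := bal.
have f0A : f0 \in A by rewrite e mem_head.
have scope l (f : factor) : f.1 =i meet l (x :: X) -> x \in l.1.2 -> [seq y <- f.1 | y != x] =i meet l X.
  move=> el xl y; rewrite mem_filter el !mem_filter inE; case: eqP => [->|] //=.
  by rewrite (negbTE xX).
have scopeB l (f : factor) : f.1 =i meet l (x :: X) -> x \notin f.1 -> f.1 =i meet l X.
  move=> el nx y; rewrite el !mem_filter inE; case: eqP => [->|] //=.
  by move: nx; rewrite el mem_filter mem_head /= => /negbTE ->; rewrite andbF.
have xin l (f : factor) : f.1 =i meet l (x :: X) -> x \in f.1 -> x \in l.1.2.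
  by move=> -> ; rewrite mem_filter => /andP[].
split.
- move=> f; rewrite inE => /orP[/eqP->|].
    move: f0A; rewrite mem_filter => /andP[xf /b1[l hl el]]; exists l => //=.
    exact: scope (xin _ _ el xf).
  by rewrite mem_filter => /andP[nx /b1[l hl el]]; exists l => //; apply: scopeB.
- move=> l hl; have [f hf el] := b2 l hl.
  case: (boolP (x \in f.1)) => xf; last first.
    by exists f; [rewrite inE mem_filter xf hf orbT|exact: scopeB].
  have fA : f \in A by rewrite mem_filter xf hf.
  exists ([seq y <- f0.1 | y != x], Bind fr x (mulall f0.2 (map snd A'))); first exact: mem_head.
  move=> y /=; rewrite -(scope _ _ el (xin _ _ el xf)) !mem_filter.
  by rewrite (A_scope f0A fA).
- move=> f; rewrite inE => /orP[/eqP->|]; last by rewrite mem_filter => /andP[_ /b3].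
  split; [by rewrite mem_filter eqxx | exact: elim_wf | ].
  case/orP: fr_fv => [->//|/eqP f_nil]; rewrite fv_mulall.
  have hA f' : f' \in A -> fv f'.2 = [::].
    by rewrite mem_filter => /andP[_]; apply: fvs_nil.
  rewrite (hA f0 f0A) cats0 orbC; apply/orP; left.
  have: {subset A' <= A} by move=> g gA; rewrite e inE gA orbT.
  elim: {e} A' => //= g A' IH sub; rewrite hA ?sub ?mem_head //.
  by apply: IH => g' gA; apply: sub; rewrite inE gA orbT.
Qed.

Lemma elim_fvs : perm_eq (fvs (elim_var fr x fs)) ((if fr then [:: x] else [::]) ++ fvs fs).
Proof.
have [f0 [A' [e ->]]] := elim_var_eq.
have p : perm_eq (fvs fs) (fvs A ++ fvs B).
  by apply: (perm_trans (perm_fvs perm_AB)); rewrite /fvs map_cat flatten_cat.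
have pA : perm_eq (fv (mulall f0.2 (map snd A'))) (fvs A).
  by rewrite e /fvs /= fv_mulall -map_comp perm_catC.
rewrite /fvs /= -/(fvs B); apply: (@perm_trans _ (((if fr then [:: x] else [::]) ++
    fv (mulall f0.2 (map snd A'))) ++ fvs B)); first by case: (fr).
rewrite -catA perm_cat2l; apply: perm_trans (_ : perm_eq _ (fvs A ++ fvs B)) _.
  by rewrite perm_cat2r.
by rewrite perm_sym.
Qed.

Lemma pval_AB (K : comNzSemiRingType) (E : seq nat -> K) cv nu :
  pval E cv fs nu = (pval E cv A nu * pval E cv B nu)%R.
Proof. by rewrite /pval (perm_big _ perm_AB) big_cat. Qed.

Lemma pval_A (K : comNzSemiRingType) (E : seq nat -> K) cv nu f0 A' : A = f0 :: A' ->
  osem E cv (mulall f0.2 (map snd A')) nu = pval E cv A nu.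
Proof. by move=> ->; rewrite osem_mulall /pval !big_cons big_map. Qed.

Lemma elim_free (K : comNzSemiRingType) (E : seq nat -> K) cv nu : fr ->
  pval E cv (elim_var fr x fs) nu = pval E cv fs nu.
Proof.
move=> h; have [f0 [A' [e ->]]] := elim_var_eq.
by rewrite pval_AB {1}/pval big_cons /= h (pval_A _ _ _ e).
Qed.

(** Distributivity: the factors without [x] in their scope are pulled out of the sum over [x]. *)
Lemma elim_bound (K : comNzSemiRingType) (E : seq nat -> K) cv V nu : ~~ fr ->
  uniq V -> (forall q w, E (q :: w) != 0%R -> {subset w <= V}) ->
  pval E cv (elim_var fr x fs) nu = (\sum_(v <- V) pval E cv fs (upd nu x v))%R.
Proof.
move=> nfr uV sE; have [f0 [A' [e ->]]] := elim_var_eq.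
have f_nil : fvs fs = [::] by apply/eqP; move: fr_fv; rewrite (negbTE nfr).
have e1 : osem E cv (Bind fr x (mulall f0.2 (map snd A'))) nu =
    (\sum_(v <- V) osem E cv (mulall f0.2 (map snd A')) (upd nu x v))%R.
  by rewrite -(osem_bind cv uV sE _ (elim_wf e)); case: (fr) nfr.
rewrite {1}/pval big_cons [X in (X * _)%R]e1 mulr_suml;
  apply: eq_bigr => v _; rewrite pval_AB (pval_A _ _ _ e).
congr (_ * _)%R; rewrite /pval !big_seq; apply: eq_bigr => f.
rewrite mem_filter => /andP[nx hf]; have [_ _ b3] := bal.
apply: (osem_dep _ _ (b3 f hf)) => y; rewrite (fvs_nil f_nil hf) cats0 => yf.
by rewrite upd_neq //; apply: contraNneq nx => <-.
Qed.

End Step.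

(** The variable eliminated last is summed outermost, hence [rev]. *)
Lemma elim_vars_bound xs X fs : uniq (xs ++ X) -> balanced (xs ++ X) fs ->
  (forall x, x \in xs -> exists2 l, l \in L & x \in l.1.2) -> leafy (xs ++ X) ->
  fvs fs = [::] ->
  let fs' := elim_vars false xs fs in
  [/\ balanced X fs', fvs fs' = [::] &
    forall (K : comNzSemiRingType) (E : seq nat -> K) cv V nu, uniq V ->
      (forall q w, E (q :: w) != 0%R -> {subset w <= V}) ->
      pval E cv fs' nu = isum V (rev xs) (pval E cv fs) nu].
Proof.
elim: xs fs => [|x xs IH] fs //= /andP[nx u] b occ [lf ly] fn.
have ox : exists2 l, l \in L & x \in l.1.2 by apply: occ; rewrite mem_head.
have ff : false || (fvs fs == [::]) by rewrite fn.
have b1 := elim_balanced nx b ox lf ff.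
have fn1 : fvs (elim_var false x fs) = [::].
  by apply/perm_nilP; have := elim_fvs false b ox; rewrite fn.
have [|b2 fn2 val] := IH _ u b1 _ ly fn1.
  by move=> y ys; apply: occ; rewrite inE ys orbT.
split=> // K E cv V nu uV sE; rewrite (val _ _ _ V) // rev_cons -cats1 isum_cat.
apply: eq_isum => nu'; rewrite (elim_bound b ox lf ff cv nu' isT uV sE) /=.
by [].
Qed.

Lemma elim_vars_free xs X fs : uniq (xs ++ X) -> balanced (xs ++ X) fs ->
  (forall x, x \in xs -> exists2 l, l \in L & x \in l.1.2) -> leafy (xs ++ X) ->
  let fs' := elim_vars true xs fs in
  [/\ balanced X fs', perm_eq (fvs fs') (xs ++ fvs fs) &
    forall (K : comNzSemiRingType) (E : seq nat -> K) cv nu,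
      pval E cv fs' nu = pval E cv fs nu].
Proof.
elim: xs fs => [|x xs IH] fs //= /andP[nx u] b occ [lf ly].
have ox : exists2 l, l \in L & x \in l.1.2 by apply: occ; rewrite mem_head.
have b1 := elim_balanced (fr := true) nx b ox lf isT.
have [|b2 p val] := IH _ u b1 _ ly.
  by move=> y ys; apply: occ; rewrite inE ys orbT.
split=> // [|K E cv nu]; last by rewrite val (elim_free b ox).
apply: (perm_trans p); have := elim_fvs true b ox.
rewrite -(perm_cat2l xs) => p2; apply: (perm_trans p2).
by rewrite -cat1s perm_catCA.
Qed.

(** The elimination order lists quantified variables before free ones. *)
Lemma elim_all xs ys : uniq (xs ++ ys) -> leafy (xs ++ ys) ->
  (forall l, l \in L -> {subset l.1.2 <= xs ++ ys}) ->
  (forall x, x \in xs ++ ys -> exists2 l, l \in L & x \in l.1.2) ->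
  exists t, [/\ wf ar [::] t, perm_eq (fv t) ys &
    forall (K : comNzSemiRingType) (E : seq nat -> K) cv V nu, uniq V -> cv 0 = 1 ->
      (forall q w, E (q :: w) != 0%R -> {subset w <= V}) ->
      osem E cv t nu =
        isum V (rev xs) (fun nu => \prod_(l <- L) lval E cv l.1.1 l.1.2 l.2 nu)%R nu].
Proof.
move=> u ly sL occ; pose fs : seq factor := [seq (l.1.2, mkleaf l) | l <- L].
have b : balanced (xs ++ ys) fs.
  have e l : l \in L -> l.1.2 =i meet l (xs ++ ys).
    by move=> hl y; rewrite mem_filter; case: (boolP (y \in l.1.2)) => [/(sL l hl)->|]; rewrite ?andbF.
  split=> [f /mapP[l hl ->]|l hl|f /mapP[l hl ->]].
  - by exists l => //; apply: e.
  - by exists (l.1.2, mkleaf l); [apply: (map_f (fun l => _)) | apply: e].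
  - by have [sz al] := L_ok hl.
have fn : fvs fs = [::].
  by rewrite /fvs /fs -map_comp; elim: (L).
have [|b1 fn1 v1] := elim_vars_bound u b _ ly fn.
  by move=> x xx; apply: occ; rewrite mem_cat xx.
set fs1 := elim_vars false xs fs in b1 fn1 v1.
have [uy ly'] : uniq (ys ++ [::]) /\ leafy (ys ++ [::]).
  rewrite cats0; split; first by move: u; rewrite cat_uniq => /and3P[].
  by elim: (xs) ly => //= x s IH [_ /IH].
have [||b2 p2 v2] := elim_vars_free uy (fs := fs1) _ _ ly'; first by rewrite cats0.
  by move=> x xx; apply: occ; rewrite mem_cat xx orbT.
set fs2 := elim_vars true ys fs1 in b2 p2 v2.
(* [Cst 0 [::]] has value 1, as index 0 denotes the constant 1; it stands for the empty product. *)
exists (mulall (Cst 0 [::]) (map snd fs2)); split.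
- have [c1 c2 c3] := b2.
  have: {subset fs2 <= fs2} by [].
  elim: {-2}fs2 => [|f fs' IH] sub //=; split; last first.
    by apply: IH => g gf; apply: sub; rewrite inE gf orbT.
  have hf : f \in fs2 by apply: sub; rewrite mem_head.
  apply: wf_eqi (c3 f hf) => y; have [l _ ->] := c1 f hf.
  by rewrite mem_filter.
- by rewrite fv_mulall cats0 -map_comp; move: p2; rewrite fn1 cats0.
- move=> K E cv V nu uV cv0 sE; rewrite osem_mulall big_cons /= /mincst /= cv0 mul1r big_map.
  rewrite -[LHS]/(pval E cv fs2 nu) v2 (v1 _ _ _ V) //; apply: eq_isum => nu'.
  by rewrite /pval big_map.
Qed.

End Elimination.

(** * Conjunctive queries *)

Lemma leq_mincst cv c cs v : (v <= mincst cv c cs) = all (fun c => v <= cv c) (c :: cs).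
Proof.
rewrite /mincst /=; elim: cs (cv c) => [|c' cs IH] m /=; first by rewrite andbT.
by rewrite IH leq_min andbA.
Qed.

Lemma sum_iota1 (K : comNzSemiRingType) m (F : nat -> K) :
  (\sum_(v <- iota 1 m) F v = \sum_(i < m) F i.+1)%R.
Proof.
rewrite -[1]addn0 iotaDl big_map -[m in iota 0 m]subn0 -/(index_iota 0 m) big_mkord.
by apply: eq_bigr => i _; rewrite add1n.
Qed.

Lemma sum_indicator (K : comNzSemiRingType) N m : m <= N ->
  (\sum_(v <- iota 1 N) (if (0 < v <= m)%N then 1 else 0) = m%:R :> K)%R.
Proof.
move=> le; rewrite -(subnKC le) iotaD big_cat /= [X in (_ + X)%R]big1_seq ?addr0.
  rewrite (eq_big_seq (fun=> 1%R)) => [|v].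
    by rewrite big_const_seq count_predT size_iota iter_addr_0.
  by rewrite mem_iota add1n ltnS => ->.
by move=> v; rewrite mem_iota => /andP[_ h]; case: ifP => //; lia.
Qed.

Lemma tree_valE (K : comNzSemiRingType) (sg : vocabulary) (T : tree) (db : database K sg) ar nu :
  wf ar [::] T -> tree_val T db nu = osem (flat db) (flat_cst db) T nu.
Proof. by move=> w; apply: (oeval_osem _ _ _ w). Qed.

Lemma mem_filter_enum (T : finType) (p : pred T) x : (x \in [seq x <- enum T | p x]) = p x.
Proof. by rewrite mem_filter fintype.mem_enum andbT. Qed.

(** * Iterated sums as sums over valuations in a finite grid *)

Section Grid.
Variables (K : comNzSemiRingType) (n N : nat).
Let V := iota 1 N.

Definition grid_env (g : {ffun 'I_n -> 'I_N}) : nat -> nat :=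
  fun y => if insub y is Some x then (g x).+1 else 0.

Lemma grid_envE g (x : 'I_n) : grid_env g x = (g x).+1.
Proof. by rewrite /grid_env valK. Qed.

Definition agrees (xs : seq nat) (nu : nat -> nat) (g : {ffun 'I_n -> 'I_N}) :=
  [forall y : 'I_n, (val y \notin xs) ==> ((g y).+1 == nu y)].

(** Partition the valuations by their value at the first variable; fixing this value amounts to
    updating [nu]. Once all variables are fixed, exactly one grid point agrees with [nu], because
    [nu] stays inside the domain. *)
Lemma grid_sum xs (G : (nat -> nat) -> K) nu : uniq xs -> {subset xs <= gtn n} ->
  (forall nu nu', (forall y, y < n -> nu y = nu' y) -> G nu = G nu') ->
  (forall y, y < n -> y \notin xs -> nu y \in V) ->
  (\sum_(g : {ffun 'I_n -> 'I_N} | agrees xs nu g) G (grid_env g))%R = isum V xs G nu.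
Proof.
move=> + + dG; elim: xs nu => [|x xs IH] nu /=.
  move=> _ _ hV.
  have lt (y : 'I_n) : (nu y).-1 < N by have := hV y (ltn_ord y) isT; rewrite mem_iota; lia.
  pose g0 : {ffun 'I_n -> 'I_N} := [ffun y => Ordinal (lt y)].
  rewrite (big_pred1 g0) => [|g].
    apply: dG => y ly; rewrite (_ : y = Ordinal ly) // grid_envE ffunE /=.
    by have := hV y ly isT; rewrite mem_iota; lia.
  apply/forallP/eqP => [h|-> y]; last first.
    apply/implyP => _; rewrite ffunE /=; apply/eqP.
    by have := hV y (ltn_ord y) isT; rewrite mem_iota; lia.
  by apply/ffunP => y; apply: val_inj; rewrite ffunE /= -(eqP (implyP (h y) isT)).
case/andP=> nx u sx hV; have xn : x < n by apply: sx; rewrite mem_head.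
pose x' := Ordinal xn.
rewrite (partition_big (fun g : {ffun 'I_n -> 'I_N} => g x') predT) //=.
rewrite [RHS]sum_iota1.
apply: eq_bigr => i _; rewrite -IH //.
- apply: eq_bigl => g; apply/andP/forallP => [[/forallP h /eqP e] y|h].
    apply/implyP => ny; rewrite updE; case: (val y =P x) => [ey|/eqP ne].
      by rewrite -e (_ : y = x') //; apply: val_inj.
    by apply: (implyP (h y)); rewrite inE negb_or ne.
  have e : g x' = i.
    by apply: val_inj; have /implyP/(_ nx) := h x'; rewrite updxx => /eqP[].
  split; last by rewrite e.
  apply/forallP => y; apply/implyP; rewrite inE negb_or => /andP[ne ny].
  by have /implyP/(_ ny) := h y; rewrite upd_neq.
- by move=> y ys; apply: sx; rewrite inE ys orbT.
- move=> y ly ny; rewrite updE; case: eqP => [_|/eqP ne].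
    by rewrite mem_iota; have := ltn_ord i; lia.
  by apply: hV => //; rewrite inE negb_or ne.
Qed.

Lemma isum_neq0 (V' : seq nat) xs (G : (nat -> nat) -> K) nu : isum V' xs G nu != 0%R ->
  exists2 nu', (forall y, y \notin xs -> nu' y = nu y) & G nu' != 0%R.
Proof.
elim: xs nu => [|x xs IH] nu /=; first by exists nu.
move=> n0; have [v nv] : exists v, isum V' xs G (upd nu x v) != 0%R.
  apply: contrapT => h; move: n0; rewrite big1 ?eqxx // => v _.
  by apply/eqP; apply: contra_notT h => nv; exists v.
have [nu' h n'] := IH _ nv; exists nu' => // y; rewrite inE negb_or => /andP[ne ny].
by rewrite h // upd_neq.
Qed.

End Grid.

Lemma cq_total sg (Q : cq sg) (x : 'I_(nvar Q)) :
  has (fun a => x \in args a) (rels Q) || (x \in unzip1 (comps Q)).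
Proof. by case: Q x. Qed.

Lemma prod_if (K : comNzSemiRingType) (I : Type) (s : seq I) (p : pred I) :
  (\prod_(i <- s) (if p i then 1 else 0) = if all p s then 1 else 0 :> K)%R.
Proof.
elim: s => [|i s IH]; first by rewrite big_nil.
by rewrite big_cons IH /=; case: (p i); rewrite ?mul1r ?mul0r.
Qed.

(** * The plan of a q-hierarchical query *)

Section CQTree.
Variables (K : comNzSemiRingType) (sg : vocabulary) (Q : cq sg).
Hypothesis qh : q_hierarchical Q.
Implicit Types (x y : 'I_(nvar Q)) (db : database K sg).

Definition cidx (c : const sg) : nat := if c is Some c' then (enum_rank c').+1 else 0.

Lemma flat_cidx db c : flat_cst db (cidx c) = const_val db c.
Proof.
case: c => [c|] //=; rewrite /flat_cst /=.
rewrite (nth_map c) ?nth_enum_rank; last by rewrite -cardE.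
by rewrite prednK //; apply: (valP (cval db c)).
Qed.

(** A comparison is attached to every atom that mentions its variable. Its value is 0 or 1, so
    counting it several times changes nothing. *)
Definition leaf_of (a : ratom sg (nvar Q)) : leafdata :=
  (nat_of_ord (enum_rank (tag a)), map val (args a),
   [seq (index p.1 (args a), cidx p.2) | p <- comps Q & p.1 \in args a]).

Definition leaves := map leaf_of (rels Q).

Lemma leaves_ok l : l \in leaves ->
  size l.1.2 = flat_ar sg l.1.1 /\ all (fun p => p.1 < size l.1.2) l.2.
Proof.
case/mapP=> a _ -> /=; split.
  rewrite size_map size_tuple /flat_ar (nth_map (tag a)) ?nth_enum_rank //.
  by rewrite -cardE.
apply/allP => p /mapP[q]; rewrite mem_filter => /andP[h _] -> /=.
by rewrite size_map index_mem.
Qed.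

Definition inat x := has (fun a => x \in args a) (rels Q).

Definition by_atoms (s : seq 'I_(nvar Q)) := sort (fun x y => #|atoms_of x| <= #|atoms_of y|) s.

Definition boundv := by_atoms [seq x <- enum 'I_(nvar Q) | (x \notin qhead Q) && inat x].
Definition freev := by_atoms [seq x <- enum 'I_(nvar Q) | (x \in qhead Q) && inat x].
(** The variables in [boundc] and [freec] occur in comparisons only, so each contributes an
    independent factor: the number of its admissible values as a multiple of 1 if quantified, a
    range if free. *)
Definition boundc := [seq x <- enum 'I_(nvar Q) | (x \notin qhead Q) && ~~ inat x].
Definition freec := [seq x <- enum 'I_(nvar Q) | (x \in qhead Q) && ~~ inat x].

Definition agree_on x y := all (fun a1 => all (fun a2 =>
  [&& x \in args a1, x \in args a2 & y \in args a1] ==> (y \in args a2)) (rels Q)) (rels Q).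

(** If one atom contains both variables and another only [x], the hierarchy condition puts
    [atoms_of y] strictly inside [atoms_of x]. Now the head condition excludes [y] free with [x]
    quantified, the first hypothesis excludes the converse, and for equal status the second one
    contradicts the cardinalities. *)
Lemma agree_onP x y : (x \in qhead Q -> y \in qhead Q) ->
  ((x \in qhead Q) = (y \in qhead Q) -> #|atoms_of x| <= #|atoms_of y|) ->
  agree_on x y.
Proof.
move=> hh hc; apply/allP => a1 h1; apply/allP => a2 h2; apply/implyP => /and3P[x1 x2 y1].
apply: contraT => y2.
have in_at z a : a \in rels Q -> (a \in atoms_of z) = (z \in args a) by rewrite inE => ->.
have sub : atoms_of y \subset atoms_of x.
  have [/(_ x y) + _] := qh; case/or3P => //.
    by move/fintype.subsetP/(_ a2); rewrite !in_at // x2 (negbTE y2) => /(_ isT).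
  rewrite disjoint_subset => /fintype.subsetP/(_ a1) h.
  have: a1 \notin atoms_of y by apply: h; rewrite in_at.
  by rewrite in_at // y1.
have pr : atoms_of y \proper atoms_of x.
  apply/properP; split=> //; exists a2; rewrite in_at //.
have lt := proper_card pr.
case: (boolP (y \in qhead Q)) => hy.
  have hx : x \in qhead Q by have [_ /(_ y x hy)] := qh; apply.
  by have := hc _; rewrite hx hy leqNgt lt => /(_ erefl).
have hx : x \notin qhead Q by apply: contra hy.
by have := hc _; rewrite (negbTE hx) (negbTE hy) leqNgt lt => /(_ erefl).
Qed.

Lemma by_atoms_pairwise s : {in s &, forall x y, (x \in qhead Q) = (y \in qhead Q)} ->
  pairwise agree_on (by_atoms s).
Proof.
move=> h; have tr : transitive (fun x y => #|atoms_of x| <= #|atoms_of y|).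
  by move=> a b c; apply: leq_trans.
have: pairwise (fun x y => #|atoms_of x| <= #|atoms_of y|) (by_atoms s).
  rewrite -sorted_pairwise //; apply: sort_sorted => a b; exact: leq_total.
apply: (sub_in_pairwise (P := mem s)); last first.
  by apply/allP => a; rewrite mem_sort.
move=> a b ha hb le; apply: agree_onP => //.
by rewrite (h a b).
Qed.

Lemma leafy_pairwise s : pairwise agree_on s -> leafy leaves (map val s).
Proof.
elim: s => //= x s IH /andP[/allP h /IH ?]; split=> //.
move=> l1 l2 /mapP[a1 h1 ->] /mapP[a2 h2 ->] /= x1 x2 y /mapP[z zs ->].
rewrite !(mem_map val_inj) in x1 x2 * => z1.
have /allP/(_ a1 h1)/allP/(_ a2 h2)/implyP := h z zs.
by rewrite x1 x2 z1; apply.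
Qed.

Lemma order_leafy : leafy leaves (map val boundv ++ map val freev).
Proof.
rewrite -map_cat; apply: leafy_pairwise; rewrite pairwise_cat; apply/and3P; split.
- apply/allrelP => x y; rewrite !mem_sort !mem_filter => /andP[/andP[hx _] _] /andP[/andP[hy _] _].
  by apply: agree_onP; rewrite hy ?(negbTE hx).
- apply: by_atoms_pairwise => x y; rewrite !mem_filter => /andP[/andP[hx _] _] /andP[/andP[hy _] _].
  by rewrite (negbTE hx) (negbTE hy).
- apply: by_atoms_pairwise => x y; rewrite !mem_filter => /andP[/andP[hx _] _] /andP[/andP[hy _] _].
  by rewrite hx hy.
Qed.

Lemma order_uniq : uniq (map val boundv ++ map val freev).
Proof.
rewrite -map_cat (map_inj_uniq val_inj) cat_uniq !sort_uniq.
apply/and3P; split; try by apply: filter_uniq; apply: enum_uniq.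
apply/hasPn => x; rewrite !mem_sort !mem_filter => /andP[/andP[hx _] _].
by rewrite hx.
Qed.

Lemma mem_order x : (val x \in map val boundv ++ map val freev) = inat x.
Proof.
rewrite -map_cat (mem_map val_inj) mem_cat !mem_sort !mem_filter_enum.
by case: (x \in qhead Q); case: (inat x).
Qed.

Lemma order_sub l : l \in leaves -> {subset l.1.2 <= map val boundv ++ map val freev}.
Proof.
case/mapP=> a ha -> y /mapP[x xa ->]; rewrite mem_order.
by apply/hasP; exists a.
Qed.

Lemma order_occ z : z \in map val boundv ++ map val freev ->
  exists2 l, l \in leaves & z \in l.1.2.
Proof.
move=> hz; have [x ez] : exists x : 'I_(nvar Q), z = val x.
  by move: hz; rewrite -map_cat => /mapP[x _ ->]; exists x.
move: hz; rewrite ez mem_order => /hasP[a ha xa].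
by exists (leaf_of a); [apply: map_f | apply: map_f].
Qed.

Definition cs_of x := [seq cidx p.2 | p <- comps Q & p.1 == x].
Definition cst_of x := Cst (head 0 (cs_of x)) (behead (cs_of x)).
Definition rng_of x := Rng x (head 0 (cs_of x)) (behead (cs_of x)).
Definition max_of db x := mincst (flat_cst db) (head 0 (cs_of x)) (behead (cs_of x)).

(** Each variable occurs in the body, so one in no relational atom has a comparison, and the default
    of [head] does not interfere. *)
Lemma cs_of_cons x : ~~ inat x -> cs_of x = head 0 (cs_of x) :: behead (cs_of x).
Proof.
move=> nx; have: x \in unzip1 (comps Q).
  by have := cq_total x; rewrite -/(inat x) (negbTE nx).
case/mapP=> p hp ex; have: cidx p.2 \in cs_of x.
  by apply: map_f; rewrite mem_filter ex eqxx.
by case: (cs_of x).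
Qed.

Lemma le_max_of db x v : ~~ inat x ->
  (v <= max_of db x) = all (fun p => (p.1 == x) ==> (v <= const_val db p.2)) (comps Q).
Proof.
move=> nx; rewrite /max_of leq_mincst -cs_of_cons // /cs_of all_map.
elim: (comps Q) => //= p cp IH; case: eqP => //= _.
by rewrite IH flat_cidx.
Qed.

Definition ind db x (nu : nat -> nat) : K := if (0 < nu x <= max_of db x)%N then 1%R else 0%R.

Definition LL db nu : K :=
  (\prod_(l <- leaves) lval (flat db) (flat_cst db) l.1.1 l.1.2 l.2 nu)%R.

Definition nuof (mu : {ffun 'I_(nvar Q) -> posnat}) i : nat :=
  if insub i is Some x then val (mu x) else 0.

Lemma nuofE mu x : nuof mu x = val (mu x).
Proof. by rewrite /nuof valK. Qed.

Lemma lval_leaf db mu (a : ratom sg (nvar Q)) :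
  lval (flat db) (flat_cst db) (leaf_of a).1.1 (leaf_of a).1.2 (leaf_of a).2 (nuof mu) =
  (ratom_val db mu a *
    if all (fun p => (p.1 \in args a) ==> (val (mu p.1) <= const_val db p.2)%N) (comps Q)
    then 1 else 0)%R.
Proof.
rewrite /lval /=; have -> : map (nuof mu) (map val (args a)) = map val (map mu (args a)).
  by rewrite -!map_comp; apply: eq_map => x /=; rewrite nuofE.
rewrite all_map all_filter.
rewrite (eq_all (a2 := fun p => (p.1 \in args a) ==> (val (mu p.1) <= const_val db p.2))).
  case: ifP => _; last by rewrite mulr0.
  rewrite mulr1 /ratom_val -flat_fact; congr flat.
move=> p /=; case: (boolP (p.1 \in args a)) => //= h.
by rewrite -map_comp (nth_map p.1) ?index_mem // nth_index // flat_cidx.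
Qed.

Lemma body_LL db mu : body_val db mu =
  (LL db (nuof mu) * \prod_(x <- boundc ++ freec) ind db x (nuof mu))%R.
Proof.
rewrite /LL /leaves big_map (eq_bigr _ (fun a _ => lval_leaf db mu a)) big_split /= -mulrA.
congr (_ * _)%R; rewrite /comp_val /ind !prod_if.
set A := all _ _; set B := all _ _; set C := all _ _.
suff -> : A = B && C by case: B; case: C; rewrite ?mulr1 ?mulr0.
apply/allP/andP => [h|[/allP hB /allP hC] p hp].
  split; first by apply/allP => a ha; apply/allP => p hp; apply/implyP => _; apply: h.
  apply/allP => x; rewrite mem_cat !mem_filter_enum -andb_orl orNb => /andP[_ nx].
  rewrite nuofE (valP (mu x)) le_max_of //.
  by apply/allP => p hp; apply/implyP => /eqP <-; apply: h.
case: (boolP (inat p.1)) => [/hasP[a ha hpa]|nx].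
  by have /allP/(_ p hp)/implyP := hB a ha; apply.
have: p.1 \in boundc ++ freec.
  by rewrite mem_cat !mem_filter_enum -andb_orl orNb.
move/hC; rewrite nuofE le_max_of // => /andP[_ /allP/(_ p hp)].
by rewrite eqxx.
Qed.

Lemma ind_upd db x i v nu : i \notin [:: val x] -> ind db x (upd nu i v) = ind db x nu.
Proof. by rewrite inE /ind => ne; rewrite upd_neq // eq_sym. Qed.

Lemma prod_ind_upd db (s : seq 'I_(nvar Q)) i v nu : i \notin map val s ->
  (\prod_(x <- s) ind db x (upd nu i v) = \prod_(x <- s) ind db x nu)%R.
Proof.
move=> ns; rewrite !big_seq; apply: eq_bigr => x xs; apply: ind_upd.
by rewrite inE; apply: contraNneq ns => ->; apply: map_f.
Qed.

(** These variables are independent, so the sums factor; each counts the values up to its bound, and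
    [N] is large enough not to cut any off. *)
Lemma isum_ind db N (s f : seq 'I_(nvar Q)) nu : uniq (s ++ f) ->
  (forall x, max_of db x <= N) ->
  (isum (iota 1 N) (map val s) (fun nu => \prod_(x <- s ++ f) ind db x nu) nu =
   \prod_(x <- s) (max_of db x)%:R * \prod_(x <- f) ind db x nu)%R.
Proof.
move=> + le; elim: s nu => [|x s IH] nu /=; first by rewrite big_nil mul1r.
case/andP=> nx u; rewrite mem_cat negb_or in nx; case/andP: nx => xs xf.
rewrite big_cons -mulrA -(sum_indicator _ (le x)) mulr_suml; apply: eq_bigr => v _.
have -> : (fun nu => \prod_(j <- x :: s ++ f) ind db j nu)%R =
    (fun nu => ind db x nu * \prod_(j <- s ++ f) ind db j nu)%R.
  by apply: funext => nu'; rewrite big_cons.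
rewrite isum_mull; last first.
  move=> nu' y v' /mapP[z zs ->]; apply: ind_upd.
  by rewrite inE (inj_eq val_inj); apply: contraNneq xs => <-.
rewrite IH // prod_ind_upd ?(mem_map val_inj) //.
by rewrite /ind updxx.
Qed.

Lemma LL_upd db x v nu : ~~ inat x -> LL db (upd nu (val x) v) = LL db nu.
Proof.
move=> nx; rewrite /LL !big_map !big_seq; apply: eq_bigr => a ha.
have e : map (upd nu (val x) v) (map val (args a)) = map nu (map val (args a)).
  apply/eq_in_map => z /mapP[y ya ->]; rewrite upd_neq // (inj_eq val_inj).
  by apply: contraNneq nx => <-; apply/hasP; exists a.
by rewrite /lval /= e.
Qed.

Lemma LL_ext db nu nu' : (forall x, nu (val x) = nu' (val x)) -> LL db nu = LL db nu'.
Proof.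
move=> h; rewrite /LL !big_map; apply: eq_bigr => a _.
have e : map nu (map val (args a)) = map nu' (map val (args a)).
  by rewrite -!map_comp; apply: eq_map => x; apply: h.
by rewrite /lval /= e.
Qed.

(** Elimination handles the variables in relational atoms. The others are multiplied on at the root,
    the only place where constants and ranges are allowed. *)
Lemma tree_exists : exists T, [/\ wf (flat_ar sg) [::] T, uniq (fv T),
  fv T =i map val (qhead Q) &
  forall db V nu, uniq V -> (forall q w, flat db (q :: w) != 0%R -> {subset w <= V}) ->
    (tree_val T db nu = isum V (rev (map val boundv)) (LL db) nu *
      (\prod_(x <- boundc) (max_of db x)%:R * \prod_(x <- freec) ind db x nu))%R].
Proof.
have [T1 [w1 p1 v1]] := elim_all leaves_ok order_uniq order_leafy order_sub order_occ.
pose ts := [seq cst_of x | x <- boundc] ++ [seq rng_of x | x <- freec].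
have wts : wf (flat_ar sg) [::] (mulall (Cst 0 [::]) ts).
  rewrite /ts; elim: boundc => [|x s IH] //=; elim: freec => [|x s IH] //=.
have fts : fv (mulall (Cst 0 [::]) ts) = map val freec.
  rewrite fv_mulall cats0 /ts map_cat flatten_cat -!map_comp.
  have -> : flatten [seq (fv \o cst_of) x | x <- boundc] = [::] by elim: boundc.
  by elim: freec => //= x s ->.
have pf : perm_eq (fv (Mul T1 (mulall (Cst 0 [::]) ts))) (map val (freev ++ freec)).
  by rewrite /= fts map_cat perm_cat2r.
exists (Mul T1 (mulall (Cst 0 [::]) ts)); split=> //.
- rewrite (perm_uniq pf) (map_inj_uniq val_inj) cat_uniq sort_uniq.
  apply/and3P; split; try by apply: filter_uniq; apply: enum_uniq.
  by apply/hasPn => x; rewrite mem_sort !mem_filter_enum => /andP[_ /negbTE->]; rewrite andbF.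
- move=> i; rewrite (perm_mem pf); apply/mapP/mapP => -[x hx ->]; exists x => //.
    by move: hx; rewrite mem_cat mem_sort !mem_filter_enum -andb_orr => /andP[].
  by rewrite mem_cat mem_sort !mem_filter_enum -andb_orr hx orbN.
- move=> db V nu uV sV; rewrite (@tree_valE K sg _ db (flat_ar sg) nu) //= -(v1 K _ _ V) //.
  congr (_ * _)%R; rewrite osem_mulall big_cons /= /mincst /= (flat_cidx db None) mul1r.
  by rewrite /ts big_cat !big_map.
Qed.

(** Any bound on all relevant values would do; the sum of an encoded fact is a crude one for its
    entries. *)
Definition bound db : nat :=
  (\max_(x < nvar Q) max_of db x) + \max_(f <- finsupp (facts db)) sumn (enc_fact f).

Lemma max_bound db x : max_of db x <= bound db.
Proof. by apply: leq_trans (leq_addr _ _); apply: leq_bigmax. Qed.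

Lemma flat_supp db q w : flat db (q :: w) != 0%R -> {subset w <= iota 1 (bound db)}.
Proof.
case: (flat_case sg (q :: w)) => [[f e]|h]; last by rewrite flat_none ?eqxx.
rewrite e flat_fact => nz v vw; move: e => [_ e].
have: v <= sumn (enc_fact f).
  rewrite /= -e; elim: w vw {e} => //= v' w IH; rewrite inE => /orP[/eqP->|/IH]; lia.
have hf : f \in finsupp (facts db) by rewrite mem_finsupp.
have := leq_bigmax_seq f (F := fun f => sumn (enc_fact f)) hf isT.
have: 0 < v by move: vw; rewrite e => /mapP[u _ ->]; apply: (valP u).
move=> v0 hm hv; rewrite mem_iota v0 add1n ltnS.
exact: leq_trans hv (leq_trans hm (leq_addl _ _)).
Qed.

Lemma body_supp db mu x : body_val db mu != 0%R -> val (mu x) \in iota 1 (bound db).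
Proof.
rewrite body_LL => /mul_neq0[nL nI]; rewrite -nuofE.
case: (boolP (inat x)) => [/hasP[a ha xa]|nx].
  have nl : lval (flat db) (flat_cst db) (leaf_of a).1.1 (leaf_of a).1.2 (leaf_of a).2 (nuof mu) != 0%R.
    by move: nL; rewrite /LL (big_rem (leaf_of a)) ?map_f //= => /mul_neq0[].
  by apply: (lval_supp (@flat_supp db) nl); apply: map_f.
have hx : x \in boundc ++ freec by rewrite mem_cat !mem_filter_enum -andb_orl orNb.
move: nI; rewrite (big_rem x) //= => /mul_neq0[+ _]; rewrite /ind.
case: ifP => [/andP[h1 h2] _|]; last by rewrite eqxx.
by rewrite mem_iota h1 add1n ltnS (leq_trans h2 (max_bound db x)).
Qed.

Definition succ_env N (g : {ffun 'I_(nvar Q) -> 'I_N}) : {ffun 'I_(nvar Q) -> posnat} :=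
  [ffun x => exist (fun n => 0 < n) (g x).+1 isT].

Lemma succ_env_inj N : injective (@succ_env N).
Proof.
move=> g g' e; apply/ffunP => x; apply: ord_inj.
by have := congr1 (fun mu : {ffun _ -> posnat} => val (mu x)) e; rewrite !ffunE => -[].
Qed.

Lemma nuof_succ_env N (g : {ffun 'I_(nvar Q) -> 'I_N}) x : nuof (succ_env g) x = grid_env g x.
Proof. by rewrite nuofE grid_envE ffunE. Qed.

(** A nonzero body forces all values into the interval from 1 to [bound db], so the infinite index
    set shrinks to finite functions; ordinals start at 0, hence the shift in [succ_env]. *)
Lemma cq_val_grid db d : cq_val Q db d =
  (\sum_(g : {ffun 'I_(nvar Q) -> 'I_(bound db)} | [seq succ_env g x | x <- qhead Q] == d)
     body_val db (succ_env g))%R.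
Proof.
rewrite /cq_val -[RHS]big_filter; set s := filter _ _; pose r := map (@succ_env _) s.
have -> : (\sum_(g <- s) body_val db (succ_env g) = \sum_(mu <- r) body_val db mu)%R by rewrite big_map.
rewrite (fsbig_seq _ (r := r)); last first.
  by rewrite (map_inj_uniq (@succ_env_inj _)) filter_uniq ?index_enum_uniq.
apply/esym; apply: fsbig_widen => [mu /mapP[g + ->]|mu [/= hd nr]].
  by rewrite mem_filter => /andP[/eqP].
apply/eqP; apply: contra_notT nr => nz.
have lt x : (val (mu x)).-1 < bound db.
  by have := body_supp x nz; rewrite mem_iota add1n ltnS; case: (val _).
have e : mu = succ_env [ffun x => Ordinal (lt x)].
  apply/ffunP => x; rewrite !ffunE; apply: val_inj => /=.
  by rewrite prednK //; apply: (valP (mu x)).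
apply/mapP; exists [ffun x => Ordinal (lt x)] => //.
by rewrite mem_filter mem_index_enum andbT -e hd.
Qed.

Lemma cq_val_tree T db nu d :
  (forall nu, tree_val T db nu = isum (iota 1 (bound db)) (rev (map val boundv)) (LL db) nu *
      (\prod_(x <- boundc) (max_of db x)%:R * \prod_(x <- freec) ind db x nu))%R ->
  {in map val (qhead Q), forall i, nu i \in iota 1 (bound db)} ->
  map val d = map nu (map val (qhead Q)) -> cq_val Q db d = tree_val T db nu.
Proof.
move=> vT hV hd; set V := iota 1 (bound db) in vT hV.
(* All quantified variables, in an order that sums those without relational atoms innermost: the
   relational part does not depend on them and moves out. *)
pose xs := rev (map val boundv) ++ map val boundc.
pose B nu := (LL db nu * \prod_(x <- boundc ++ freec) ind db x nu)%R.
have memxs x : (val x \in xs) = (x \notin qhead Q).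
  rewrite mem_cat mem_rev !(mem_map val_inj) mem_sort !mem_filter_enum.
  by rewrite -andb_orr orbN andbT.
have uxs : uniq xs.
  rewrite cat_uniq rev_uniq !(map_inj_uniq val_inj) sort_uniq.
  apply/and3P; split; try by apply: filter_uniq; apply: enum_uniq.
  apply/hasPn => i /mapP[x + ->]; rewrite mem_rev (mem_map val_inj) mem_sort !mem_filter_enum.
  by case/andP=> _ /negbTE->; rewrite andbF.
have sxs : {subset xs <= gtn (nvar Q)}.
  by move=> i; rewrite mem_cat mem_rev => /orP[] /mapP[x _ ->]; apply: ltn_ord.
rewrite cq_val_grid vT.
have -> : (isum V (rev (map val boundv)) (LL db) nu *
    (\prod_(x <- boundc) (max_of db x)%:R * \prod_(x <- freec) ind db x nu) = isum V xs B nu)%R.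
  rewrite isum_cat.
  have -> : isum V (map val boundc) B = fun nu =>
      ((\prod_(x <- boundc) (max_of db x)%:R * \prod_(x <- freec) ind db x nu) * LL db nu)%R.
    apply: funext => nu'; rewrite mulrC isum_mull => [|nu0 i v /mapP[x + ->]]; last first.
      by rewrite mem_filter_enum => /andP[_ nx]; apply: LL_upd.
    rewrite isum_ind //; last exact: max_bound.
    rewrite cat_uniq; apply/and3P; split; try by apply: filter_uniq; apply: enum_uniq.
    by apply/hasPn => x; rewrite !mem_filter_enum => /andP[-> _].
  rewrite isum_mull; first by rewrite mulrC.
  move=> nu0 i v; rewrite mem_rev => /mapP[x + ->]; rewrite mem_sort mem_filter_enum => /andP[nx _].
  rewrite prod_ind_upd // (mem_map val_inj) mem_filter_enum (negbTE nx) //.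
rewrite -(grid_sum (n := nvar Q)) //.
- apply: eq_big => [g|g _].
    apply/eqP/forallP => [e x|h].
      apply/implyP; rewrite memxs negbK => hx; apply/eqP.
      move: hd; rewrite -e -!map_comp => /eq_in_map/(_ x hx) /=.
      by rewrite ffunE.
    apply: (inj_map val_inj); rewrite hd -!map_comp; apply/eq_in_map => x hx /=.
    by rewrite ffunE; have /implyP := h x; rewrite memxs negbK => /(_ hx)/eqP.
  rewrite body_LL /B; congr (_ * _)%R; first by apply: LL_ext => x; rewrite nuof_succ_env.
  by apply: eq_bigr => x _; rewrite /ind nuof_succ_env.
- move=> nu1 nu2 e; rewrite /B (LL_ext _ (nu' := nu2)) => [|x]; last exact: e (ltn_ord x).
  by congr (_ * _)%R; apply: eq_bigr => x _; rewrite /ind (e x (ltn_ord x)).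
- move=> i li; rewrite (_ : i = Ordinal li) // memxs negbK => h.
  by apply: hV; apply: map_f.
Qed.

End CQTree.

Lemma cq_solvable (K : comNzSemiRingType) (P : prims K) (sg : vocabulary) (Q : cq sg) :
  semi_integral K -> sum_maintainable P -> q_hierarchical Q -> dyn_solvable P (DynEvalCQ K Q).
Proof.
move=> siK smP qh; have [T [wT uT fT vT]] := tree_exists K qh.
apply: (@dyn_reduce K P (DynEvalCQ K Q) (DynEvalTree K sg T (map val (qhead Q)))
  id (fun _ => id)) => //; last exact: tree_solvable.
move=> db d k; have vT' nu := vT db _ nu (iota_uniq 1 _) (@flat_supp _ _ Q db).
split=> [[nu [-> -> nz]]|[d' [-> -> nz]]].
  (* The plan outputs natural numbers, the query positive ones. A nonzero value places each head
     variable in an atom or in its range, hence among the positive values. *)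
  have hV : {in map val (qhead Q), forall i, nu i \in iota 1 (bound Q db)}.
    move=> i /mapP[x hx ->].
    move: nz; rewrite vT' => /mul_neq0[n1 /mul_neq0[_ n2]].
    case: (boolP (inat x)) => [/hasP[a ha xa]|nx].
      have [nu' h] := isum_neq0 n1; rewrite -h; last first.
        by rewrite mem_rev (mem_map val_inj) mem_sort mem_filter_enum hx.
      rewrite /LL (big_rem (leaf_of a)) ?map_f //= => /mul_neq0[nl _].
      by apply: (lval_supp (@flat_supp _ _ Q db) nl); apply: map_f.
    move: n2; rewrite (big_rem x) /=; last by rewrite mem_filter_enum hx.
    case/mul_neq0=> + _; rewrite /ind; case: ifP => [/andP[h1 h2] _|]; last by rewrite eqxx.
    by rewrite mem_iota h1 add1n ltnS (leq_trans h2 (max_bound db x)).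
  have pos i : i \in map val (qhead Q) -> 0 < nu i.
    by move/hV; rewrite mem_iota => /andP[].
  pose d' : seq posnat := map (fun x => insubd (exist (fun n => 0 < n) 1 isT) (nu (val x))) (qhead Q).
  have ed : map val d' = map nu (map val (qhead Q)).
    rewrite -!map_comp; apply/eq_in_map => x hx /=.
    by rewrite insubdK // -topredE /=; apply: pos; apply: map_f.
  exists d'; split=> //.
  by rewrite (cq_val_tree (T := T) _ hV ed).
have nz' := nz; rewrite cq_val_grid in nz'.
(* A nonzero sum has a nonempty index set, so some valuation yields [d'] on the head. *)
have [g hg] : exists g : {ffun 'I_(nvar Q) -> 'I_(bound Q db)}, [seq succ_env g x | x <- qhead Q] == d'.
  apply: contrapT => h; move: nz'; rewrite big1 ?eqxx // => g hg.
  by case: h; exists g.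
have ed : map val d' = map (grid_env g) (map val (qhead Q)).
  rewrite -(eqP hg) -!map_comp; apply: eq_map => x /=.
  by rewrite -nuof_succ_env nuofE.
have hV : {in map val (qhead Q), forall i, grid_env g i \in iota 1 (bound Q db)}.
  move=> i /mapP[x _ ->]; rewrite grid_envE mem_iota; have := ltn_ord (g x); lia.
exists (grid_env g); split; [exact: ed | exact: (cq_val_tree vT' hV ed) | exact: nz].
Qed.

(** * MATLANG *)

Section MatrixDatabase.
Variables (K : comNzSemiRingType) (S : schema).
Implicit Types I : minst K S.

(** Matrices are binary relations and dimensions are constants; the size symbol 1 and the constant
    symbol 1 are both [None]. *)
Definition matvoc : vocabulary := @Vocabulary (msym S) (fun=> 2) (sz S).

Definition fact_of I (p : pos I) : fact matvoc :=
  @Tagged (rsym matvoc) (tag p) (fun A => (arity A).-tuple posnat)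
    [tuple exist (fun n => 0 < n) (tagged p).1.+1 isT;
           exist (fun n => 0 < n) (tagged p).2.+1 isT].

Lemma enc_fact_of I (p : pos I) : enc_fact (fact_of p) = enc_pos p.
Proof. by []. Qed.

Lemma fact_of_inj I : injective (@fact_of I).
Proof.
move=> p q /(congr1 (@enc_fact _)); rewrite !enc_fact_of /enc_pos.
case: p q => [A [i j]] [B [i' j']] /= [/ord_inj/enum_rank_inj e]; case: B / e i' j' => i' j'.
by move=> /= ei ej; rewrite (ord_inj ei) (ord_inj ej).
Qed.

Definition entry_of I (f : fact matvoc) : K :=
  (\sum_(p : pos I | fact_of p == f) entry p)%R.

Lemma entry_of_fact I (p : pos I) : entry_of I (fact_of p) = entry p.
Proof.
rewrite /entry_of (eq_bigl (pred1 p)) ?big_pred1_eq // => q.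
exact: inj_eq (@fact_of_inj I) _ _.
Qed.

Definition db_of I : database K matvoc :=
  Database [fsfun f in [fset fact_of p | p in pos I]%fset => entry_of I f] (mdim I).

Lemma facts_db_of I f : facts (db_of I) f = entry_of I f.
Proof.
rewrite /= fsfunE; case: ifPn => // nf; rewrite /entry_of big1 // => p /eqP ef.
by case/negP: nf; apply/imfsetP; exists p.
Qed.

Lemma entry_of_neq0 I f : entry_of I f != 0%R -> exists2 p : pos I, f = fact_of p & entry p != 0%R.
Proof.
move=> nz; have [p ef] : exists p : pos I, fact_of p == f.
  apply: contrapT => h; move: nz; rewrite /entry_of big1 ?eqxx // => p hp.
  by case: h; exists p.
by move: nz; rewrite -(eqP ef) entry_of_fact; exists p; rewrite // (eqP ef).
Qed.

Lemma finsupp_db_of I :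
  perm_eq [seq fact_of p | p <- enum [pred p : pos I | entry p != 0%R]] (finsupp (facts (db_of I))).
Proof.
apply: uniq_perm; first by rewrite (map_inj_uniq (@fact_of_inj I)) enum_uniq.
  exact: fset_uniq.
move=> f; rewrite mem_finsupp facts_db_of; apply/mapP/idP => [[p hp ->]|].
  by move: hp; rewrite fintype.mem_enum entry_of_fact.
case/entry_of_neq0=> p -> hp; exists p => //.
by rewrite fintype.mem_enum.
Qed.

Lemma db_of_apply I (x : minst_update I) : db_of (minst_apply x) =
  db_apply (db_of I) (match x with MInsert p k => Insert (fact_of p) k
                                 | MDelete p => Delete K (fact_of p) end).
Proof.
have entryE (F : pos I -> K) (q : pos I) : entry (q : pos (map_entries F)) = F q.
  by case: q => A [i j]; rewrite /entry /= mxE.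
have ext (F : pos I -> K) f : entry_of (map_entries F) f =
    (\sum_(p : pos I | fact_of p == f) F p)%R.
  by apply: eq_bigr => q _; apply: entryE.
have H (F : pos I -> K) p k (y : db_update K matvoc) :
    (forall q, F q = if q == p then k else entry q) ->
    facts (db_apply (db_of I) y) = [fsfun facts (db_of I) with fact_of p |-> k] ->
    cval (db_apply (db_of I) y) = mdim I ->
    db_of (map_entries F) = db_apply (db_of I) y.
  case: (db_apply _ y) => fs cv eF /= -> ->; rewrite /db_of; congr Database.
  apply/fsfunP => f; rewrite fsfun_withE.
  rewrite -[LHS]/(facts (db_of (map_entries F)) f) facts_db_of ext.
  rewrite -[X in if _ then _ else X]/(facts (db_of I) f) facts_db_of.
  rewrite (eq_bigr _ (fun q _ => eF q)).
  case: (f =P fact_of p) => [->|ne].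
    rewrite (eq_bigl (pred1 p)) ?big_pred1_eq ?eqxx // => q.
    exact: inj_eq (@fact_of_inj I) _ _.
  by apply: eq_bigr => q /eqP eq; case: eqP => // e; case: ne; rewrite -eq e.
case: x => [p k|p].
  apply: (H _ p (entry p + k)%R) => //= [q|]; first by case: eqP => // ->.
  by rewrite -[X in (X + k)%R]/(facts (db_of I) (fact_of p)) facts_db_of entry_of_fact.
by apply: (H _ p 0%R).
Qed.

Lemma enc_db_of I w : enc_minst I w -> enc_db (db_of I) w.
Proof.
case=> l pl ->; exists (map (@fact_of I) l).
  by apply: perm_trans (finsupp_db_of I); apply: perm_map.
rewrite size_map -!map_comp; congr (_ , _).
by apply: eq_map => p /=; rewrite -[RHS]/(facts (db_of I) (fact_of p)) facts_db_of entry_of_fact.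
Qed.

Definition mrank (A : msym S) : nat := enum_rank (A : rsym matvoc).

Lemma flat_mat I A i j : flat (db_of I) [:: mrank A; (nat_of_ord i).+1; (nat_of_ord j).+1] = mat I A i j.
Proof.
rewrite -[[:: _; _; _]]/(enc_fact (fact_of (Tagged (pos_of I) ((i, j) : pos_of I A)))).
by rewrite flat_fact facts_db_of entry_of_fact.
Qed.

Lemma flat_mat_supp I A u v : flat (db_of I) [:: mrank A; u; v] != 0%R ->
  (0 < u <= dim_of (mdim I) (mrow A)) /\ (0 < v <= dim_of (mdim I) (mcol A)).
Proof.
case: (flat_case matvoc [:: mrank A; u; v]) => [[f e]|h]; last by rewrite flat_none ?eqxx.
rewrite e flat_fact facts_db_of => /entry_of_neq0[[B [i j]] ef _]; move: e; rewrite ef /enc_fact /=.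
case=> /ord_inj/enum_rank_inj eA; case: B / eA i j {ef} => i j -> ->.
by rewrite !ltnS !ltn_ord.
Qed.

Lemma flat_cst_dim I a : flat_cst (db_of I) (cidx (a : const matvoc)) = dim_of (mdim I) a.
Proof. by rewrite flat_cidx; case: a. Qed.

Lemma flat_ar_mrank A : flat_ar matvoc (mrank A) = 2.
Proof.
rewrite /flat_ar (nth_map A) ?nth_enum_rank // -cardE.
exact: ltn_ord.
Qed.

(** The two head variables may coincide: the plan of a diagonal result enumerates a single variable
    and outputs it twice. *)
Lemma matlang_reduce (P : prims K) a b (e : expr a b) T hx hy :
  semi_integral K -> sum_maintainable P -> wf (flat_ar matvoc) [::] T -> uniq (fv T) ->
  fv T =i [:: hx; hy] ->
  (forall I nu, osem (flat (db_of I)) (flat_cst (db_of I)) T nu != 0%R ->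
     exists i j, [/\ nu hx = (nat_of_ord i).+1, nu hy = (nat_of_ord j).+1 &
       Defs.eval I e i j = osem (flat (db_of I)) (flat_cst (db_of I)) T nu]) ->
  (forall I i j, Defs.eval I e i j != 0%R ->
     exists nu, [/\ nu hx = (nat_of_ord i).+1, nu hy = (nat_of_ord j).+1 &
       Defs.eval I e i j = osem (flat (db_of I)) (flat_cst (db_of I)) T nu]) ->
  dyn_solvable P (DynEvalMatlang K e).
Proof.
move=> siK smP w u f h1 h2.
apply: (@dyn_reduce K P (DynEvalMatlang K e) (DynEvalTree K matvoc T [:: hx; hy])
  db_of (fun I x => match x with MInsert p k => Insert (fact_of p) k
                               | MDelete p => Delete K (fact_of p) end)).
- by move=> I /=; rewrite -(perm_size (finsupp_db_of I)) size_map -cardE.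
- exact: enc_db_of.
- by move=> I [].
- exact: db_of_apply.
- move=> I d k; split=> [[nu [-> -> nz]]|[i [j [-> -> nz]]]].
    rewrite (tree_valE _ _ w) in nz *; have [i [j [e1 e2 e3]]] := h1 _ _ nz.
    by exists i, j; rewrite /= e1 e2 e3.
  by have [nu [e1 e2 e3]] := h2 I i j nz; exists nu; rewrite /= e1 e2 (tree_valE _ _ w) -e3.
- exact: tree_solvable.
Qed.

End MatrixDatabase.

Lemma wf_mulall ar s t ts : {in t :: ts, forall t', wf ar s t'} -> wf ar s (mulall t ts).
Proof.
elim: ts => [|t' ts IH] h /=; first by apply: h; rewrite mem_head.
split; first by apply: h; rewrite !inE eqxx orbT.
by apply: IH => t2; rewrite inE => /orP[/eqP->|h2]; apply: h; rewrite !inE ?eqxx ?h2 ?orbT.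
Qed.

Lemma fv_mulall0 t ts : {in t :: ts, forall t', fv t' = [::]} -> fv (mulall t ts) = [::].
Proof.
elim: ts => [|t' ts IH] h /=; first by apply: h; rewrite mem_head.
rewrite h ?inE ?eqxx ?orbT //; apply: IH => t2; rewrite inE => /orP[/eqP->|h2]; apply: h.
  by rewrite mem_head.
by rewrite !inE h2 !orbT.
Qed.

(** * Normal forms of expressions *)

Section NormalForm.
Variables (K : comNzSemiRingType) (S : schema).
Implicit Types (I : minst K S) (x y : nat) (nu : nat -> nat).

Local Notation ar := (flat_ar (matvoc S)).
Local Notation os I := (osem (flat (db_of I)) (flat_cst (db_of I))).
Local Notation dim I a := (dim_of (mdim I) a).

Definition binleaf x y (l : msym S * bool) : tree :=
  Leaf (mrank l.1) (if l.2 then [:: y; x] else [:: x; y]) [::].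

(** The meaning of an expression at row [x] and column [y]: a product of a
    scalar, factors in [x], factors in [y], matrix entries (transposed when
    flagged) and possibly the test [x = y]. *)
Record normal := Normal {
  scal : tree;
  rowf : seq tree;
  colf : seq tree;
  diag : bool;
  ents : seq (msym S * bool) }.

Definition nval I N x y nu : K :=
  (os I (scal N) nu * ((\prod_(t <- rowf N) os I t nu) * (\prod_(t <- colf N) os I t nu) *
    (\prod_(l <- ents N) os I (binleaf x y l) nu) * (if diag N then (nu x == nu y)%:R else 1)))%R.

Lemma nvalE I s r c d l x y nu : nval I (Normal s r c d l) x y nu =
  (os I s nu * ((\prod_(t <- r) os I t nu) * (\prod_(t <- c) os I t nu) *
    (\prod_(l <- l) os I (binleaf x y l) nu) * (if d then (nu x == nu y)%:R else 1)))%R.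
Proof. by []. Qed.

(** The support condition turns sums over all naturals into sums over the indices of a matrix. *)
Definition factor_ok (x : nat) (a : option (sz S)) t :=
  [/\ wf ar [:: x] t, fv t = [::] &
    forall I nu, os I t nu != 0%R -> 0 < nu x <= dim I a].

Definition normal_ok a b N x y : Prop :=
  [/\ wf ar [::] (scal N) /\ fv (scal N) = [::],
    forall t, t \in rowf N -> factor_ok x a t,
    forall t, t \in colf N -> factor_ok y b t,
    forall l, l \in ents N -> forall I nu, os I (binleaf x y l) nu != 0%R ->
      (0 < nu x <= dim I a) && (0 < nu y <= dim I b) &
    diag N -> a = b].

(** A side of size 1 has a single index, so whatever depends on it is moved to the other side or
    into the scalar. *)
Definition shaped (a b : option (sz S)) N : Prop :=
  [/\ ~~ isSome a -> rowf N = [::], ~~ isSome b -> colf N = [::] &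
    ~~ (isSome a && isSome b) -> diag N = false /\ ents N = [::]].

(** In the absence of outer products, a simple expression whose two sides are proper size symbols
    has no separate row or column factors, and it contains an entry or the diagonal test. *)
Definition simple_shape (a b : option (sz S)) N : Prop :=
  isSome a && isSome b ->
    [/\ rowf N = [::], colf N = [::] & diag N || (ents N != [::])].

Definition represents a b (e : expr a b) N x y : Prop :=
  forall I nu i j, nu x = (nat_of_ord i).+1 -> nu y = (nat_of_ord j).+1 ->
    Defs.eval I e i j = nval I N x y nu.

Lemma os_binleaf I x y l nu : os I (binleaf x y l) nu =
  flat (db_of I) [:: mrank l.1; nu (if l.2 then y else x); nu (if l.2 then x else y)].
Proof. by case: l => A []. Qed.

Lemma wf_binleaf x y l s : s =i [:: x; y] -> wf ar s (binleaf x y l).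
Proof.
move=> e; split=> //; last by rewrite flat_ar_mrank; case: l.2.
by move=> z; rewrite e; case: l.2 => //; rewrite !inE orbC.
Qed.

Lemma os_scal I t nu nu' : wf ar [::] t -> fv t = [::] -> os I t nu = os I t nu'.
Proof. by move=> w f; apply: (osem_dep _ _ w) => z; rewrite f. Qed.

Lemma os_factor I x a t nu nu' : factor_ok x a t -> nu x = nu' x -> os I t nu = os I t nu'.
Proof.
case=> w f _ e; apply: (osem_dep _ _ w) => z.
by rewrite f cats0 inE => /eqP->.
Qed.

Lemma os_bind I m x t nu : (forall v, os I t (upd nu x v) != 0%R -> 0 < v <= m) ->
  os I (Bind false x t) nu = (\sum_(i < m) os I t (upd nu x i.+1))%R.
Proof.
move=> h; rewrite -[LHS]/(agg false (fun v => os I t (upd nu x v))).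
rewrite (agg_sum (L := iota 1 m)) ?iota_uniq //; first exact: sum_iota1.
by move=> v /h; rewrite mem_iota add1n ltnS.
Qed.

Lemma os_prod I ts t nu : os I (mulall t ts) nu = (\prod_(t' <- t :: ts) os I t' nu)%R.
Proof. exact: osem_mulall. Qed.

Lemma prod_neq0 I ts nu t : (\prod_(t' <- ts) os I t' nu != 0)%R -> t \in ts -> os I t nu != 0%R.
Proof. by move=> + ht; rewrite (big_rem t) //= => /mul_neq0[]. Qed.

Lemma dim_None I a : ~~ isSome a -> dim I a = 1.
Proof. by case: a. Qed.

Lemma ord_None I a (i : 'I_(dim I a)) : ~~ isSome a -> (nat_of_ord i).+1 = 1.
Proof. by case: a i => // -[[|m] li]. Qed.

Definition one := Cst 0 [::].

Lemma os_one I nu : os I one nu = 1%R.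
Proof. by rewrite /= /mincst /= (flat_cst_dim I None). Qed.

Lemma flat_supp1 I A x y s nu : os I (binleaf x y (A, s)) nu != 0%R ->
  (0 < nu (if s then y else x) <= dim I (mrow A)) &&
  (0 < nu (if s then x else y) <= dim I (mcol A)).
Proof. by rewrite os_binleaf => /flat_mat_supp[-> ->]. Qed.

(** A side of size 1 is bound by a sum that has just the term at index 1; the matrix thereby becomes
    a row factor, a column factor or a scalar. *)
Lemma represents_Mat A x y : x != y -> exists N,
  [/\ normal_ok (mrow A) (mcol A) N x y, shaped (mrow A) (mcol A) N,
    simple_shape (mrow A) (mcol A) N & represents (EMat A) N x y].
Proof.
move=> ne; set t := binleaf x y (A, false).
have supp I nu := @flat_supp1 I A x y false nu; rewrite /= -/t in supp.
have val I nu i j : nu x = (nat_of_ord i).+1 -> nu y = (nat_of_ord j).+1 -> os I t nu = mat I A i j.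
  by move=> ex ey; rewrite os_binleaf /= ex ey flat_mat.
have wt s : s =i [:: x; y] -> wf ar s t by apply: wf_binleaf.
have ne' : y != x by rewrite eq_sym.
have bindy I nu : ~~ isSome (mcol A) -> os I (Bind false y t) nu = os I t (upd nu y 1).
  move=> nb; rewrite (os_bind (m := dim I (mcol A))) => [|v /supp/andP[_]]; last by rewrite updxx.
  by rewrite dim_None // big_ord1.
have bindx I nu : ~~ isSome (mrow A) -> os I (Bind false x t) nu = os I t (upd nu x 1).
  move=> na; rewrite (os_bind (m := dim I (mrow A))) => [|v /supp/andP[+ _]]; last by rewrite updxx.
  by rewrite dim_None // big_ord1.
case: (boolP (isSome (mrow A))) => ha; case: (boolP (isSome (mcol A))) => hb.
- exists (Normal one [::] [::] false [:: (A, false)]); split.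
  + split=> //= l; rewrite inE => /eqP-> I nu /supp //.
  + by split; rewrite ?ha ?hb.
  + by split.
  + move=> I nu i j ex ey; rewrite nvalE os_one !big_nil big_seq1 !(mul1r, mulr1).
    by rewrite -(val I nu).
- exists (Normal one [:: Bind false y t] [::] false [::]); split.
  + split=> //= u; rewrite inE => /eqP->; split=> //.
      split=> //; first by rewrite inE.
      by apply: wt => z; rewrite !inE orbC.
    move=> I nu; rewrite bindy // => /supp/andP[+ _]; by rewrite upd_neq.
  + by split; rewrite ?ha.
  + by rewrite /simple_shape ha (negbTE hb).
  + move=> I nu i j ex ey; rewrite nvalE os_one !big_nil big_seq1 !(mul1r, mulr1).
    rewrite bindy // (val _ _ i j) ?updxx ?upd_neq //.
    by rewrite ord_None.
- exists (Normal one [::] [:: Bind false x t] false [::]); split.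
  + split=> //= u; rewrite inE => /eqP->; split=> //.
      by split=> //; [rewrite inE | apply: wt].
    move=> I nu; rewrite bindx // => /supp/andP[_]; by rewrite upd_neq.
  + by split; rewrite ?hb.
  + by rewrite /simple_shape (negbTE ha).
  + move=> I nu i j ex ey; rewrite nvalE os_one !big_nil big_seq1 !(mul1r, mulr1).
    rewrite bindx // (val _ _ i j) ?updxx ?upd_neq //.
    by rewrite ord_None.
- exists (Normal (Bind false x (Bind false y t)) [::] [::] false [::]); split.
  + split=> //=; split=> //; split=> //; split=> //; first by rewrite inE.
    by apply: wt => z; rewrite !inE orbC.
  + by split.
  + by rewrite /simple_shape (negbTE ha).
  + move=> I nu i j ex ey; rewrite nvalE !big_nil !mulr1.
    have nz nu' : os I (Bind false y t) nu' != 0%R -> 0 < nu' x <= dim I (mrow A).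
      by rewrite bindy // => /supp/andP[+ _]; rewrite upd_neq.
    rewrite (os_bind (m := 1)) => [|v /nz]; last by rewrite updxx dim_None.
    rewrite big_ord1 bindy // (val _ _ i j) //.
      by rewrite upd_neq // updxx ord_None.
    by rewrite updxx ord_None.
Qed.

Lemma represents_Ones a x y : exists N,
  [/\ normal_ok a None N x y, shaped a None N, simple_shape a None N & represents (EOnes a) N x y].
Proof.
exists (Normal one [::] [::] false [::]); split=> //; first by rewrite /simple_shape andbF.
by move=> I nu i j _ _; rewrite nvalE os_one !big_nil !mulr1 /= mxE.
Qed.

(** For the size symbol 1 the identity is the scalar 1, and the diagonal test is left out as
    [shaped] demands. *)
Lemma represents_Id a x y : exists N,
  [/\ normal_ok a a N x y, shaped a a N, simple_shape a a N & represents (EId a) N x y].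
Proof.
exists (Normal one [::] [::] (isSome a) [::]); split.
- by split.
- by split=> //=; case: (a).
- by rewrite /simple_shape /= andbb => ->.
move=> I nu i j ex ey; rewrite nvalE os_one !big_nil !mul1r ex ey eqSS /= mxE.
by case: a i j {ex ey} => [a|] //= i j; rewrite (ord1 i) (ord1 j) eqxx.
Qed.

Definition swap_ent (l : msym S * bool) := (l.1, ~~ l.2).

Definition swap_normal N := Normal (scal N) (colf N) (rowf N) (diag N) (map swap_ent (ents N)).

Lemma os_swap I x y l nu : os I (binleaf x y (swap_ent l)) nu = os I (binleaf y x l) nu.
Proof. by rewrite !os_binleaf; case: l => A []. Qed.

Lemma nval_swap I N x y nu : nval I (swap_normal N) x y nu = nval I N y x nu.
Proof.
case: N => s r c d l; rewrite /swap_normal !nvalE big_map eq_sym; congr (_ * (_ * _ * _))%R.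
  exact: mulrC.
by apply: eq_bigr => z _; apply: os_swap.
Qed.

Lemma normal_ok_swap a b N x y : normal_ok a b N y x -> normal_ok b a (swap_normal N) x y.
Proof.
case=> h1 h2 h3 h4 h5; split=> //; last by move/h5.
by move=> l /mapP[l' hl ->] I nu; rewrite os_swap andbC; apply: h4.
Qed.

Lemma shaped_swap a b N : shaped a b N -> shaped b a (swap_normal N).
Proof. by case=> h1 h2 h3; split=> //=; rewrite andbC => /h3[-> ->]. Qed.

Lemma represents_Tr a b (e : expr a b) x y :
  (exists N, [/\ normal_ok a b N y x, shaped a b N, simple_shape a b N & represents e N y x]) ->
  exists N, [/\ normal_ok b a N x y, shaped b a N, simple_shape b a N & represents (ETr e) N x y].
Proof.
case=> N [h1 h2 h3 h4]; exists (swap_normal N); split.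
- exact: normal_ok_swap.
- exact: shaped_swap.
- rewrite /simple_shape andbC /= => /h3[-> -> h]; split=> //.
  by case: (ents N) h.
- by move=> I nu i j ex ey; rewrite nval_swap /= mxE; apply: h4.
Qed.

Definition mul_normal N N' := Normal (Mul (scal N) (scal N')) (rowf N ++ rowf N')
  (colf N ++ colf N') (diag N || diag N') (ents N ++ ents N').

Lemma nval_mul I N N' x y nu : nval I (mul_normal N N') x y nu = (nval I N x y nu * nval I N' x y nu)%R.
Proof.
case: N N' => s r c d l [s' r' c' d' l']; rewrite /mul_normal !nvalE /= !big_cat.
set dd := (X in (_ * (_ * X) = _)%R).
have -> : dd = ((if d then (nu x == nu y)%:R else 1) * (if d' then (nu x == nu y)%:R else 1))%R.
  by rewrite {}/dd; case: d; case: d'; case: (nu x == nu y); rewrite ?mulr1 ?mulr0 ?mul1r.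
rewrite -!/(os I _ _) /=; set A := (\big[_/_]_(_ <- r) _)%R; set A' := (\big[_/_]_(_ <- r') _)%R.
set B := (\big[_/_]_(_ <- c) _)%R; set B' := (\big[_/_]_(_ <- c') _)%R.
set C := (\big[_/_]_(_ <- l) _)%R; set C' := (\big[_/_]_(_ <- l') _)%R.
rewrite [RHS]mulrACA; congr (_ * _)%R.
rewrite [RHS]mulrACA; congr (_ * _)%R.
rewrite [RHS]mulrACA; congr (_ * _)%R.
exact: mulrACA.
Qed.

Lemma normal_ok_mul a b N N' x y : normal_ok a b N x y -> normal_ok a b N' x y ->
  normal_ok a b (mul_normal N N') x y.
Proof.
case=> [[w f] h2 h3 h4 h5] [[w' f'] h2' h3' h4' h5']; split=> //=; first by rewrite f f'.
- by move=> t; rewrite mem_cat => /orP[/h2|/h2'].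
- by move=> t; rewrite mem_cat => /orP[/h3|/h3'].
- by move=> t; rewrite mem_cat => /orP[/h4|/h4'].
- by case/orP.
Qed.

Lemma shaped_mul a b N N' : shaped a b N -> shaped a b N' -> shaped a b (mul_normal N N').
Proof.
case=> h1 h2 h3 [h1' h2' h3']; split=> /= h; rewrite ?h1 ?h1' ?h2 ?h2' //.
by have [-> ->] := h3 h; have [-> ->] := h3' h.
Qed.

Lemma represents_Had a b (e e' : expr a b) N N' x y :
  represents e N x y -> represents e' N' x y -> represents (EHad e e') (mul_normal N N') x y.
Proof. by move=> h h' I nu i j ex ey; rewrite nval_mul -(h I nu i j) // -(h' I nu i j) //= mxE. Qed.

Lemma simple_shape_mul a b N N' : simple_shape a b N -> simple_shape a b N' ->
  simple_shape a b (mul_normal N N').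
Proof.
move=> h h' ab; have [r c d] := h ab; have [r' c' _] := h' ab.
split; rewrite /= ?r ?c //; case/orP: d => [->|] //.
by case: (ents N) => // l ls _; rewrite orbT.
Qed.

Definition represented a b (e : expr a b) x y : Prop := exists N,
  [/\ normal_ok a b N x y, shaped a b N, simple_shape a b N & represents e N x y].

Lemma represented_Scale a b (e1 : expr None None) (e2 : expr a b) x y : x != y ->
  represented e1 x y -> represented e2 x y -> represented (EScale e1 e2) x y.
Proof.
move=> ne [[s r c d l] [[[/= w f] _ _ _ _] [/= r0 c0 dl0] _ h1]] [N2 [k2 s2 m2 h2]].
move: h1; rewrite (r0 isT) (c0 isT); have [-> ->] := dl0 isT => h1.
exists (mul_normal (Normal s [::] [::] false [::]) N2); split.
- by apply: normal_ok_mul.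
- by apply: shaped_mul.
- move=> ab; have [/= -> -> h] := m2 ab; by split.
- move=> I nu i j ex ey; rewrite nval_mul -(h2 I nu i j) //= mxE; congr (_ * _)%R.
  rewrite (h1 I (upd (upd nu x 1) y 1)); last by rewrite updxx.
    by rewrite !nvalE !big_nil !mulr1; apply: os_scal.
  by rewrite upd_neq // updxx.
Qed.

(** The first factor ends the product in place of a constant 1, since constants are not well-formed
    below a binder. *)
Definition prodt G := mulall (head one G) (behead G).

Lemma os_prodt I G nu : G != [::] -> os I (prodt G) nu = (\prod_(t <- G) os I t nu)%R.
Proof. by case: G => // t G _; apply: os_prod. Qed.

Lemma wf_prodt s G : G != [::] -> {in G, forall t, wf ar s t /\ fv t = [::]} ->
  wf ar s (prodt G) /\ fv (prodt G) = [::].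
Proof.
case: G => // t G _ h; split; [apply: wf_mulall | apply: fv_mulall0] => t' /h; by case.
Qed.

Lemma eval_sum a b (e : expr a b) I i j :
  Defs.eval I (EMul e (EOnes b)) i j = (\sum_k Defs.eval I e i k)%R.
Proof. by rewrite /= mxE; apply: eq_bigr => k _; rewrite mxE mulr1. Qed.

(** If [b] is the size symbol 1, the sum has one term. A diagonal test selects the term at [y = x]
    and turns the entries into diagonal entries. Otherwise let [G] collect the factors that mention
    [y]: if there are none, the sum multiplies by the dimension; else [y] is bound over their
    product. For a proper [a], [simple_shape] leaves only entries in [G], which all mention [x], so
    this is a row factor; for [a] of size 1 it is a scalar. *)
Lemma represented_Sum a b (e : expr a b) x y : x != y ->
  represented e x y -> represented (EMul e (EOnes b)) x y.
Proof.
move=> ne [[s r c d l] [[/= [ws fs] hr hc hl hd] [/= r0 c0 dl0] sh h]].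
have ne' : y != x by rewrite eq_sym.
have shape N : (~~ isSome a -> rowf N = [::]) -> colf N = [::] -> diag N = false -> ents N = [::] ->
    shaped a None N /\ simple_shape a None N.
  by move=> h1 h2 h3 h4; split; [split | rewrite /simple_shape andbF].
case: (boolP (isSome b)) => hb; last first.
  have [d0 l0] : d = false /\ l = [::] by apply: dl0; rewrite (negbTE hb) andbF.
  have [s1 s2] := shape (Normal s r [::] false [::]) r0 erefl erefl erefl.
  exists (Normal s r [::] false [::]); split=> //.
  move=> I nu i j ex ey; rewrite eval_sum.
  have lb : 0 < dim I b by rewrite dim_None.
  rewrite (bigD1 (Ordinal lb)) //= big1 ?addr0; last first.
    move=> k /eqP nk; case: nk; apply: val_inj; by have := ord_None k hb => -[].
  by rewrite (h I nu) //= ?c0 ?d0 ?l0 // ey ord_None.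
have val I nu i : nu x = (nat_of_ord i).+1 -> (\sum_k Defs.eval I e i k =
    \sum_(k < dim I b) nval I (Normal s r c d l) x y (upd nu y k.+1))%R.
  by move=> ex; apply: eq_bigr => k _; apply: h; rewrite ?updxx ?upd_neq.
have rowE I nu v : (\prod_(t <- r) os I t (upd nu y v) = \prod_(t <- r) os I t nu)%R.
  by rewrite !big_seq; apply: eq_bigr => t /hr ht; apply: os_factor ht _; rewrite upd_neq.
case ed: d; subst d.
  have ab := hd isT; have ha : isSome a by rewrite ab.
  have [er ec _] : [/\ r = [::], c = [::] & true || (l != [::])] by apply: sh; rewrite ha hb.
  pose D := [seq binleaf x x z | z <- l].
  have leafE I z nu : os I (binleaf x x z) nu = os I (binleaf x y z) (upd nu y (nu x)).
    by rewrite !os_binleaf; case: z.2; rewrite updxx upd_neq.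
  have [s1 s2] := shape (Normal s D [::] false [::]) ltac:(by rewrite ha) erefl erefl erefl.
  exists (Normal s D [::] false [::]); split=> //.
  + split=> // t /mapP[z hz ->]; split=> //.
      split=> //; last by rewrite flat_ar_mrank; case: z.2.
      by move=> i; case: z.2; rewrite !inE orbb.
    by move=> I nu; rewrite leafE => /(hl z hz)/andP[+ _]; rewrite upd_neq.
  + move=> I nu i j ex ey; rewrite eval_sum (val I nu) // er ec.
    have lt : i < dim I b by rewrite -ab ltn_ord.
    rewrite (bigD1 (Ordinal lt)) //= big1 ?addr0 => [|k nk]; last first.
      rewrite nvalE upd_neq // updxx ex eqSS.
      by case: eqP => [e1|_]; [case/eqP: nk; apply: val_inj | rewrite !mulr0].
    rewrite !nvalE !big_nil upd_neq // updxx ex eqxx !mulr1 mul1r /D big_map.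
    congr (_ * _)%R; first exact: os_scal.
    by apply: eq_bigr => z _; rewrite leafE ex.
pose G := c ++ [seq binleaf x y z | z <- l].
have valG I nu k : nval I (Normal s r c false l) x y (upd nu y k) =
    (os I s nu * (\prod_(t <- r) os I t nu) * \prod_(t <- G) os I t (upd nu y k))%R.
  rewrite nvalE mulr1 rowE /G big_cat big_map /= !mulrA; do 3 congr (_ * _)%R.
  exact: os_scal.
case: (eqVneq G [::]) => [G0|nG].
  have [s1 s2] := shape (Normal (Mul s (Cst (cidx (b : const (matvoc S))) [::]))
    r [::] false [::]) r0 erefl erefl erefl.
  exists (Normal (Mul s (Cst (cidx (b : const (matvoc S))) [::])) r [::] false [::]); split=> //.
  + by split=> //; split; [split | rewrite /= fs].
  + move=> I nu i j ex ey; rewrite eval_sum (val I nu) //.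
    rewrite (eq_bigr (fun=> os I s nu * \prod_(t <- r) os I t nu)%R) => [|k _]; last first.
      by rewrite valG G0 big_nil mulr1.
    rewrite big_const_ord iter_addr_0 nvalE !big_nil !mulr1 /= /mincst /=.
    by rewrite flat_cst_dim mulrAC mulr_natr.
have supp I nu : os I (prodt G) nu != 0%R -> 0 < nu y <= dim I b.
  rewrite os_prodt // => nz;
    have [t tG] : exists t, t \in G by case: (G) nG => // t G' _; exists t; rewrite mem_head.
  have := prod_neq0 nz tG; move: tG; rewrite mem_cat => /orP[/hc[_ _ ht]|/mapP[z hz ->]];
    first exact: ht.
  by move/(hl z hz) => /andP[].
pose B := Bind false y (prodt G).
have valB I nu i j : nu x = (nat_of_ord i).+1 -> Defs.eval I (EMul e (EOnes b)) i j =
    (os I s nu * (\prod_(t <- r) os I t nu) * os I B nu)%R.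
  move=> ex; rewrite eval_sum (val I nu) // (eq_bigr _ (fun (k : 'I_(dim I b)) _ => valG I nu k.+1))
    -mulr_sumr.
  congr (_ * _)%R; rewrite (os_bind (m := dim I b)) => [|v /supp]; last by rewrite updxx.
  by apply: eq_bigr => k _; rewrite os_prodt.
case: (boolP (isSome a)) => ha.
  have [er ec _] : [/\ r = [::], c = [::] & false || (l != [::])] by apply: sh; rewrite ha hb.
  have [s1 s2] := shape (Normal s [:: B] [::] false [::]) ltac:(by rewrite ha) erefl erefl erefl.
  exists (Normal s [:: B] [::] false [::]); split=> //.
  + split=> // t; rewrite inE => /eqP->.
    have [w1 w2] : wf ar [:: y; x] (prodt G) /\ fv (prodt G) = [::].
      apply: wf_prodt => // t'; rewrite /G ec => /mapP[z _ ->]; split=> //.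
      by apply: wf_binleaf => i; rewrite !inE orbC.
    split=> //; first by split; rewrite ?w2 ?inE.
    move=> I nu; rewrite (os_bind (m := dim I b)) => [nz|v /supp]; last by rewrite updxx.
    have [k nk] : exists k : 'I_(dim I b), os I (prodt G) (upd nu y k.+1) != 0%R.
      apply: contrapT => H; move: nz; rewrite big1 ?eqxx // => k _.
      by apply/eqP; apply: contra_notT H => nk; exists k.
    move: nk; rewrite os_prodt // => nz'.
    have [z hz] : exists z, z \in l.
      by move: nG; rewrite /G ec; case: (l) => // z l' _; exists z; rewrite mem_head.
    have zG : binleaf x y z \in G by rewrite mem_cat map_f ?orbT.
    by have /andP[] := hl z hz _ _ (prod_neq0 nz' zG); rewrite upd_neq.
  + move=> I nu i j ex ey; rewrite (valB I nu i j ex) er nvalE !big_nil big_seq1 !mulr1.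
    by [].
have [_ l0] : false = false /\ l = [::] by apply: dl0; rewrite (negbTE ha).
have [s1 s2] := shape (Normal (Mul s B) [::] [::] false [::]) (fun _ => erefl) erefl erefl erefl.
exists (Normal (Mul s B) [::] [::] false [::]); split=> //.
+ have [w1 w2] : wf ar [:: y] (prodt G) /\ fv (prodt G) = [::].
    by apply: wf_prodt => // t; rewrite /G l0 cats0 => /hc[].
  split=> //; split; last by rewrite /= fs w2.
  by split=> //; split=> //; rewrite w2.
+ move=> I nu i j ex ey; rewrite (valB I nu i j ex) (r0 ha) nvalE !big_nil !mulr1.
  by [].
Qed.

Lemma simple_represented a b (e : expr a b) x y : x != y -> simple_matlang e -> represented e x y.
Proof.
move=> + h; elim: h x y => {a b e}.
- by move=> A x y; apply: represents_Mat.
- by move=> a x y _; apply: represents_Ones.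
- by move=> a x y _; apply: represents_Id.
- by move=> a b e _ IH x y ne; apply: represents_Tr; apply: IH; rewrite eq_sym.
- by move=> a b e1 e2 _ IH1 _ IH2 x y ne; apply: represented_Scale; [|apply: IH1|apply: IH2].
- move=> a b e1 e2 _ IH1 _ IH2 x y ne.
  have [N1 [k1 s1 m1 h1]] := IH1 x y ne; have [N2 [k2 s2 m2 h2]] := IH2 x y ne.
  exists (mul_normal N1 N2); split; [exact: normal_ok_mul|exact: shaped_mul|exact: simple_shape_mul|].
  exact: represents_Had.
- by move=> a b e _ IH x y ne; apply: represented_Sum => //; apply: IH.
Qed.

(** Excludes a row factor and a column factor around a common entry, the pattern R(x), A(x,y), S(y)
    in which the atoms of x and y overlap without inclusion. *)
Definition qh_shape N : Prop := diag N || (ents N != [::]) -> rowf N = [::] \/ colf N = [::].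

Definition qh_represented a b (e : expr a b) x y : Prop := exists N,
  [/\ normal_ok a b N x y, shaped a b N, qh_shape N & represents e N x y].

Lemma represents_row a b (e : expr a None) x y : x != y -> represented e x y ->
  exists s r, let N := Normal s r [::] false [::] in
  [/\ normal_ok a b N x y, shaped a b N & represents (EMul e (ETr (EOnes b))) N x y].
Proof.
move=> ne [[s r c d l] [[/= ws hr _ _ _] [/= r0 c0 dl0] _ h]].
have [d0 l0] : d = false /\ l = [::] by apply: dl0; rewrite andbF.
rewrite (c0 isT) {c0}d0 {dl0}l0 in h; exists s, r; split=> //.
move=> I nu i j ex ey; rewrite /= mxE big_ord1 !mxE mulr1 (h I (upd nu y 1)) ?updxx ?upd_neq //.
rewrite !nvalE !big_nil !mulr1; congr (_ * _)%R; first by apply: os_scal; case: ws.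
by rewrite !big_seq; apply: eq_bigr => t /hr ht; apply: os_factor ht _; rewrite upd_neq.
Qed.

Lemma represents_col a b (e : expr None b) x y : x != y -> represented e x y ->
  exists s c, let N := Normal s [::] c false [::] in
  [/\ normal_ok a b N x y, shaped a b N & represents (EMul (EOnes a) e) N x y].
Proof.
move=> ne [[s r c d l] [[/= ws _ hc _ _] [/= r0 c0 dl0] _ h]].
have [d0 l0] := dl0 isT.
rewrite (r0 isT) {r0}d0 {dl0}l0 in h; exists s, c; split=> //.
have ne' : y != x by rewrite eq_sym.
move=> I nu i j ex ey; rewrite /= mxE big_ord1 !mxE mul1r (h I (upd nu x 1)) ?updxx ?upd_neq //.
rewrite !nvalE !big_nil !mul1r !mulr1; congr (_ * _)%R; first by apply: os_scal; case: ws.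
by rewrite !big_seq; apply: eq_bigr => t /hc ht; apply: os_factor ht _; rewrite upd_neq.
Qed.

Lemma simple_qh_shape a b N : shaped a b N -> simple_shape a b N ->
  diag N || (ents N != [::]) -> rowf N = [::] /\ colf N = [::].
Proof.
case=> _ _ h3 h de; have ab : isSome a && isSome b.
  by apply: contraLR de => /h3[-> ->].
by have [-> ->] := h ab.
Qed.

Lemma qh_matlang_represented a b (e : expr a b) x y : x != y -> qh_matlang e -> qh_represented e x y.
Proof.
move=> ne; case=> {a b e} a b.
- move=> e1 /(simple_represented ne)[N [k s m h]]; exists N; split=> //.
  by move/(simple_qh_shape s m) => [-> _]; left.
- move=> e1 e2 /(simple_represented ne)[N [k s m h]] /(simple_represented ne)/(represents_row b ne).
  case=> s2 [r2 [k2 sh2 h2]]; exists (mul_normal N (Normal s2 r2 [::] false [::])); split.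
  + exact: normal_ok_mul.
  + exact: shaped_mul.
  + rewrite /qh_shape /= orbF cats0 => /(simple_qh_shape s m)[_ ->]; by right.
  + exact: represents_Had.
- move=> e1 e2 /(simple_represented ne)/(represents_col a ne)[s2 [c2 [k2 sh2 h2]]].
  move=> /(simple_represented ne)[N [k s m h]].
  exists (mul_normal (Normal s2 [::] c2 false [::]) N); split.
  + exact: normal_ok_mul.
  + exact: shaped_mul.
  + rewrite /qh_shape /= => /(simple_qh_shape s m)[-> _]; by left.
  + exact: represents_Had.
- move=> e1 e2 /(simple_represented ne)/(represents_col a ne)[s2 [c2 [k2 sh2 h2]]].
  move=> /(simple_represented ne)/(represents_row b ne)[s3 [r3 [k3 sh3 h3]]].
  exists (mul_normal (Normal s2 [::] c2 false [::]) (Normal s3 r3 [::] false [::])); split=> //.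
  + exact: normal_ok_mul.
  + exact: shaped_mul.
  + exact: represents_Had.
Qed.

(** * Plans for normal forms *)

(** The last clause is a restriction only for [hx = hy], where it says that nonzero entries lie on
    the diagonal. Values are compared inside the matrix only, as a normal form without factors in an
    index does not vanish outside. *)
Definition realizes (a b : option (sz S)) N x y T hx hy : Prop :=
  [/\ [/\ wf ar [::] T, uniq (fv T) & fv T =i [:: hx; hy]],
    forall I nu, os I T nu != 0%R -> (0 < nu hx <= dim I a) && (0 < nu hy <= dim I b),
    forall I nu nu', (0 < nu hx <= dim I a) && (0 < nu hy <= dim I b) ->
      nu' x = nu hx -> nu' y = nu hy -> os I T nu = nval I N x y nu' &
    forall I nu', nval I N x y nu' != 0%R -> exists nu, nu hx = nu' x /\ nu hy = nu' y].

(** Without any factor the index runs over its whole dimension. *)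
Definition comp x (a : option (sz S)) G : tree :=
  if G is t :: ts then Bind true x (mulall t ts) else Rng x (cidx (a : const (matvoc S))) [::].

Lemma comp_ok x a G : (forall t, t \in G -> factor_ok x a t) ->
  [/\ wf ar [::] (comp x a G), fv (comp x a G) = [:: x],
    forall I nu, os I (comp x a G) nu != 0%R -> 0 < nu x <= dim I a &
    forall I nu, 0 < nu x <= dim I a -> os I (comp x a G) nu = (\prod_(t <- G) os I t nu)%R].
Proof.
case: G => [|t ts] h.
  split=> // I nu; rewrite /= /mincst /= flat_cst_dim.
    by case: ifP => //; rewrite eqxx.
  by move=> ->; rewrite big_nil.
have [w f] : wf ar [:: x] (mulall t ts) /\ fv (mulall t ts) = [::].
  by apply: (@wf_prodt _ (t :: ts)) => // t' /h[].
have e I nu : os I (comp x a (t :: ts)) nu = (\prod_(t' <- t :: ts) os I t' nu)%R.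
  exact: os_prod.
split=> [|||I nu _].
- by split.
- by rewrite /= f.
- move=> I nu; rewrite e => nz; have [_ _ ht] := h t (mem_head _ _).
  by apply: ht (prod_neq0 nz _); rewrite mem_head.
- exact: e.
Qed.

Lemma os_ext I x y l nu nu' : nu x = nu' x -> nu y = nu' y ->
  os I (binleaf x y l) nu = os I (binleaf x y l) nu'.
Proof. by move=> ex ey; rewrite !os_binleaf; case: l.2; rewrite ex ey. Qed.

Lemma prod_factor_ext I x a G nu nu' : (forall t, t \in G -> factor_ok x a t) -> nu x = nu' x ->
  (\prod_(t <- G) os I t nu = \prod_(t <- G) os I t nu')%R.
Proof. by move=> h e; rewrite !big_seq; apply: eq_bigr => t /h ht; apply: os_factor ht e. Qed.

(** With a diagonal test one variable serves as row and column. Without entries the value is an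
    outer product of two independent enumerations. Otherwise [y] is enumerated inside [x]: the
    entries contain both variables, and the row factors join at the level of [x]; a column factor
    would not fit below both binders. *)
Lemma realizable a b N x y : x != y -> normal_ok a b N x y -> shaped a b N ->
  (diag N || (ents N != [::]) -> colf N = [::]) -> exists T hx hy, realizes a b N x y T hx hy.
Proof.
move=> ne [+ + + + +] _; case: N => s r c d l /= [ws fs] hr hc hl hd q.
case ed: d; subst d.
  rewrite q // in hc *; have ab := hd isT.
  pose G := r ++ [seq binleaf x x z | z <- l].
  have leafE I z nu : os I (binleaf x x z) nu = os I (binleaf x y z) (upd nu y (nu x)).
    by rewrite !os_binleaf; case: z.2; rewrite updxx upd_neq.
  have hG t : t \in G -> factor_ok x a t.
    rewrite mem_cat => /orP[/hr//|/mapP[z hz ->]]; split=> //.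
      split=> //; last by rewrite flat_ar_mrank; case: z.2.
      by move=> i; case: z.2; rewrite !inE orbb.
    by move=> I nu; rewrite leafE => /(hl z hz)/andP[+ _]; rewrite upd_neq.
  have [w f nz v] := comp_ok hG.
  exists (Mul s (comp x a G)), x, x; split.
  - split; [by split | by rewrite /= fs f |].
    by move=> i; rewrite /= fs f !inE orbb.
  - by move=> I nu /= /mul_neq0[_ /nz]; rewrite -ab => ->.
  - move=> I nu nu' /andP[hx _] ex ey; rewrite nvalE big_nil ex ey eqxx !mulr1 /= v //.
    congr (_ * _)%R; first exact: os_scal.
    rewrite /G big_cat big_map; congr (_ * _)%R; first exact: prod_factor_ext hr (esym ex).
    by apply: eq_bigr => z _; rewrite leafE; apply: os_ext; rewrite ?updxx ?upd_neq.
  - move=> I nu'; rewrite nvalE => nv; exists nu'; split=> //.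
    by apply/eqP; apply: contraNT nv => /negbTE->; rewrite !mulr0.
case: (eqVneq l [::]) => [l0|nl].
  have [w f nz v] := comp_ok hr; have [w' f' nz' v'] := comp_ok hc.
  exists (Mul s (Mul (comp x a r) (comp y b c))), x, y; split.
  - by split; rewrite /= ?fs ?f ?f' //= inE ne.
  - by move=> I nu /= /mul_neq0[_ /mul_neq0[/nz-> /nz'->]].
  - move=> I nu nu' /andP[hx hy] ex ey; rewrite nvalE l0 big_nil !mulr1 /= v // v' //.
    congr (_ * (_ * _))%R; [exact: os_scal | exact: prod_factor_ext hr (esym ex)
      | exact: prod_factor_ext hc (esym ey)].
  - by move=> I nu' _; exists nu'.
rewrite q // in hc *; pose G := [seq binleaf x y z | z <- l].
have nG : G != [::] by rewrite /G; case: (l) nl.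
have [w f] : wf ar [:: y; x] (prodt G) /\ fv (prodt G) = [::].
  apply: wf_prodt => // t' /mapP[z _ ->]; split=> //.
  by apply: wf_binleaf => i; rewrite !inE orbC.
have vB I nu : os I (Mul s (Bind true x (mulall (Bind true y (prodt G)) r))) nu =
    (os I s nu * ((\prod_(z <- l) os I (binleaf x y z) nu) * \prod_(t <- r) os I t nu))%R.
  rewrite -[LHS]/(os I s nu * os I (mulall (Bind true y (prodt G)) r) nu)%R os_prod big_cons.
  by rewrite -[X in (_ * (X * _))%R]/(os I (prodt G) nu) os_prodt // /G big_map.
have fr : flatten (map fv r) = [::].
  have: {in r, forall t, fv t = [::]} by move=> t /hr[].
  by elim: (r) => //= t r' IH h; rewrite h ?mem_head //= IH // => t' ht'; apply: h; rewrite inE ht' orbT.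
exists (Mul s (Bind true x (mulall (Bind true y (prodt G)) r))), x, y; split.
- split; last 2 first.
  + by rewrite /= fs fv_mulall fr /= f inE ne.
  + by move=> i; rewrite /= fs fv_mulall fr /= f.
  split=> //; split=> //; apply: wf_mulall => t; rewrite inE => /orP[/eqP->|/hr[]//].
  by split=> //; rewrite inE eq_sym.
- move=> I nu; rewrite vB => /mul_neq0[_ /mul_neq0[nz _]].
  have [z hz] : exists z, z \in l by case: (l) nl => // z l' _; exists z; rewrite mem_head.
  by apply: (hl z hz); move: nz; rewrite (big_rem z) //= => /mul_neq0[].
- move=> I nu nu' _ ex ey; rewrite vB nvalE big_nil !mulr1 [X in (_ * X)%R]mulrC.
  congr (_ * (_ * _))%R; [exact: os_scal | exact: prod_factor_ext hr (esym ex) |].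
  by apply: eq_bigr => z _; apply: os_ext.
- by move=> I nu' _; exists nu'.
Qed.

(** If the row factors are the missing ones, transposition reduces to the previous case, with the
    output columns exchanged. *)
Lemma qh_realizable a b N x y : x != y -> normal_ok a b N x y -> shaped a b N -> qh_shape N ->
  exists T hx hy, realizes a b N x y T hx hy.
Proof.
move=> ne k s q; case: (boolP (diag N || (ents N != [::]))) => de; last first.
  by apply: realizable => //; rewrite (negbTE de).
case: (q de) => r0; last by apply: realizable.
have [|T [hy [hx [[w u f] h1 h2 h3]]]]
  := realizable _ (normal_ok_swap (x := y) (y := x) k) (shaped_swap s) (fun _ => r0).
  by rewrite eq_sym.
exists T, hx, hy; split.
- by split=> // i; rewrite f !inE orbC.
- by move=> I nu; rewrite andbC; apply: h1.
- by move=> I nu nu' hr ex ey; rewrite (h2 I nu nu') ?nval_swap // andbC.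
- by move=> I nu' nz; have [|nu [e1 e2]] := h3 I nu'; [rewrite nval_swap | exists nu].
Qed.

Lemma matlang_solvable (P : prims K) (a b : option (sz S)) (e : expr a b) :
  semi_integral K -> sum_maintainable P -> qh_matlang e -> dyn_solvable P (DynEvalMatlang K e).
Proof.
move=> siK smP; have ne : 0 != 1 :> nat by [].
case/(qh_matlang_represented ne) => N [k s q h].
have [T [hx [hy [[w u f] h1 h2 h3]]]] := qh_realizable ne k s q.
pose pt (i j : nat) := upd (upd (fun=> 0) 0 i) 1 j.
apply: (matlang_reduce (hx := hx) (hy := hy)) siK smP w u f _ _ => [I nu nz|I i j nz].
  have hr := h1 I nu nz; have /andP[/andP[x0 xl] /andP[y0 yl]] := hr.
  have lx : (nu hx).-1 < dim I a by rewrite prednK.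
  have ly : (nu hy).-1 < dim I b by rewrite prednK.
  exists (Ordinal lx), (Ordinal ly); rewrite /= !prednK //; split=> //.
  by rewrite (h2 I nu (pt (nu hx) (nu hy)) hr) // -(h I _ (Ordinal lx) (Ordinal ly)) //= prednK.
have e1 : Defs.eval I e i j = nval I N 0 1 (pt i.+1 j.+1) by apply: h.
rewrite e1 in nz *; have [nu [ex ey]] := h3 I _ nz.
exists nu; split=> //; apply/esym; apply: h2 => //.
by rewrite ex ey /= !ltn_ord.
Qed.

End NormalForm.

Theorem theorem13 (K : comNzSemiRingType) (P : prims K)
    (semi_integralK : semi_integral K) (sum_maintainableK : sum_maintainable P) :
  (forall (sg : vocabulary) (Q : cq sg),
     q_hierarchical Q -> dyn_solvable P (DynEvalCQ K Q)) /\
  (forall (S : schema) (a b : option (sz S)) (e : expr a b),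
     qh_matlang e -> dyn_solvable P (DynEvalMatlang K e)).
Proof.
split=> [sg Q qh|S a b e qh]; first exact: cq_solvable.
exact: matlang_solvable.
Qed.
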